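(* Let $T$ be a unitary operator on $L^2(\mathbb{R})$ with $T\neq I$ (the identity operator), and suppose that $T$ is semistable, translation-invariant, symmetric, and locally uniformly continuous (LUC) under dilation. Let $\alpha\in\mathbb{R}\setminus\{0\}$. Then $T$ is a Schrödinger operator of order $\alpha$ if and only if $$T^2=T_{2^{1/\alpha}}.$$
   Context: $L^2(\mathbb{R})$ is the space of complex-valued Lebesgue square-integrable functions on $\mathbb{R}$ modulo a.e. equality, and $\mathscr{L}(L^2(\mathbb{R}))$ is the space of bounded linear operators on it. The Fourier transform is the unitary one, $\hat f(\xi)=\frac{1}{\sqrt{2\pi}}\int_{\mathbb{R}} f(x)e^{-i\xi x}\,dx$ (extended to $L^2$ as usual). For $\lambda\in\mathbb{R}\setminus\{0\}$ and $a\in\mathbb{R}$, set $\delta_\lambda f(x)=\frac{1}{|\lambda|}f(x/\lambda)$ and $\tau_a f(x)=f(x-a)$. For $T\in\mathscr{L}(L^2(\mathbb{R}))$ and $\lambda\in\mathbb{R}\setminus\{0\}$, set $T_\lambda=\delta_\lambda\,T\,\delta_{\lambda^{-1}}$. For $R>1$, $L^2_R(\mathbb{R})=\{f\in L^2(\mathbb{R}): \hat f(\xi)=0 \text{ for a.e. }\xi\text{ with }|\xi|<R^{-1}\text{ or }|\xi|>R\}$. Definitions for $T\in\mathscr{L}(L^2(\mathbb{R}))$: - $T$ is semistable if there exist constants $a,b>0$ such that $T^2=T_a$ and $T^3=T_b$. - $T$ is translation-invariant if $\tau_{-a}T\tau_a=T$ for all $a\in\mathbb{R}$. - $T$ is symmetric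 if $T_{-1}=T$. - $T$ is locally uniformly continuous (LUC) under dilation if for every $R>1$ the map $\lambda\mapsto T_\lambda|_{L^2_R(\mathbb{R})}$, from $(0,\infty)$ to the bounded operators $L^2_R(\mathbb{R})\to L^2(\mathbb{R})$, is continuous with respect to the operator norm. Schrödinger operator: suppose a unitary operator $T$ satisfies $\widehat{Tf}(\xi)=e^{i\beta|\xi|^{\alpha}}\hat f(\xi)$ for all $f\in L^2(\mathbb{R})$, for some $\alpha\in\mathbb{R}\setminus\{0\}$ and $\beta\in\mathbb{R}$. Define $\alpha(T)=0$ if $T=I$ and $\alpha(T)=\alpha$ if $T\neq I$ (in the latter case $\alpha,\beta$ are uniquely determined by $T$). Then $T$ is called a Schrödinger operator of order $\alpha(T)$. *)

(* Defs.v *)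
From HB Require Import structures.
From mathcomp Require Import all_boot all_order all_algebra.
From mathcomp Require Import all_classical all_reals all_analysis.
From mathcomp Require Import measurable_realfun.
From mathcomp Require Import complex ring lra.

Set Implicit Arguments.
Unset Strict Implicit.
Unset Printing Implicit Defensive.

Import Order.TTheory GRing.Theory Num.Theory.
Import numFieldNormedType.Exports.
Import ComplexField.Normc.

Local Open Scope classical_set_scope.
Local Open Scope ring_scope.
Local Open Scope complex_scope.
Local Open Scope quotient_scope.

Local Notation Re := complex.Re.
Local Notation Im := complex.Im.

(* `R` is a model of the real line and `R[i]` of the complex numbers; `normc`
   is the modulus, with values in `R`. *)

Definition cmeasurable (R : realType) (f : R -> R[i]) : Prop :=
  measurable_fun [set: R] (fun x => Re (f x)) /\
  measurable_fun [set: R] (fun x => Im (f x)).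

Definition cintegrable (R : realType) (f : R -> R[i]) : Prop :=
  cmeasurable f /\
  (\int[lebesgue_measure]_x (normc (f x))%:E < +oo)%E.

Definition cintegral (R : realType) (f : R -> R[i]) : R[i] :=
  (\int[lebesgue_measure]_x Re (f x)) +i*
  (\int[lebesgue_measure]_x Im (f x)).

Definition expi (R : realType) (t : R) : R[i] := cos t +i* sin t.

Definition sqint (R : realType) : {pred R -> R[i]} :=
  mem [set f : R -> R[i] | cmeasurable f /\
    (\int[lebesgue_measure]_x ((normc (f x)) ^+ 2)%:E < +oo)%E].

Lemma normc2E (R : realType) (z : R[i]) :
  (normc z) ^+ 2 = Re z ^+ 2 + Im z ^+ 2.
Proof. by case: z => a b /=; rewrite sqr_sqrtr// addr_ge0// sqr_ge0. Qed.

Lemma normc2D_le (R : realType) (z w : R[i]) :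
  (normc (z + w)) ^+ 2 <= 2 * (normc z) ^+ 2 + 2 * (normc w) ^+ 2.
Proof.
rewrite !normc2E; case: z w => u v [s t] /=.
have := sqr_ge0 (u - s); have := sqr_ge0 (v - t); lra.
Qed.

Lemma measurable_normc2 (R : realType) (f : R -> R[i]) : cmeasurable f ->
  measurable_fun [set: R] (fun x => (normc (f x)) ^+ 2).
Proof.
move=> [mr mi]; under eq_fun do rewrite normc2E.
by apply: measurable_funD; apply: measurable_funX.
Qed.

Lemma sqint_submod_closed (R : realType) : submod_closed (@sqint R).
Proof.
split.
  rewrite inE; split; first by split; exact: measurable_cst.
  under eq_integral do rewrite /= expr0n addr0 sqrtr0 expr0n.
  by rewrite integral0.
move=> a f g /[!inE] -[[mfr mfi] f2] [[mgr mgi] g2].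
have mh : cmeasurable (a *: f + g).
  case: a => ar ai; split.
  - have -> : (fun x => Re ((ar +i* ai *: f + g) x)) =
        (fun x => ar * Re (f x) - ai * Im (f x) + Re (g x)).
      by apply/funext => x /=; rewrite !fctE; case: (f x) (g x) => ? ? [].
    apply: measurable_funD => //; apply: measurable_funB; exact: measurable_funM.
  - have -> : (fun x => Im ((ar +i* ai *: f + g) x)) =
        (fun x => ar * Im (f x) + ai * Re (f x) + Im (g x)).
      apply/funext => x /=; rewrite !fctE; case: (f x) (g x) => ? ? [? ?] /=.
      by [].
    apply: measurable_funD => //; apply: measurable_funD; exact: measurable_funM.
split => //.
pose F x := ((2 * (normc a) ^+ 2)%:E * ((normc (f x)) ^+ 2)%:E +
             2%:E * ((normc (g x)) ^+ 2)%:E)%E.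
apply: (@le_lt_trans _ _ (\int[lebesgue_measure]_x F x)%E).
  apply: ge0_le_integral => //.
  - by move=> x _; rewrite lee_fin sqr_ge0.
  - by apply/measurable_EFinP; exact: measurable_normc2.
  - apply: emeasurable_funD; apply: emeasurable_funM => //;
      by apply/measurable_EFinP; apply: measurable_normc2.
  move=> x _; rewrite /F -!EFinM -EFinD lee_fin !fctE.
  by rewrite -mulrA -exprMn -normcM; exact: normc2D_le.
have kn0 : 0 <= 2 * (normc a) ^+ 2 by rewrite mulr_ge0// sqr_ge0.
have IZ k (h : R -> R[i]) : 0 <= k -> cmeasurable h ->
    (\int[lebesgue_measure]_x (k%:E * ((normc (h x)) ^+ 2)%:E) =
     k%:E * \int[lebesgue_measure]_x ((normc (h x)) ^+ 2)%:E)%E.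
  move=> k0 mh'; apply: ge0_integralZl => //.
    by apply/measurable_EFinP; exact: measurable_normc2.
  by move=> x _; rewrite lee_fin sqr_ge0.
rewrite /F ge0_integralD//=.
- rewrite !IZ//; apply: lte_add_pinfty; exact: lte_mul_pinfty.
- by move=> x _; apply: mule_ge0; rewrite lee_fin ?sqr_ge0.
- by apply: emeasurable_funM => //; apply/measurable_EFinP; exact: measurable_normc2.
- by move=> x _; apply: mule_ge0; rewrite lee_fin ?sqr_ge0.
- by apply: emeasurable_funM => //; apply/measurable_EFinP; exact: measurable_normc2.
Qed.

HB.instance Definition _ (R : realType) :=
  GRing.isSubmodClosed.Build R[i] (R -> R[i]) (@sqint R)
    (@sqint_submod_closed R).

Record sqfun (R : realType) :=
  SqFun { sqfun_fun :> R -> R[i]; sqfunP : sqfun_fun \in @sqint R }.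

HB.instance Definition _ (R : realType) := [isSub for @sqfun_fun R].
HB.instance Definition _ (R : realType) := [Choice of sqfun R by <:].
HB.instance Definition _ (R : realType) :=
  [SubChoice_isSubLmodule of sqfun R by <:].

Definition null (R : realType) : {pred sqfun R} :=
  mem [set f : sqfun R | \forall x \ae lebesgue_measure, f x = 0].

Lemma null_submod_closed (R : realType) : submod_closed (@null R).
Proof.
split; first by rewrite inE /=; exact/aeW.
move=> a f g /[!inE] /= f0 g0.
have F : Filter (nbhs (almost_everywhere (@lebesgue_measure R))).
  by apply: ae_filter_ringOfSetsType.
apply: filterS2 f0 g0 => x /= fx0 gx0.
by rewrite !fctE fx0 gx0 scaler0 addr0.
Qed.

HB.instance Definition _ (R : realType) :=
  GRing.isSubmodClosed.Build R[i] (sqfun R) (@null R) (@null_submod_closed R).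


Definition L2 (R : realType) : Type := @Quotient.quot (sqfun R) (@null R).
HB.instance Definition _ (R : realType) := GRing.Zmodule.on (L2 R).
HB.instance Definition _ (R : realType) := EqQuotient.on (L2 R).

Definition toL2 (R : realType) (f : sqfun R) : L2 R := \pi_(L2 R) f.

Definition L2repr (R : realType) (u : L2 R) : sqfun R := repr u.
Coercion L2repr : L2 >-> sqfun.

Lemma toL2W (R : realType) (P : L2 R -> Prop) :
  (forall f, P (toL2 f)) -> forall u, P u.
Proof. exact: quotW. Qed.

Lemma toL2D (R : realType) (f g : sqfun R) : toL2 (f + g) = toL2 f + toL2 g.
Proof. exact: raddfD. Qed.

Definition L2scale (R : realType) (a : R[i]) (u : L2 R) : L2 R :=
  toL2 (a *: (u : sqfun R)).

Lemma toL2Z (R : realType) (a : R[i]) (f : sqfun R) :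
  L2scale a (toL2 f) = toL2 (a *: f).
Proof.
apply/eqP; rewrite -Quotient.idealrBE -scalerBr rpredZ//.
by rewrite Quotient.idealrBE reprK.
Qed.

Lemma L2scaleA (R : realType) (a b : R[i]) (u : L2 R) :
  L2scale a (L2scale b u) = L2scale (a * b) u.
Proof.
elim/toL2W: u => f.
by rewrite [L2scale b _]toL2Z [LHS]toL2Z [RHS]toL2Z scalerA.
Qed.

Lemma L2scale1 (R : realType) : left_id 1 (@L2scale R).
Proof. by elim/toL2W => f; rewrite toL2Z scale1r. Qed.

Lemma L2scaleDr (R : realType) : right_distributive (@L2scale R) +%R.
Proof.
move=> a; elim/toL2W => f; elim/toL2W => g.
by rewrite -toL2D [LHS]toL2Z scalerDr toL2D -!toL2Z.
Qed.

Lemma L2scaleDl (R : realType) (u : L2 R) :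
  {morph (@L2scale R)^~ u : a b / a + b}.
Proof.
by elim/toL2W: u => f a b; rewrite [LHS]toL2Z scalerDl toL2D -!toL2Z.
Qed.

HB.instance Definition _ (R : realType) :=
  GRing.Zmodule_isLmodule.Build R[i] (L2 R)
    (@L2scaleA R) (@L2scale1 R) (@L2scaleDr R) (@L2scaleDl R).

Lemma lebesgue_measure_affine (R : realType) (a b : R)
    (A : set (measurableTypeR R)) : a != 0 -> measurable A ->
  (lebesgue_measure A =
   `|a|%:E * lebesgue_measure ((fun x => (a * x + b)%R) @^-1` A))%E.
Proof.
move=> a0 mA.
pose phi : measurableTypeR R -> measurableTypeR R := fun x => a * x + b.
have mphi : measurable_fun [set: measurableTypeR R] phi.
  by apply: measurable_funD => //; exact: measurable_funM.
have k0 : 0 <= `|a| by [].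
pose pm_ : {measure set (measurableTypeR R) -> \bar R} :=
  pushforward lebesgue_measure phi.
pose pm := pm_ mphi.
pose nu : {measure set (measurableTypeR R) -> \bar R} := mscale (NngNum k0) pm.
suff H X : ocitv X -> lebesgue_measure X = nu X.
  exact: (lebesgue_measure_unique H).
move=> [[c d] _ <-].
have an0 : 0 < `|a| by rewrite normr_gt0.
have -> : nu [set` `]c, d]] =
    (`|a|%:E * lebesgue_measure (phi @^-1` [set` `]c, d]]))%E by [].
have -> : phi @^-1` [set` `]c, d]] = if 0 < a then
   [set` `](c - b) / a, (d - b) / a] ] else [set` `[(d - b) / a, (c - b) / a[ ].
  apply/seteqP; rewrite /phi; case: ltP => a1; split => x /=; rewrite !in_itv/=.
  - by rewrite ler_pdivlMr// ltr_pdivrMr// ltrBlDr lerBrDr mulrC.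
  - by rewrite ler_pdivlMr// ltr_pdivrMr// ltrBlDr lerBrDr mulrC.
  - rewrite ler_ndivrMr ?ltr_ndivlMr; first last.
    + by rewrite lt_neqAle a0.
    + by rewrite lt_neqAle a0.
    by rewrite ltrBlDr lerBrDr mulrC andbC.
  - rewrite ler_ndivrMr ?ltr_ndivlMr; first last.
    + by rewrite lt_neqAle a0.
    + by rewrite lt_neqAle a0.
    by rewrite ltrBlDr lerBrDr mulrC andbC.
case: ltP => a1; rewrite !lebesgue_measure_itv/= !lte_fin.
- rewrite ltr_pM2r ?invr_gt0// ltrD2r; case: ifP => _; last by rewrite mule0.
  by rewrite -!EFinB -EFinM gtr0_norm//; congr EFin; field.
- have a2 : a < 0 by rewrite lt_neqAle a0.
  rewrite ltr_nM2r ?invr_lt0// ltrD2r; case: ifP => _; last by rewrite mule0.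
  by rewrite -!EFinB -EFinM ltr0_norm//; congr EFin; field.
Qed.

Lemma ge0_integral_affine (R : realType) (a b : R) (f : R -> \bar R) :
  a != 0 -> measurable_fun [set: measurableTypeR R] f ->
  (forall x, 0 <= f x)%E ->
  (\int[lebesgue_measure]_x f x =
   `|a|%:E * \int[lebesgue_measure]_x f (a * x + b)%R)%E.
Proof.
move=> a0 mf f0.
pose phi : measurableTypeR R -> measurableTypeR R := fun x => a * x + b.
have mphi : measurable_fun [set: measurableTypeR R] phi.
  by apply: measurable_funD => //; exact: measurable_funM.
have k0 : 0 <= `|a| by [].
pose pm_ : {measure set (measurableTypeR R) -> \bar R} :=
  pushforward lebesgue_measure phi.
pose pm := pm_ mphi.
pose nu : {measure set (measurableTypeR R) -> \bar R} := mscale (NngNum k0) pm.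
transitivity (\int[nu]_x f x)%E.
  apply: eq_measure_integral => A mA _.
  exact: lebesgue_measure_affine.
rewrite ge0_integral_mscale//; congr (_ * _)%E.
by rewrite ge0_integral_pushforward.
Qed.

Lemma sqint_affine (R : realType) (c : R[i]) (a b : R) (f : sqfun R) :
  a != 0 -> (fun x => c * f (a * x + b)) \in @sqint R.
Proof.
move=> a0; have [[mr mi] f2] := set_mem (sqfunP f).
have mphi : measurable_fun [set: R] (fun x : R => a * x + b).
  by apply: measurable_funD => //; exact: measurable_funM.
have mg : cmeasurable (fun x => f (a * x + b)).
  have mr' := measurableT_comp mr mphi.
  have mi' := measurableT_comp mi mphi.
  by split.
pose g : R -> R[i] := fun x => f (a * x + b).
rewrite (_ : (fun x => _) = c *: g)//; apply: rpredZ.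
rewrite inE; split => //.
move: f2; rewrite (@ge0_integral_affine R a b)//; last 2 first.
- by apply/measurable_EFinP; exact: measurable_normc2.
- by move=> x; rewrite lee_fin sqr_ge0.
rewrite ltey => h; rewrite ltey; apply: contra h => /eqP ->.
by rewrite gt0_muley// lte_fin normr_gt0.
Qed.

Lemma sqint_dilate (R : realType) (lam : R) (f : sqfun R) :
  (fun x => (`|lam|^-1)%:C * f (x / lam)) \in @sqint R.
Proof.
have [->|l0] := eqVneq lam 0.
  have -> : (fun x => (`|0 : R|^-1)%:C * f (x / 0)) = 0.
    by apply/funext => x; rewrite normr0 invr0 mul0r.
  exact: rpred0.
rewrite (_ : (fun x => _) =
    (fun x => (`|lam|^-1)%:C * f (lam^-1 * x + 0))) ?sqint_affine ?invr_eq0//.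
by apply/funext => x; rewrite addr0 (mulrC lam^-1).
Qed.

Lemma sqint_translate (R : realType) (a : R) (f : sqfun R) :
  (fun x => f (x - a)) \in @sqint R.
Proof.
rewrite (_ : (fun x => _) = (fun x => 1 * f (1 * x + - a))) ?sqint_affine//.
by apply/funext => x; rewrite !mul1r.
Qed.

(* The class of the result does not depend on the representative of `u`. For
   `lam = 0` this is the zero map (division by 0 gives 0). *)
Definition dilate (R : realType) (lam : R) (u : L2 R) : L2 R :=
  toL2 (SqFun (sqint_dilate lam u)).

Definition translate (R : realType) (a : R) (u : L2 R) : L2 R :=
  toL2 (SqFun (sqint_translate a u)).

Definition L2norm (R : realType) (u : L2 R) : R :=
  Num.sqrt (fine (\int[lebesgue_measure]_x ((normc (u x)) ^+ 2)%:E)%E).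

Definition L2inner (R : realType) (u v : L2 R) : R[i] :=
  cintegral (fun x => u x * conjc (v x)).

Definition bounded_operator (R : realType) (T : L2 R -> L2 R) : Prop :=
  linear T /\ exists M : R, forall u, L2norm (T u) <= M * L2norm u.

Definition unitary (R : realType) (T : L2 R -> L2 R) : Prop :=
  [/\ bounded_operator T, (forall v, exists u, T u = v) &
      forall u v, L2inner (T u) (T v) = L2inner u v].

Definition fourier_integral (R : realType) (f : R -> R[i]) (xi : R) : R[i] :=
  ((Num.sqrt (2 * pi))^-1)%:C * cintegral (fun x => f x * expi (- (xi * x))).

(* The extension of the Fourier integral from the dense subspace of integrable
   elements of L2 to a bounded operator on L2. *)
Definition is_fourier_extension (R : realType) (F : L2 R -> L2 R) : Prop :=
  bounded_operator F /\
  forall u : L2 R, cintegrable u ->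
    \forall xi \ae lebesgue_measure, F u xi = fourier_integral u xi.

(* Existence and uniqueness of the extension (Plancherel) make the default
   value irrelevant. *)
Definition fourier (R : realType) : L2 R -> L2 R :=
  xget (fun=> 0) [set F | @is_fourier_extension R F].

Definition dilated (R : realType) (T : L2 R -> L2 R) (lam : R) : L2 R -> L2 R :=
  dilate lam \o T \o dilate lam^-1.

Definition semistable (R : realType) (T : L2 R -> L2 R) : Prop :=
  exists a b : R, [/\ 0 < a, 0 < b, T \o T = dilated T a &
                      T \o T \o T = dilated T b].

Definition translation_invariant (R : realType) (T : L2 R -> L2 R) : Prop :=
  forall a : R, translate (- a) \o T \o translate a = T.

Definition symmetric_op (R : realType) (T : L2 R -> L2 R) : Prop :=
  dilated T (- 1) = T.

Definition L2band (R : realType) (r : R) : set (L2 R) :=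
  [set u | \forall xi \ae lebesgue_measure,
    `|xi| < r^-1 \/ r < `|xi| -> fourier u xi = 0].

Definition opnorm_on (R : realType) (D : set (L2 R)) (S : L2 R -> L2 R) :
    \bar R :=
  ereal_sup [set (L2norm (S u))%:E | u in [set u | D u /\ L2norm u <= 1]].

(* Continuity at every point of the open set of positive reals. *)
Definition LUC (R : realType) (T : L2 R -> L2 R) : Prop :=
  forall r : R, 1 < r -> forall lam0 : R, 0 < lam0 ->
    opnorm_on (L2band r) (fun u => dilated T lam u - dilated T lam0 u)
      @[lam --> lam0] --> 0%E.

Definition schrodinger_multiplier (R : realType) (alpha beta : R)
    (T : L2 R -> L2 R) : Prop :=
  forall u : L2 R, \forall xi \ae lebesgue_measure,
    fourier (T u) xi = expi (beta * `|xi| `^ alpha) * fourier u xi.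

Definition schrodinger_of_order (R : realType) (T : L2 R -> L2 R) (s : R) :
    Prop :=
  unitary T /\
  exists alpha beta : R, [/\ alpha != 0, schrodinger_multiplier alpha beta T &
    s = if `[< T = idfun >] then 0 else alpha].

(* Main.v *)
(** A translation-invariant unitary [T] is a Fourier multiplier: comparing
    [<T tau_a u, T w>] with [<tau_a u, w>] for all [a] and using uniqueness of
    Fourier transforms of integrable functions gives
    [F(Tu) conj (F(Tw)) = F u conj (F w)] a.e., and choosing [w = exp (-|x|)],
    whose transform has no zero, produces [m] of modulus 1 with [F(Tu) = m F u].
    Dilating [T] by [c] turns [m] into [m (c xi)].  Local uniform continuity
    says that [m (lam xi) - m xi] is essentially small on compact bands for
    [lam] near 1, so that, comparing averages at Lebesgue points, [m] agrees
    a.e. on the half line with a continuous [g].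

    If [T^2 = T_{2^{1/alpha}}] and [T^3 = T_b], then [M s = g (exp (s / alpha))]
    satisfies [M (s + ln 2) = M s ^ 2] and [M (s + B) = M s ^ 3].  A suitable
    continuous lift [H] of the argument of [M] satisfies [H (s + ln 2) = 2 H s]
    and [H (s + B) = 3 H s].  Now [P s = H s exp (-s)] has period [ln 2], hence is
    bounded, and is multiplied by [3 exp (-B)] under the shift by [B]; so either
    [P = 0], or [B = ln 3] and [P] has the incommensurable periods [ln 2] and
    [ln 3].  In both cases [P] is a constant [beta].

    The Fourier transform is built on the way: Bessel's inequality on integrable
    square-integrable functions comes from the weight [exp (-t |xi|)] and its
    transform, the Poisson kernel, and [F F u (x) = u (-x)] makes [F] unitary. *)

Require Import Defs.
From mathcomp Require Import all_boot all_order all_algebra.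
From mathcomp Require Import all_classical all_reals all_analysis.
From mathcomp Require Import measurable_realfun.
From mathcomp Require Import complex ring lra.

Set Implicit Arguments.
Unset Strict Implicit.
Unset Printing Implicit Defensive.

Import Order.TTheory GRing.Theory Num.Theory.
Import numFieldNormedType.Exports.
Import ComplexField.Normc.

Local Open Scope classical_set_scope.
Local Open Scope ring_scope.
Local Open Scope complex_scope.
Local Open Scope quotient_scope.

Local Notation Re := complex.Re.
Local Notation Im := complex.Im.
Local Notation mu := lebesgue_measure.

(** The doubling relation alone does not determine the phase: it also holds when [|xi|^alpha] is
    multiplied by any continuous function of [ln |xi|] with period [ln 2 / |alpha|]. The relation
    for [T^3] serves to exclude these, although its constant [b] is unrelated to [alpha] at the
    outset.

    The obstacle on the way there is that operator identities give multiplier identities only almost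
    everywhere, with a null set that varies with the dilation. No value of [m] can be compared
    pointwise, so the functional equations are stated for the continuous function [g], for which
    a.e. equality on the half line is equality everywhere. The substitution [x = exp (s / alpha)]
    then turns dilations into shifts, with [B = alpha * ln b], and symmetry of [T] supplies the
    negative half line.

    The converse implication is a computation: [|2^(1/alpha) xi|^alpha = 2 |xi|^alpha], and since
    [T] is not the identity its order is the exponent itself.

    Estimates are stated for squared norms. The triangle and Cauchy-Schwarz inequalities are
    replaced by versions with a free weight, chosen at the end. *)

#[local] Instance ae_lebesgue_filter (R : realType) :
  Filter (nbhs (almost_everywhere (@lebesgue_measure R))).
Proof. exact: ae_filter_ringOfSetsType. Qed.

Lemma oppr1_neq0 (R : realType) : - 1 != 0 :> R.
Proof. by rewrite oppr_eq0 oner_eq0. Qed.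

Lemma invSn_gt0 (R : realType) n : 0 < n.+1%:R^-1 :> R.
Proof. by rewrite invr_gt0. Qed.

(** * Complex-valued functions *)

Section ComplexNumbers.
Variable R : realType.
Implicit Types z w : R[i].

Lemma normc_ge0 z : 0 <= normc z.
Proof. by case: z => a b; exact: sqrtr_ge0. Qed.

Lemma normc_Re_le z : `|Re z| <= normc z.
Proof.
case: z => a b /=; rewrite -sqrtr_sqr ler_sqrt ?lerDl ?sqr_ge0//.
by rewrite addr_ge0 ?sqr_ge0.
Qed.

Lemma normc_Im_le z : `|Im z| <= normc z.
Proof.
case: z => a b /=; rewrite -sqrtr_sqr ler_sqrt ?lerDr ?sqr_ge0//.
by rewrite addr_ge0 ?sqr_ge0.
Qed.

Lemma normc_le_ReIm z : normc z <= `|Re z| + `|Im z|.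
Proof.
rewrite -(@ler_pXn2r _ 2)// ?nnegrE ?normc_ge0 ?addr_ge0//.
rewrite normc2E sqrrD !real_normK ?num_real// addrAC lerDl mulrn_wge0//.
Qed.

Lemma normc_conjc z : normc z^* = normc z.
Proof. by case: z => a b /=; rewrite sqrrN. Qed.

Lemma mulc_conjc z : z * z^* = (normc z ^+ 2)%:C.
Proof.
rewrite normc2E; case: z => a b /=; apply/eqP; rewrite eq_complex/=.
by apply/andP; split; apply/eqP; ring.
Qed.

Lemma normc_real (a : R) : normc a%:C = `|a|.
Proof. by rewrite /= expr0n addr0 sqrtr_sqr. Qed.

Lemma normc_expi (t : R) : normc (expi t) = 1.
Proof. by rewrite /= cos2Dsin2 sqrtr1. Qed.

Lemma expiD (s t : R) : expi (s + t) = expi s * expi t.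
Proof.
rewrite /expi cosD sinD; apply/eqP; rewrite eq_complex/=.
by apply/andP; split; apply/eqP; ring.
Qed.

Lemma expi0 : expi (0 : R) = 1.
Proof. by rewrite /expi cos0 sin0. Qed.

Lemma conjc_expi (t : R) : (expi t)^* = expi (- t).
Proof. by rewrite /expi cosN sinN. Qed.

Lemma ReM z w : Re (z * w) = Re z * Re w - Im z * Im w.
Proof. by case: z w => a b []. Qed.

Lemma ImM z w : Im (z * w) = Re z * Im w + Im z * Re w.
Proof. by case: z w => a b []. Qed.

Lemma ReD z w : Re (z + w) = Re z + Re w.
Proof. by case: z w => a b []. Qed.

Lemma ImD z w : Im (z + w) = Im z + Im w.
Proof. by case: z w => a b []. Qed.

Lemma ReN z : Re (- z) = - Re z.
Proof. by case: z. Qed.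

Lemma ImN z : Im (- z) = - Im z.
Proof. by case: z. Qed.

Lemma Re_conjc z : Re z^* = Re z. Proof. by case: z. Qed.

Lemma Im_conjc z : Im z^* = - Im z. Proof. by case: z. Qed.

Lemma complex_eqP z w : Re z = Re w -> Im z = Im w -> z = w.
Proof. by case: z w => a b [c d] /= -> ->. Qed.

End ComplexNumbers.

Definition cE := (ReM, ImM, ReD, ImD, ReN, ImN, Re_conjc, Im_conjc).

Section ComplexFunctions.
Variable R : realType.
Implicit Types (f g : R -> R[i]) (c : R[i]).

Lemma measurable_opp (h : R -> R) :
  measurable_fun [set: R] h -> measurable_fun [set: R] (fun x => - h x).
Proof. by move=> mh; apply: measurableT_comp mh. Qed.

Lemma cmeasurable_cst c : cmeasurable (fun=> c : R[i]).
Proof. by split; exact: measurable_cst. Qed.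

Lemma cmeasurableD f g :
  cmeasurable f -> cmeasurable g -> cmeasurable (fun x => f x + g x).
Proof.
move=> [mf mf'] [mg mg']; split; under eq_fun do rewrite cE.
  exact: measurable_funD.
exact: measurable_funD.
Qed.

Lemma cmeasurableM f g :
  cmeasurable f -> cmeasurable g -> cmeasurable (fun x => f x * g x).
Proof.
move=> [mf mf'] [mg mg']; split; under eq_fun do rewrite cE.
  by apply: measurable_funB; exact: measurable_funM.
by apply: measurable_funD; exact: measurable_funM.
Qed.

Lemma cmeasurableB f g :
  cmeasurable f -> cmeasurable g -> cmeasurable (fun x => f x - g x).
Proof.
move=> mf [mg mg']; apply: cmeasurableD => //; split;
  under eq_fun do rewrite cE; exact: measurable_opp.
Qed.

Lemma cmeasurable_conjc f : cmeasurable f -> cmeasurable (fun x => (f x)^*).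
Proof.
move=> [mf mf']; split; under eq_fun do rewrite cE; first exact: mf.
exact: measurable_opp.
Qed.

Lemma cmeasurable_real (f : R -> R) :
  measurable_fun [set: R] f -> cmeasurable (fun x => (f x)%:C).
Proof. by move=> mf; split => //=; exact: measurable_cst. Qed.

Lemma cmeasurable_comp f (h : R -> R) :
  cmeasurable f -> measurable_fun [set: R] h -> cmeasurable (fun x => f (h x)).
Proof.
move=> [mf mf'] mh; have h1 := measurableT_comp mf mh.
have h2 := measurableT_comp mf' mh; by split.
Qed.

Lemma measurable_cos : measurable_fun [set: R] (@cos R).
Proof. by apply: continuous_measurable_fun; exact: continuous_cos. Qed.

Lemma measurable_sin : measurable_fun [set: R] (@sin R).
Proof. by apply: continuous_measurable_fun; exact: continuous_sin. Qed.

Lemma cmeasurable_expi (h : R -> R) :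
  measurable_fun [set: R] h -> cmeasurable (fun x => expi (h x)).
Proof.
move=> mh; have h1 := measurableT_comp measurable_cos mh.
have h2 := measurableT_comp measurable_sin mh; by split.
Qed.

Lemma measurable_normc f : cmeasurable f ->
  measurable_fun [set: R] (fun x => normc (f x)).
Proof.
move=> mf; have -> : (fun x => normc (f x)) = (fun x => Num.sqrt (normc (f x) ^+ 2)).
  by apply/funext => x; rewrite sqrtr_sqr ger0_norm ?normc_ge0.
exact: (measurableT_comp (continuous_measurable_fun (@sqrt_continuous R))
  (measurable_normc2 mf)).
Qed.

Lemma affine_measurable (a b : R) : measurable_fun [set: R] (fun x : R => a * x + b).
Proof. by apply: measurable_funD => //; exact: measurable_funM. Qed.

Lemma cmeasurable_affine f (a b : R) :
  cmeasurable f -> cmeasurable (fun x => f (a * x + b)).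
Proof. by move=> mf; apply: cmeasurable_comp mf (affine_measurable a b). Qed.

(** Integrability of the modulus is traded for integrability of the two components, so that
    linearity of the complex integral reduces to the real one. *)
Lemma cintegrableP f : cintegrable f <->
  mu.-integrable [set: R] (EFin \o (fun x => Re (f x))) /\
  mu.-integrable [set: R] (EFin \o (fun x => Im (f x))).
Proof.
split=> [[mf fi]|[fr fi]].
  have [mr mi] := mf.
  have mn := measurable_normc mf.
  have nI : mu.-integrable [set: R] (EFin \o (fun x => normc (f x))).
    apply/integrableP; split; first exact/measurable_EFinP.
    by under eq_integral do rewrite /= ger0_norm ?normc_ge0//.
  split; apply: le_integrable nI => //; try exact/measurable_EFinP.
    move=> x _ /=; rewrite lee_fin (ger0_norm (normc_ge0 _)); exact: normc_Re_le.
  move=> x _ /=; rewrite lee_fin (ger0_norm (normc_ge0 _)); exact: normc_Im_le.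
have mr : measurable_fun [set: R] (fun x => Re (f x)).
  by apply/measurable_EFinP; exact: measurable_int fr.
have mi : measurable_fun [set: R] (fun x => Im (f x)).
  by apply/measurable_EFinP; exact: measurable_int fi.
split => //.
have := integrable_lty measurableT (integrableD measurableT (integrable_abse fr) (integrable_abse fi)).
apply: le_lt_trans; apply: ge0_le_integral => //.
- by move=> x _; rewrite lee_fin normc_ge0.
- by apply/measurable_EFinP; exact: measurable_normc.
- by apply: emeasurable_funD; apply: measurableT_comp => //; exact/measurable_EFinP.
- by move=> x _ /=; rewrite -EFinD lee_fin normc_le_ReIm.
Qed.

Lemma cintegrable_normc f : cintegrable f ->
  mu.-integrable [set: R] (EFin \o (fun x => normc (f x))).
Proof.
move=> [mf fi]; apply/integrableP; split.
  by apply/measurable_EFinP; exact: measurable_normc.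
by under eq_integral do rewrite /= ger0_norm ?normc_ge0//.
Qed.

Lemma cintegrable_dom f (g : R -> R) : cmeasurable f ->
  mu.-integrable [set: R] (EFin \o g) -> (forall x, normc (f x) <= g x) ->
  cintegrable f.
Proof.
move=> mf ig fg; split => //.
apply: le_lt_trans (integrable_lty measurableT ig); apply: ge0_le_integral => //.
- by move=> x _; rewrite lee_fin normc_ge0.
- by apply/measurable_EFinP; exact: measurable_normc.
- exact: measurable_int ig.
- by move=> x _ /=; rewrite lee_fin.
Qed.

Lemma cintegrableD f g :
  cintegrable f -> cintegrable g -> cintegrable (fun x => f x + g x).
Proof.
move=> /cintegrableP[fr fi] /cintegrableP[gr gi]; apply/cintegrableP.
split; rewrite /comp; under eq_fun do rewrite cE EFinD; exact: integrableD.
Qed.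

Lemma cintegrable_bounded f g (C : R) : cintegrable f -> cmeasurable g ->
  (forall x, normc (g x) <= C) -> cintegrable (fun x => f x * g x).
Proof.
move=> fi mg gC; have [mf _] := fi.
apply: (@cintegrable_dom _ (fun x => C * normc (f x))); first exact: cmeasurableM.
  by rewrite /comp; under eq_fun do rewrite EFinM; apply: integrableZl => //; exact: cintegrable_normc.
by move=> x; rewrite normcM mulrC ler_wpM2r ?normc_ge0.
Qed.

Lemma cintegrableZ c f : cintegrable f -> cintegrable (fun x => c * f x).
Proof.
move=> fi; under eq_fun do rewrite mulrC.
by apply: (@cintegrable_bounded _ _ (normc c)) => //; exact: cmeasurable_cst.
Qed.

Lemma cintegrable_conjc f : cintegrable f -> cintegrable (fun x => (f x)^*).
Proof.
move=> [mf fi]; split; first exact: cmeasurable_conjc.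
by under eq_integral do rewrite normc_conjc.
Qed.

Lemma cintegrable_affine f (a b : R) : a != 0 -> cintegrable f ->
  cintegrable (fun x => f (a * x + b)).
Proof.
move=> a0 [mf fi]; split; first exact: cmeasurable_affine.
move: fi; rewrite (@ge0_integral_affine R a b)//; last 2 first.
- by apply/measurable_EFinP; exact: measurable_normc.
- by move=> x; rewrite lee_fin normc_ge0.
rewrite ltey => h; rewrite ltey; apply: contra h => /eqP ->.
by rewrite gt0_muley// lte_fin normr_gt0.
Qed.

Lemma cintegralD f g : cintegrable f -> cintegrable g ->
  cintegral (fun x => f x + g x) = cintegral f + cintegral g.
Proof.
move=> /cintegrableP[fr fi] /cintegrableP[gr gi].
by apply: complex_eqP; rewrite cE /= -RintegralD//; apply: eq_Rintegral => x _;
  rewrite cE.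
Qed.

Lemma cintegralZ c f : cintegrable f ->
  cintegral (fun x => c * f x) = c * cintegral f.
Proof.
move=> /cintegrableP[fr fi]; apply: complex_eqP; rewrite !cE /cintegral /=.
  rewrite -!RintegralZl// -RintegralB//.
  - by apply: eq_Rintegral => x _; rewrite cE.
  - by rewrite /comp; under eq_fun do rewrite EFinM; exact: integrableZl.
  - by rewrite /comp; under eq_fun do rewrite EFinM; exact: integrableZl.
rewrite -!RintegralZl// -RintegralD//.
- by apply: eq_Rintegral => x _; rewrite cE.
- by rewrite /comp; under eq_fun do rewrite EFinM; exact: integrableZl.
- by rewrite /comp; under eq_fun do rewrite EFinM; exact: integrableZl.
Qed.

Lemma cintegralN f : cintegrable f ->
  cintegral (fun x => - f x) = - cintegral f.
Proof.
move=> fi; under eq_fun do rewrite -mulN1r.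
by rewrite cintegralZ// mulN1r.
Qed.

Lemma cintegralB f g : cintegrable f -> cintegrable g ->
  cintegral (fun x => f x - g x) = cintegral f - cintegral g.
Proof.
move=> fi gi; rewrite cintegralD//; first by rewrite cintegralN.
by under eq_fun do rewrite -mulN1r; exact: cintegrableZ.
Qed.

Lemma cintegral_conjc f : cintegrable f ->
  cintegral (fun x => (f x)^*) = (cintegral f)^*.
Proof.
move=> /cintegrableP[fr fi]; rewrite /cintegral /= ; congr (_ +i* _).
  by apply: eq_Rintegral => x _; rewrite cE.
rewrite -mulN1r -RintegralZl//.
by apply: eq_Rintegral => x _; rewrite cE mulN1r.
Qed.

Lemma ae_eq_Rintegral (f g : R -> R) :
  measurable_fun [set: R] f -> measurable_fun [set: R] g ->
  (\forall x \ae mu, f x = g x) -> \int[mu]_x f x = \int[mu]_x g x.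
Proof.
move=> mf mg fg; rewrite /Rintegral; congr fine.
apply: ae_eq_integral => //; try exact/measurable_EFinP.
by apply: filterS fg => x -> _.
Qed.

Lemma ae_eq_cintegral f g : cmeasurable f -> cmeasurable g ->
  (\forall x \ae mu, f x = g x) -> cintegral f = cintegral g.
Proof.
move=> [mf mf'] [mg mg'] fg; rewrite /cintegral; congr (_ +i* _);
  by apply: ae_eq_Rintegral => //; apply: filterS fg => x ->.
Qed.

(** The components are bounded separately, whence the factor 2. Only boundedness and convergence to
    0 are drawn from this estimate, so the constant is harmless. *)
Lemma normc_cintegral_le2 f : cintegrable f ->
  normc (cintegral f) <= 2 * \int[mu]_x normc (f x).
Proof.
move=> fI; have /cintegrableP[fr fi] := fI.
apply: (le_trans (normc_le_ReIm _)) => /=.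
have nI := cintegrable_normc fI.
rewrite mulr_natl mulr2n; apply: lerD; apply: (le_trans (le_normr_Rintegral _ _)) => //;
  apply: le_Rintegral => //.
- exact: integrable_norm.
- by move=> x _; exact: normc_Re_le.
- exact: integrable_norm.
- by move=> x _; exact: normc_Im_le.
Qed.

End ComplexFunctions.

(** * The space [L2] *)

Section L2Basics.
Variable R : realType.
Implicit Types (u v : L2 R) (a : R[i]) (f g : sqfun R).

Lemma sqint_cmeasurable f : cmeasurable f.
Proof. by have [] := set_mem (sqfunP f). Qed.

(** The difference lies in the submodule of null functions. Together with [L2P] this reduces
    identities in [L2] to a.e. identities between explicit functions, whatever representatives the
    quotient picks. *)
Lemma toL2_ae f : \forall x \ae mu, toL2 f x = f x.
Proof.
have : (toL2 f : sqfun R) - f \in @null R.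
  by rewrite Quotient.idealrBE /L2repr reprK.
rewrite inE /=; apply: filterS => x.
rewrite /= => /eqP; rewrite subr_eq0 => /eqP; exact.
Qed.

Lemma L2P u v : (\forall x \ae mu, u x = v x) -> u = v.
Proof.
move=> uv; rewrite -[u]reprK -[v]reprK; apply/eqP.
rewrite -Quotient.idealrBE inE /=; apply: filterS uv => x uvx.
by apply/eqP; rewrite subr_eq0; apply/eqP.
Qed.

Lemma L2D_ae u v : \forall x \ae mu, L2repr (u + v) x = u x + v x.
Proof.
have -> : u + v = toL2 ((u : sqfun R) + v).
  by rewrite toL2D /toL2 /L2repr !reprK.
exact: toL2_ae.
Qed.

Lemma L2Z_ae a u : \forall x \ae mu, L2repr (a *: u) x = a * u x.
Proof. exact: toL2_ae. Qed.

Lemma L2B_ae u v : \forall x \ae mu, L2repr (u - v) x = u x - v x.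
Proof.
have -> : u - v = u + (-1) *: v by rewrite scaleN1r.
apply: filterS2 (L2D_ae u (-1 *: v)) (L2Z_ae (-1) v) => x -> ->.
by rewrite mulN1r.
Qed.

Lemma L20_ae : \forall x \ae mu, L2repr (0 : L2 R) x = 0.
Proof. by apply: filterS (L2Z_ae 0 0) => x; rewrite scale0r mul0r. Qed.

(** Valued in the extended reals, so that Fatou and domination bounds can be stated before square
    integrability is known. *)
Definition isqr (f : R -> R[i]) : \bar R :=
  (\int[mu]_x ((normc (f x)) ^+ 2)%:E)%E.

Lemma isqr_ge0 (f : R -> R[i]) : (0 <= isqr f)%E.
Proof. by apply: integral_ge0 => x _; rewrite lee_fin sqr_ge0. Qed.

Lemma isqr_le (f g : R -> R[i]) : cmeasurable f -> cmeasurable g ->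
  (\forall x \ae mu, normc (f x) <= normc (g x)) -> (isqr f <= isqr g)%E.
Proof.
move=> mf mg fg; rewrite /isqr; apply: ae_ge0_le_integral => //.
- by move=> x _; rewrite lee_fin sqr_ge0.
- by apply/measurable_EFinP; exact: measurable_normc2.
- by move=> x _; rewrite lee_fin sqr_ge0.
- by apply/measurable_EFinP; exact: measurable_normc2.
apply: filterS fg => x fgx _; rewrite lee_fin.
by rewrite ler_pXn2r// ?nnegrE ?normc_ge0.
Qed.

Lemma isqr_eq (f g : R -> R[i]) : cmeasurable f -> cmeasurable g ->
  (\forall x \ae mu, f x = g x) -> isqr f = isqr g.
Proof.
move=> mf mg fg; apply/eqP; rewrite eq_le; apply/andP; split;
  by apply: isqr_le => //; apply: filterS fg => x ->.
Qed.

Definition sqn u : R := fine (isqr u).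

Lemma sqnE u : (sqn u)%:E = isqr u.
Proof.
rewrite /sqn fineK// ge0_fin_numE ?isqr_ge0//.
by have [] := set_mem (sqfunP u).
Qed.

Lemma sqn_ge0 u : 0 <= sqn u.
Proof. by rewrite -lee_fin sqnE isqr_ge0. Qed.

Lemma L2norm2 u : L2norm u ^+ 2 = sqn u.
Proof. by rewrite /L2norm sqr_sqrtr// sqn_ge0. Qed.

Lemma L2norm_ge0 u : 0 <= L2norm u.
Proof. exact: sqrtr_ge0. Qed.

Lemma sqn_toL2 f : (sqn (toL2 f))%:E = isqr f.
Proof. by rewrite sqnE; apply: isqr_eq (toL2_ae f); exact: sqint_cmeasurable. Qed.

Lemma sqn_eq0 u : sqn u = 0 -> u = 0.
Proof.
move=> u0; apply: L2P.
have /ae_eq_integral_abs : (\int[mu]_x `| ((normc (u x)) ^+ 2)%:E | = 0)%E.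
  rewrite -[RHS]/(0%:E) -u0 sqnE; apply: eq_integral => x _.
  by rewrite /= ger0_norm ?sqr_ge0.
have mu2 : measurable_fun [set: R] (fun x => ((normc (u x)) ^+ 2)%:E).
  by apply/measurable_EFinP; apply: measurable_normc2; exact: sqint_cmeasurable.
move=> /(_ measurableT mu2) h; apply: filterS2 L20_ae h => x -> /(_ I) [] /eqP.
by rewrite sqrf_eq0 => /eqP/eq0_normc.
Qed.

Lemma sqn0 : sqn 0 = 0.
Proof.
apply: EFin_inj; rewrite sqnE; have -> : isqr (0 : L2 R) = isqr (fun=> 0).
  by apply: isqr_eq L20_ae; [exact: sqint_cmeasurable|exact: cmeasurable_cst].
by rewrite /isqr; under eq_integral do rewrite normc0 expr0n; rewrite integral0.
Qed.

Lemma isqrZ a (f : R -> R[i]) : cmeasurable f ->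
  isqr (fun x => a * f x) = ((normc a ^+ 2)%:E * isqr f)%E.
Proof.
move=> mf; rewrite /isqr -ge0_integralZl//.
- by apply: eq_integral => x _; rewrite normcM exprMn.
- by apply/measurable_EFinP; exact: measurable_normc2.
- by move=> x _; rewrite lee_fin sqr_ge0.
- by rewrite lee_fin sqr_ge0.
Qed.

Lemma sqnZ a u : sqn (a *: u) = normc a ^+ 2 * sqn u.
Proof.
apply: EFin_inj; rewrite EFinM !sqnE -isqrZ; last exact: sqint_cmeasurable.
apply: isqr_eq (L2Z_ae a u); first exact: sqint_cmeasurable.
by apply: cmeasurableM; [exact: cmeasurable_cst|exact: sqint_cmeasurable].
Qed.

(** In each coordinate the difference of the two sides is the square [t^-1 * (t * p - q)^2]. A small
    weight [t] keeps the coefficient of the first term close to 1, which the choice [t = 1] cannot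
    do. *)
Lemma normc2D_le_weighted (z w : R[i]) (t : R) : 0 < t ->
  normc (z + w) ^+ 2 <= (1 + t) * normc z ^+ 2 + (1 + t^-1) * normc w ^+ 2.
Proof.
move=> t0; rewrite !normc2E; case: z w => x y [x' y'] /=.
have h (p q : R) : (p + q) ^+ 2 <= (1 + t) * p ^+ 2 + (1 + t^-1) * q ^+ 2.
  rewrite -subr_ge0.
  have -> : (1 + t) * p ^+ 2 + (1 + t^-1) * q ^+ 2 - (p + q) ^+ 2 =
    t^-1 * (t * p - q) ^+ 2 by field; rewrite gt_eqF.
  by rewrite mulr_ge0 ?sqr_ge0// invr_ge0 ltW.
have := lerD (h x x') (h y y'); lra.
Qed.

Lemma isqrD_le (f g : R -> R[i]) (t : R) : cmeasurable f -> cmeasurable g -> 0 < t ->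
  (isqr (fun x => f x + g x)%R <=
   (1 + t)%:E * isqr f + (1 + t^-1)%:E * isqr g)%E.
Proof.
move=> mf mg t0; have k1 : 0 <= 1 + t by rewrite addr_ge0// ltW.
have k2 : 0 <= 1 + t^-1 by rewrite addr_ge0// invr_ge0 ltW.
have h k (k0 : 0 <= k) (f' : R -> R[i]) : cmeasurable f' ->
    (k%:E * isqr f' = \int[mu]_x (k * (normc (f' x)) ^+ 2)%:E)%E.
  move=> mf'; rewrite /isqr -ge0_integralZl//.
  - by apply/measurable_EFinP; exact: measurable_normc2.
  - by move=> x _; rewrite lee_fin sqr_ge0.
have m2 k (f' : R -> R[i]) : cmeasurable f' ->
   measurable_fun [set: R] (fun x => (k * (normc (f' x)) ^+ 2)%:E).
  move=> mf'; apply/measurable_EFinP; apply: measurable_funM => //.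
  exact: measurable_normc2.
rewrite !h// -ge0_integralD//=.
- apply: ge0_le_integral => //.
  + by move=> x _; rewrite lee_fin sqr_ge0.
  + by apply/measurable_EFinP; apply: measurable_normc2; exact: cmeasurableD.
  + by apply: emeasurable_funD; [exact: (m2 _ _ mf)|exact: (m2 _ _ mg)].
  + by move=> x _; rewrite -EFinD lee_fin; exact: normc2D_le_weighted.
- by move=> x _; rewrite lee_fin mulr_ge0 ?sqr_ge0.
- exact: (m2 _ _ mf).
- by move=> x _; rewrite lee_fin mulr_ge0 ?sqr_ge0.
- exact: (m2 _ _ mg).
Qed.

Lemma sqnD_le_weighted u v (t : R) : 0 < t ->
  sqn (u + v) <= (1 + t) * sqn u + (1 + t^-1) * sqn v.
Proof.
move=> t0; rewrite -lee_fin EFinD !(EFinM (1 + _)) !sqnE.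
have mu' := sqint_cmeasurable u; have mv := sqint_cmeasurable v.
apply: le_trans (isqrD_le mu' mv t0).
rewrite (isqr_eq _ _ (L2D_ae u v)) //; first exact: sqint_cmeasurable.
exact: cmeasurableD.
Qed.

Lemma sqnD_le u v : sqn (u + v) <= 2 * sqn u + 2 * sqn v.
Proof. by have := sqnD_le_weighted u v ltr01; rewrite invr1. Qed.

Lemma sqnN u : sqn (- u) = sqn u.
Proof. by rewrite -scaleN1r sqnZ normcN normc1 expr1n mul1r. Qed.

Lemma sqnB_le u v w : sqn (u - v) <= 2 * sqn (u - w) + 2 * sqn (w - v).
Proof. by rewrite -[u - v](subrKA w); exact: sqnD_le. Qed.

Lemma sqint_mem (f : R -> R[i]) :
  cmeasurable f -> (isqr f < +oo)%E -> f \in @sqint R.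
Proof. by move=> mf f2; rewrite inE; split. Qed.

Lemma dilate_ae (lam : R) u :
  \forall x \ae mu, dilate lam u x = (`|lam|^-1)%:C * u (x / lam).
Proof. exact: toL2_ae. Qed.

Lemma translate_ae (c : R) u : \forall x \ae mu, translate c u x = u (x - c).
Proof. exact: toL2_ae. Qed.

Lemma measurable_affine_preimage (a b : R) (A : set R) : measurable A ->
  measurable ((fun x : R => a * x + b) @^-1` A).
Proof.
by move=> mA; rewrite -[X in measurable X]setTI; exact: affine_measurable.
Qed.

Lemma ae_affine (a b : R) (P : set R) : a != 0 ->
  (\forall x \ae mu, P x) -> \forall x \ae mu, P (a * x + b).
Proof.
move=> a0 [N [mN N0 PN]].
exists ((fun x => a * x + b) @^-1` N); split.
- exact: measurable_affine_preimage.
- have := @lebesgue_measure_affine R a b N a0 mN; rewrite N0.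
  move/esym/eqP; rewrite mule_eq0 => /orP[|/eqP//].
  by rewrite eqe normr_eq0 (negbTE a0).
- by move=> x /= nP; apply: PN.
Qed.

Lemma isqr_affine (f : R -> R[i]) (a b : R) : a != 0 -> cmeasurable f ->
  isqr f = (`|a|%:E * isqr (fun x => f (a * x + b)%R))%E.
Proof.
move=> a0 mf; rewrite /isqr (@ge0_integral_affine R a b)//.
- by apply/measurable_EFinP; exact: measurable_normc2.
- by move=> x; rewrite lee_fin sqr_ge0.
Qed.

Lemma cintegral_affine (f : R -> R[i]) (a b : R) : a != 0 -> cintegrable f ->
  cintegral f = (`|a|)%:C * cintegral (fun x => f (a * x + b)).
Proof.
move=> a0 /cintegrableP[fr fi].
have h (h : R -> R) : mu.-integrable [set: R] (EFin \o h) ->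
    \int[mu]_x h x = `|a| * \int[mu]_x h (a * x + b).
  move=> hi; have mh : measurable_fun [set: R] (EFin \o h) := measurable_int _ hi.
  (* The change of variables for nonnegative functions is applied to the positive and negative
     parts, whose integrals are finite. *)
  pose p : R -> \bar R := ((EFin \o h)^\+)%E.
  pose n : R -> \bar R := ((EFin \o h)^\-)%E.
  have mp : measurable_fun [set: R] p by exact: measurable_funepos.
  have mn : measurable_fun [set: R] n by exact: measurable_funeneg.
  have fp : (\int[mu]_x p x)%E \is a fin_num by exact: integrable_pos_fin_num.
  have fn : (\int[mu]_x n x)%E \is a fin_num by exact: integrable_neg_fin_num.
  have p0 x : (0 <= p x)%E by rewrite /p funeposE le_max lexx orbT.
  have n0 x : (0 <= n x)%E by rewrite /n funenegE le_max lexx orbT.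
  have Hp := ge0_integral_affine b a0 mp p0.
  have Hn := ge0_integral_affine b a0 mn n0.
  have E1 : (\int[mu]_x (h x)%:E = \int[mu]_x p x - \int[mu]_x n x)%E.
    exact: integralE.
  have E2 : (\int[mu]_x (h (a * x + b)%R)%:E =
      \int[mu]_x p (a * x + b)%R - \int[mu]_x n (a * x + b)%R)%E.
    rewrite integralE; congr (_ - _)%E; apply: eq_integral => x _.
      by rewrite /p !funeposE.
    by rewrite /n !funenegE.
  rewrite /Rintegral E1 E2; rewrite Hp Hn in fp fn *.
  have fin (q : \bar R) : (`|a|%:E * q)%E \is a fin_num -> (0 <= q)%E ->
      q \is a fin_num.
    by case: q => // + _; rewrite gt0_muley// lte_fin normr_gt0.
  have ip0 : (0 <= \int[mu]_x p (a * x + b)%R)%E by exact: integral_ge0.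
  have in0 : (0 <= \int[mu]_x n (a * x + b)%R)%E by exact: integral_ge0.
  rewrite -(fineK (fin _ fp ip0)) -(fineK (fin _ fn in0)) -!EFinM -!EFinB /=.
  by rewrite mulrBr.
apply: complex_eqP; rewrite !cE /=.
  by rewrite mul0r subr0; exact: h.
by rewrite mul0r addr0; exact: h.
Qed.

End L2Basics.

Section L2Of.
Variable R : realType.
Implicit Types (u v w : L2 R) (f g : R -> R[i]).

(* The junk value is [0] when [f] is not square integrable. *)
Definition L2of f : L2 R :=
  if pselect (f \in @sqint R) is left hf then toL2 (SqFun hf) else 0.

Lemma L2of_ae f : f \in @sqint R -> \forall x \ae mu, L2of f x = f x.
Proof. by rewrite /L2of; case: pselect => // hf _; exact: toL2_ae. Qed.

Lemma sqn_L2of f : f \in @sqint R -> (sqn (L2of f))%:E = isqr f.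
Proof. by rewrite /L2of; case: pselect => // hf _; exact: sqn_toL2. Qed.

Lemma sqint_L2 u : (u : R -> R[i]) \in @sqint R.
Proof. exact: sqfunP. Qed.

Lemma sqint_dom f g : cmeasurable f -> g \in @sqint R ->
  (\forall x \ae mu, normc (f x) <= normc (g x)) -> f \in @sqint R.
Proof.
move=> mf gs fg; have [mg g2] := set_mem gs.
by apply: sqint_mem => //; apply: le_lt_trans g2; exact: isqr_le.
Qed.

Lemma sqintM f g (C : R) : cmeasurable f -> (forall x, normc (f x) <= C) ->
  g \in @sqint R -> (fun x => f x * g x) \in @sqint R.
Proof.
move=> mf fC gs; have [mg _] := set_mem gs.
have C0 : 0 <= C by exact: le_trans (normc_ge0 _) (fC 0).
have h : (C%:C *: g) \in @sqint R by exact: rpredZ.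
apply: sqint_dom h _; first exact: cmeasurableM.
apply: aeW => x; have -> : (C%:C *: g) x = C%:C * g x by [].
rewrite !normcM normc_real (ger0_norm C0).
by rewrite ler_wpM2r ?normc_ge0.
Qed.

Lemma sqn_ae u f : cmeasurable f -> (\forall x \ae mu, u x = f x) ->
  (sqn u)%:E = isqr f.
Proof.
by move=> mf uf; rewrite sqnE; apply: isqr_eq => //; exact: sqint_cmeasurable.
Qed.

Lemma cintegrable_ae f g : cmeasurable g -> cintegrable f ->
  (\forall x \ae mu, f x = g x) -> cintegrable g.
Proof.
move=> mg [mf fi] fg; split => //; apply: le_lt_trans fi.
rewrite le_eqVlt; apply/orP; left; apply/eqP.
apply: ge0_ae_eq_integral => //.
- by apply/measurable_EFinP; exact: measurable_normc.
- by apply/measurable_EFinP; exact: measurable_normc.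
- by move=> x _; rewrite lee_fin normc_ge0.
- by move=> x _; rewrite lee_fin normc_ge0.
by apply: filterS fg => x -> _.
Qed.

End L2Of.

(** * Convergence in mean square, Fatou and dominated convergence *)

Section L2Convergence.
Variable R : realType.
Implicit Types (u v w : L2 R) (f g : R -> R[i]).

Definition L2cvg (v : nat -> L2 R) w : Prop :=
  (fun n => sqn (v n - w)) @ \oo --> (0 : R).

Lemma squeeze0 (a b : nat -> R) : (forall n, 0 <= a n) -> (forall n, a n <= b n) ->
  b @ \oo --> (0 : R) -> a @ \oo --> (0 : R).
Proof.
move=> a0 ab b0; apply: (@squeeze_cvgr _ _ _ _ (cst 0) b) => //.
  by apply: nearW => n; rewrite a0 ab.
exact: cvg_cst.
Qed.

Lemma L2cvg_unique (v : nat -> L2 R) w w' : L2cvg v w -> L2cvg v w' -> w = w'.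
Proof.
move=> vw vw'; apply/eqP; rewrite -subr_eq0; apply/eqP; apply: sqn_eq0.
have h : (fun n => 2 * sqn (v n - w) + 2 * sqn (v n - w')) @ \oo --> (0 : R).
  rewrite -[0](_ : 2 * 0 + 2 * 0 = 0); last by rewrite mulr0 addr0.
  by apply: cvgD; apply: cvgMr.
have : (fun=> sqn (w - w')) @ \oo --> (0 : R).
  apply: squeeze0 h => n; first exact: sqn_ge0.
  by apply: le_trans (sqnB_le _ _ (v n)) _; rewrite -(opprB (v n) w) sqnN.
by move=> h0; apply: (@cvg_unique _ (@Rhausdorff R) _ _ _ _ _ h0) => //; exact: cvg_cst.
Qed.

(** The function [f] is only a pointwise limit, not yet known to be square integrable. Fatou carries
    the uniform bound on [w - v n] over to [w - f]; this is how the limit is controlled in the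
    completeness proof. *)
Lemma L2cvg_fatou (v : nat -> L2 R) w f (C : R) : cmeasurable f ->
  (\forall x \ae mu, (fun n => normc (v n x - f x)) @ \oo --> (0 : R)) ->
  (forall n, sqn (w - v n) <= C) ->
  (isqr (fun x => w x - f x)%R <= C%:E)%E.
Proof.
move=> mf vf wC.
pose h n x := ((normc (w x - v n x)) ^+ 2)%:E.
have mh n : measurable_fun [set: R] (h n).
  apply/measurable_EFinP; apply: (@measurable_normc2 R (fun x => w x - v n x)).
  by apply: cmeasurableB; exact: sqint_cmeasurable.
have h0 n x : [set: R] x -> (0 <= h n x)%E by rewrite lee_fin sqr_ge0.
have := fatou mu measurableT mh h0.
have -> : (\int[mu]_x limn_einf (h ^~ x) = isqr (fun x => w x - f x)%R)%E.
  apply: ae_eq_integral => //.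
  - rewrite /limn_einf; apply: measurableT_comp => //.
    apply: (@measurable_fun_limn_esup _ _ _ _ (fun n x => - h n x)%E) => n.
    exact: measurableT_comp.
  - apply/measurable_EFinP; apply: (@measurable_normc2 R (fun x => w x - f x)).
    by apply: cmeasurableB => //; exact: sqint_cmeasurable.
  apply: filterS vf => x vfx _.
  have : (h ^~ x) @ \oo --> ((normc (w x - f x)) ^+ 2)%:E.
    apply: cvg_EFin; first exact: nearW.
    rewrite /h /= /comp /=.
    have vfx' : (fun n => normc (w x - v n x)) @ \oo --> normc (w x - f x).
      apply/cvgrPdist_le => e e0; near=> n.
      apply: (@le_trans _ _ (normc (v n x - f x))); last first.
        near: n; move/cvgrPdist_le : vfx => /(_ _ e0); apply: filterS => n.
        by rewrite sub0r normrN ger0_norm ?normc_ge0.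
      rewrite ler_norml; apply/andP; split.
        rewrite lerNl opprB lerBlDr -(normcN (v n x - f x)) opprB.
        apply: le_trans (le_normcD _ _).
        by rewrite le_eqVlt; apply/orP; left; apply/eqP; congr normc; ring.
      rewrite lerBlDr; apply: le_trans (le_normcD _ _).
      by rewrite le_eqVlt; apply/orP; left; apply/eqP; congr normc; ring.
    by rewrite expr2; under eq_fun do rewrite expr2; apply: cvgM.
  by move=> /cvg_limn_einf_sup[->].
move=> /le_trans; apply.
rewrite limn_einf_lim; apply: lime_le; first exact: is_cvg_einfs.
near=> n.
apply: (@le_trans _ _ (\int[mu]_x h n x)%E).
  by apply: ereal_inf_lbound; exists n => //=.
move: (wC n); rewrite -lee_fin sqnE; apply: le_trans.
rewrite le_eqVlt; apply/orP; left; apply/eqP; apply: esym.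
apply: isqr_eq (L2B_ae _ _); first exact: sqint_cmeasurable.
by apply: cmeasurableB; exact: sqint_cmeasurable.
Unshelve. all: by end_near. Qed.

End L2Convergence.

Section DominatedConvergence.
Variable R : realType.

Lemma Rdominated_convergence (f_ : nat -> R -> R) (f g : R -> R) :
  (forall n, measurable_fun [set: R] (f_ n)) -> measurable_fun [set: R] f ->
  (\forall x \ae mu, (fun n => f_ n x) @ \oo --> f x) ->
  mu.-integrable [set: R] (EFin \o g) ->
  (forall n x, `|f_ n x| <= g x) ->
  (fun n => \int[mu]_x f_ n x) @ \oo --> \int[mu]_x f x.
Proof.
move=> mf_ mf f_f ig f_g.
have mf1 n : measurable_fun [set: R] (EFin \o f_ n) by exact/measurable_EFinP.
have mf2 : measurable_fun [set: R] (EFin \o f) by exact/measurable_EFinP.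
have ff : {ae mu, forall x, [set: R] x ->
    (fun n => (EFin \o f_ n) x) @ \oo --> (EFin \o f) x}.
  by apply: filterS f_f => x fx _; apply: cvg_EFin; [exact: nearW|exact: fx].
have fg : {ae mu, forall x n, [set: R] x ->
    (`|(EFin \o f_ n) x| <= (EFin \o g) x)%E}.
  by apply: aeW => x n _ /=; rewrite lee_fin.
have [i1 _ i2] := @dominated_convergence _ _ R mu [set: R] measurableT
  _ _ _ mf1 mf2 ff ig fg.
rewrite /Rintegral; apply: fine_cvg; rewrite fineK//.
exact: integrable_fin_num.
Qed.

Lemma cdominated_convergence (f_ : nat -> R -> R[i]) (f : R -> R[i]) (g : R -> R) :
  (forall n, cmeasurable (f_ n)) -> cmeasurable f ->
  (\forall x \ae mu, (fun n => normc (f_ n x - f x)) @ \oo --> (0 : R)) ->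
  mu.-integrable [set: R] (EFin \o g) ->
  (forall n x, normc (f_ n x) <= g x) ->
  (fun n => normc (cintegral (f_ n) - cintegral f)) @ \oo --> (0 : R).
Proof.
move=> mf_ [mf mf'] f_f ig f_g.
have hr : (fun n => \int[mu]_x Re (f_ n x)) @ \oo --> \int[mu]_x Re (f x).
  apply: (@Rdominated_convergence _ _ g) => //.
  - by move=> n; have [] := mf_ n.
  - apply: filterS f_f => x h; apply/cvgrPdist_le => e e0; near=> n.
    apply: (@le_trans _ _ (normc (f_ n x - f x))).
      rewrite distrC (_ : _ - _ = Re (f_ n x - f x)) ?normc_Re_le//.
      by rewrite !cE.
    near: n; move/cvgrPdist_le : h => /(_ _ e0); apply: filterS => n.
    by rewrite sub0r normrN ger0_norm ?normc_ge0.
  - by move=> n x; apply: le_trans (f_g n x); exact: normc_Re_le.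
have hi : (fun n => \int[mu]_x Im (f_ n x)) @ \oo --> \int[mu]_x Im (f x).
  apply: (@Rdominated_convergence _ _ g) => //.
  - by move=> n; have [] := mf_ n.
  - apply: filterS f_f => x h; apply/cvgrPdist_le => e e0; near=> n.
    apply: (@le_trans _ _ (normc (f_ n x - f x))).
      rewrite distrC (_ : _ - _ = Im (f_ n x - f x)) ?normc_Im_le//.
      by rewrite !cE.
    near: n; move/cvgrPdist_le : h => /(_ _ e0); apply: filterS => n.
    by rewrite sub0r normrN ger0_norm ?normc_ge0.
  - by move=> n x; apply: le_trans (f_g n x); exact: normc_Im_le.
apply: (@squeeze0 R _ (fun n => `|\int[mu]_x Re (f x) - \int[mu]_x Re (f_ n x)| +
   `|\int[mu]_x Im (f x) - \int[mu]_x Im (f_ n x)|)).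
- by move=> n; exact: normc_ge0.
- move=> n; apply: le_trans (normc_le_ReIm _) _; rewrite !cE /=.
  by rewrite distrC (distrC (\int[mu]_x Im (f x))).
rewrite -[X in _ --> X](addr0 0); apply: cvgD.
  rewrite -[X in _ --> X](@normr0 R R); apply: cvg_norm.
  by rewrite -(subrr (\int[mu]_x Re (f x))); apply: cvgB => //; exact: cvg_cst.
rewrite -[X in _ --> X](@normr0 R R); apply: cvg_norm.
by rewrite -(subrr (\int[mu]_x Im (f x))); apply: cvgB => //; exact: cvg_cst.
Unshelve. all: by end_near. Qed.

(** The differences [v n - w] are known only a.e.; the explicit functions [d n] allow convergence
    and domination to be checked at every point. *)
Lemma L2_dominated (v : nat -> L2 R) (w : L2 R) (d : nat -> R -> R[i])
    (g : R -> R[i]) : g \in @sqint R ->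
  (forall n, cmeasurable (d n)) ->
  (forall n, \forall x \ae mu, v n x - w x = d n x) ->
  (forall x, (fun n => normc (d n x)) @ \oo --> (0 : R)) ->
  (forall n x, normc (d n x) <= normc (g x)) -> L2cvg v w.
Proof.
move=> gs md vd d0 dg; have [mg g2] := set_mem gs.
have I0 : 0 = \int[mu]_x (0 : R) by rewrite Rintegral_cst// mul0r.
rewrite /L2cvg [X in _ --> X]I0.
have E n : sqn (v n - w) = \int[mu]_x (normc (d n x) ^+ 2).
  rewrite /Rintegral -/(isqr (d n)) -(@sqn_ae _ (v n - w) (d n))//.
  by apply: filterS2 (L2B_ae (v n) w) (vd n) => x -> ->.
under eq_fun do rewrite E.
apply: (@Rdominated_convergence _ _ (fun x => normc (g x) ^+ 2)).
- by move=> n; exact: measurable_normc2.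
- exact: measurable_cst.
- apply: aeW => x; rewrite -[X in _ --> X](mulr0 0).
  by under eq_fun do rewrite expr2; apply: cvgM; exact: d0.
- apply/integrableP; split.
    by apply/measurable_EFinP; exact: measurable_normc2.
  by under eq_integral do rewrite /= ger0_norm ?sqr_ge0//.
- move=> n x; rewrite ger0_norm ?sqr_ge0// ler_pXn2r// ?nnegrE ?normc_ge0//.
Qed.

End DominatedConvergence.

(** * Bounded operators and density of the integrable elements *)

Section BoundedOperators.
Variable R : realType.
Implicit Types (u v w : L2 R) (A B : L2 R -> L2 R).

Lemma bopD A u v : bounded_operator A -> A (u + v) = A u + A v.
Proof. by move=> [lA _]; have := lA 1 u v; rewrite !scale1r. Qed.

Lemma bop0 A : bounded_operator A -> A 0 = 0.
Proof.
by move=> hA; have := bopD 0 0 hA; rewrite addr0 -{1}[A 0]addr0 => /addrI.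
Qed.

Lemma bopZ A (a : R[i]) u : bounded_operator A -> A (a *: u) = a *: A u.
Proof. by move=> hA; have [lA _] := hA; have := lA a u 0; rewrite (bop0 hA) !addr0. Qed.

Lemma bopB A u v : bounded_operator A -> A (u - v) = A u - A v.
Proof. by move=> hA; rewrite bopD// -scaleN1r bopZ// scaleN1r. Qed.

Lemma bop_sqn A : bounded_operator A ->
  exists2 C : R, 0 <= C & forall u, sqn (A u) <= C * sqn u.
Proof.
move=> [_ [M hM]]; exists (M ^+ 2); first exact: sqr_ge0.
move=> u; rewrite -!L2norm2 -exprMn ler_pXn2r// ?nnegrE ?L2norm_ge0//.
exact: le_trans (L2norm_ge0 _) (hM u).
Qed.

Lemma bop_intro A (C : R) : (forall u v, A (u + v) = A u + A v) ->
  (forall (a : R[i]) u, A (a *: u) = a *: A u) -> 0 <= C ->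
  (forall u, sqn (A u) <= C * sqn u) -> bounded_operator A.
Proof.
move=> aD aZ C0 aC; split; first by move=> a u v; rewrite aD aZ.
exists (Num.sqrt C) => u.
rewrite -(@ler_pXn2r _ 2)// ?nnegrE ?mulr_ge0 ?L2norm_ge0 ?sqrtr_ge0//.
by rewrite exprMn !L2norm2 sqr_sqrtr.
Qed.

Lemma bop_comp A B : bounded_operator A -> bounded_operator B ->
  bounded_operator (A \o B).
Proof.
move=> hA hB; have [C C0 hC] := bop_sqn hA; have [D D0 hD] := bop_sqn hB.
apply: (@bop_intro _ (C * D)).
- by move=> u v /=; rewrite !bopD.
- by move=> a u /=; rewrite !bopZ.
- exact: mulr_ge0.
- move=> u /=; apply: (le_trans (hC _)); rewrite -mulrA.
  by apply: ler_wpM2l.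
Qed.

Lemma bop_scale A (a : R[i]) : bounded_operator A ->
  bounded_operator (fun u => a *: A u).
Proof.
move=> hA; have [C C0 hC] := bop_sqn hA.
apply: (@bop_intro _ (normc a ^+ 2 * C)).
- by move=> u v /=; rewrite bopD// scalerDr.
- by move=> b u /=; rewrite bopZ// !scalerA mulrC.
- by rewrite mulr_ge0// sqr_ge0.
- by move=> u /=; rewrite sqnZ -[leRHS]mulrA; apply: ler_wpM2l => //; exact: sqr_ge0.
Qed.

Lemma bop_id : bounded_operator (@id (L2 R)).
Proof. by apply: (@bop_intro _ 1) => // u; rewrite mul1r. Qed.

Lemma L2cvg_bop A (v : nat -> L2 R) w : bounded_operator A ->
  L2cvg v w -> L2cvg (fun n => A (v n)) (A w).
Proof.
move=> hA vw; have [C C0 hC] := bop_sqn hA.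
apply: (@squeeze0 R _ (fun n => C * sqn (v n - w))).
- by move=> n; exact: sqn_ge0.
- by move=> n; rewrite -bopB.
- by rewrite -[X in _ --> X](mulr0 C); apply: cvgMr.
Qed.

Lemma L2cvgD (v v' : nat -> L2 R) w w' : L2cvg v w -> L2cvg v' w' ->
  L2cvg (fun n => v n + v' n) (w + w').
Proof.
move=> h h'; apply: (@squeeze0 R _ (fun n => 2 * sqn (v n - w) + 2 * sqn (v' n - w'))).
- by move=> n; exact: sqn_ge0.
- by move=> n; rewrite opprD addrACA; exact: sqnD_le.
- rewrite -[X in _ --> X](_ : 2 * 0 + 2 * 0 = 0); last by rewrite mulr0 addr0.
  by apply: cvgD; apply: cvgMr.
Qed.

Lemma L2cvgZ (v : nat -> L2 R) w (a : R[i]) : L2cvg v w ->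
  L2cvg (fun n => a *: v n) (a *: w).
Proof. by apply: L2cvg_bop; apply: bop_scale; exact: bop_id. Qed.

(** The weight [t] tends to 0: the inequality with weight 1 would only give [2 * C], whereas the
    Fourier transform has to be a contraction with the exact constant 1. *)
Lemma L2cvg_sqn_le (v : nat -> L2 R) w (C : R) : L2cvg v w ->
  (forall n, sqn (v n) <= C) -> sqn w <= C.
Proof.
move=> vw vC; have C0 : 0 <= C by exact: le_trans (sqn_ge0 _) (vC 0%N).
have h t : 0 < t -> sqn w <= (1 + t) * C.
  move=> t0; have : (fun n => (1 + t) * C + (1 + t^-1) * sqn (v n - w)) @ \oo -->
      (1 + t) * C.
    rewrite -[X in _ --> X]addr0 -[X in _ --> _ + X](mulr0 (1 + t^-1)).
    by apply: cvgD; [exact: cvg_cst|exact: cvgMr].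
  move=> hc; rewrite -(cvg_lim (@Rhausdorff R) hc).
  apply: limr_ge; [exact: cvgP hc|apply: nearW => n].
  have -> : sqn (v n - w) = sqn (w - v n) by rewrite -sqnN opprB.
  have {1}-> : w = v n + (w - v n) by rewrite addrC subrK.
  apply: (le_trans (sqnD_le_weighted _ _ t0)); rewrite lerD2r.
  by apply: ler_wpM2l => //; rewrite addr_ge0// ltW.
apply/ler_addgt0Pr => e e0.
(* With this weight the excess [t * C] is at most [e]; the added 1 avoids a division by 0 when
   [C = 0]. *)
have t0 : 0 < e / (C + 1) by rewrite divr_gt0// ltr_wpDl.
apply: le_trans (h _ t0) _; rewrite mulrDl mul1r lerD2l.
by rewrite mulrAC ler_pdivrMr ?ltr_wpDl//; apply: ler_wpM2l; [exact: ltW|lra].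
Qed.

End BoundedOperators.

Section Truncation.
Variable R : realType.
Implicit Types (u v w : L2 R) (A B : L2 R -> L2 R).

Definition cutoff (n : nat) (x : R) : R := \1_(`[- n%:R, n%:R]%classic : set R) x.

Lemma measurable_cutoff n : measurable_fun [set: R] (cutoff n).
Proof. exact: measurable_indic. Qed.

Lemma cutoff_ge0 n x : 0 <= cutoff n x. Proof. by rewrite /cutoff indicE. Qed.

Lemma cutoff_le1 n x : cutoff n x <= 1.
Proof. by rewrite /cutoff indicE; case: (_ \in _). Qed.

Lemma cutoff_cvg x : \forall n \near \oo, cutoff n x = 1.
Proof.
near=> n; rewrite /cutoff indicE mem_set//= in_itv/= -ler_norml.
by near: n; exact: nbhs_infty_ger.
Unshelve. all: by end_near. Qed.

Lemma integrable_cutoff n : mu.-integrable [set: R] (EFin \o cutoff n).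
Proof. exact: integrable_indic_itv. Qed.

Definition trunc n u : L2 R := L2of (fun x => (cutoff n x)%:C * u x).

Lemma sqint_trunc n u : (fun x => (cutoff n x)%:C * u x) \in @sqint R.
Proof.
apply: (@sqintM _ _ _ 1); last exact: sqint_L2.
- by apply: cmeasurable_real; exact: measurable_cutoff.
- by move=> x; rewrite normc_real ger0_norm ?cutoff_ge0 ?cutoff_le1.
Qed.

Lemma trunc_ae n u : \forall x \ae mu, trunc n u x = (cutoff n x)%:C * u x.
Proof. exact: L2of_ae (sqint_trunc n u). Qed.

Lemma trunc_cvg u : L2cvg (trunc ^~ u) u.
Proof.
have mc n : cmeasurable (fun x => (cutoff n x - 1)%:C * u x).
  apply: cmeasurableM; last exact: sqint_cmeasurable.
  by apply: cmeasurable_real; apply: measurable_funB => //; exact: measurable_cutoff.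
apply: (@L2_dominated R _ _ (fun n x => (cutoff n x - 1)%:C * u x) u (sqint_L2 u)) => //.
- move=> n; apply: filterS (trunc_ae n u) => x ->.
  by rewrite rmorphB/= mulrBl mul1r.
- move=> x; apply: cvg_near_cst; apply: filterS (cutoff_cvg x) => n ->.
  by rewrite subrr mul0r normc0.
- move=> n x; rewrite normcM normc_real ler_piMl ?normc_ge0//.
  by rewrite distrC ger0_norm ?subr_ge0 ?cutoff_le1// lerBlDr lerDl cutoff_ge0.
Qed.

Lemma trunc_cintegrable n u : cintegrable (trunc n u).
Proof.
have mc : cmeasurable (fun x => (cutoff n x)%:C * u x).
  apply: cmeasurableM; last exact: sqint_cmeasurable.
  by apply: cmeasurable_real; exact: measurable_cutoff.
apply: (@cintegrable_ae _ (fun x => (cutoff n x)%:C * u x)); last 2 first.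
- apply: (@cintegrable_dom _ _ (fun x => cutoff n x + normc (u x) ^+ 2)) => //.
    rewrite /comp; under eq_fun do rewrite EFinD.
    apply: (@integrableD _ _ _ _ _ measurableT _ _ (integrable_cutoff n)).
    apply/integrableP; split.
      by apply/measurable_EFinP; apply: measurable_normc2; exact: sqint_cmeasurable.
    under eq_integral do rewrite /= ger0_norm ?sqr_ge0//.
    by have [] := set_mem (sqint_L2 u).
  move=> x; rewrite normcM normc_real ger0_norm ?cutoff_ge0//.
  rewrite /cutoff indicE; case: (_ \in _); last by rewrite mul0r add0r sqr_ge0.
  (* Inside the window the modulus [z] is dominated by [1 + z^2]. *)
  rewrite /= mul1r; have := sqr_ge0 (normc (u x) - 1); nra.
- by apply: filterS (trunc_ae n u) => x ->.
- exact: sqint_cmeasurable.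
Qed.

(** Truncations are integrable and dense, so an identity between bounded operators needs checking
    only where the Fourier transform is given by its integral. *)
Lemma bop_eq_integrable A B : bounded_operator A -> bounded_operator B ->
  (forall u, cintegrable u -> A u = B u) -> A = B.
Proof.
move=> hA hB AB; apply/funext => u.
have h1 := L2cvg_bop hA (trunc_cvg u); have h2 := L2cvg_bop hB (trunc_cvg u).
apply: L2cvg_unique h1 _; rewrite (_ : (fun n => A (trunc n u)) =
  (fun n => B (trunc n u)))//.
by apply/funext => n; apply: AB; exact: trunc_cintegrable.
Qed.

Lemma sqn_trunc_le n u : sqn (trunc n u) <= sqn u.
Proof.
rewrite -lee_fin sqnE (sqnE u).
rewrite (isqr_eq _ _ (trunc_ae n u)); last 2 first.
- exact: sqint_cmeasurable.
- by have [] := set_mem (sqint_trunc n u).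
apply: isqr_le; first by have [] := set_mem (sqint_trunc n u).
  exact: sqint_cmeasurable.
apply: aeW => x; rewrite normcM normc_real ger0_norm ?cutoff_ge0//.
by rewrite ler_piMl ?normc_ge0 ?cutoff_le1.
Qed.

Lemma bop_sqn_le A (C : R) : bounded_operator A -> 0 <= C ->
  (forall u, cintegrable u -> sqn (A u) <= C * sqn u) ->
  forall u, sqn (A u) <= C * sqn u.
Proof.
move=> hA C0 AC u; apply: (@L2cvg_sqn_le R _ _ _ (L2cvg_bop hA (trunc_cvg u))) => n.
apply: le_trans (AC _ (trunc_cintegrable n u)) _; apply: ler_wpM2l => //.
exact: sqn_trunc_le.
Qed.

Lemma L2cvg_cauchy (v : nat -> L2 R) w : L2cvg v w -> forall e : R, 0 < e ->
  exists N, forall n k, (N <= n)%N -> (N <= k)%N -> sqn (v n - v k) <= e.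
Proof.
move=> vw e e0; have e4 : 0 < e / 4 by rewrite divr_gt0.
move/cvgrPdist_le : vw => /(_ _ e4) [N _ hN]; exists N => n k Nn Nk.
have h m : (N <= m)%N -> sqn (v m - w) <= e / 4.
  by move=> /hN /=; rewrite sub0r normrN ger0_norm ?sqn_ge0.
apply: le_trans (sqnB_le _ _ w) _; rewrite -(sqnN (w - _)) opprB.
have := h n Nn; have := h k Nk; lra.
Qed.

End Truncation.

(** * Completeness of [L2] *)

Section Completeness.
Variable R : realType.

Lemma cvg_of_abs_summable (a : nat -> R) (b : nat -> R) :
  (forall k, `|a k.+1 - a k| <= b k) -> cvgn (series b) -> cvgn a.
Proof.
move=> ab cb.
have h : cvgn (series (telescope a)).
  apply: normed_cvg; apply: (@series_le_cvg _ _ b) => //.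
    by move=> n; exact: normr_ge0.
  by move=> n; exact: le_trans (normr_ge0 _) (ab n).
move: h; rewrite telescopeK => h.
have -> : a = (fun n => ([sequence a n - a 0%N]_n n) + a 0%N).
  by apply/funext => n; rewrite subrK.
by apply: is_cvgD; [exact: h|exact: is_cvg_cst].
Qed.

Lemma nneseries_fin_cvg (a : nat -> R) : (forall k, 0 <= a k) ->
  (\sum_(k <oo) (a k)%:E < +oo)%E -> cvgn (series a).
Proof.
move=> a0 aoo; apply: nondecreasing_is_cvgn.
  by apply: nondecreasing_series => n _ _.
exists (fine (\sum_(k <oo) (a k)%:E)%E) => _ [n _ <-].
rewrite -lee_fin fineK; last first.
  by rewrite ge0_fin_numE// nneseries_ge0// => k _ _; rewrite lee_fin.
rewrite /series/= -sumEFin; apply: nneseries_lim_ge => k _ _.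
by rewrite lee_fin.
Qed.

Lemma geometric_eseries_half :
  (\sum_(k <oo) ((1 / (2 ^ (k + 1))%:R : R)%:E) = 1%:E)%E.
Proof.
have /cvg_lim := @cvg_geometric_eseries_half R 1 0; rewrite expr0 divr1.
by move=> h; rewrite -[RHS]h.
Qed.

(** Riesz-Fischer, by a subsequence with increments [g k] for which the sum of [2^k |g k|^2] is
    integrable. Since [|g k| <= 2^-k + 2^k |g k|^2], the subsequence then converges a.e., and Fatou
    turns the pointwise limit into a limit of the whole sequence. *)
Lemma L2_complete (v : nat -> L2 R) :
  (forall e : R, 0 < e ->
    exists N, forall n k, (N <= n)%N -> (N <= k)%N -> sqn (v n - v k) <= e) ->
  exists w, L2cvg v w.
Proof.
move=> cv.
(* Chosen so that [2^k * e k] is the geometric term [1 / 2^(k + 1)], with sum 1. *)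
pose e k : R := (1 / (2 ^ (k + 1))%:R) / 2 ^+ k.
have e0 k : 0 < e k by rewrite divr_gt0// ?exprn_gt0// divr_gt0// ltr0n expn_gt0.
have [N hN] := choice (fun k => cv _ (e0 k)).
(* The sum makes [phi] monotone and at least [N k]; the summand [k] makes it tend to infinity. *)
pose phi k := (k + \sum_(j < k.+1) N j)%N.
have Nphi k : (N k <= phi k)%N by rewrite /phi big_ord_recr /= addnA leq_addl.
have phiS k : (phi k <= phi k.+1)%N.
  by rewrite {2}/phi big_ord_recr /= addSn addnA -addSn leqW// leq_addr.
pose g k x := v (phi k.+1) x - v (phi k) x.
have mg k : cmeasurable (g k) by apply: cmeasurableB; exact: sqint_cmeasurable.
have ig k : (isqr (g k) <= (e k)%:E)%E.
  rewrite -(@sqn_ae _ (v (phi k.+1) - v (phi k)) (g k) (mg k)); last exact: L2B_ae.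
  rewrite lee_fin; apply: hN; last exact: Nphi.
  exact: leq_trans (Nphi k) (phiS k).
pose G k x := (2 ^+ k * normc (g k x) ^+ 2)%:E.
have mG k : measurable_fun [set: R] (G k).
  by apply/measurable_EFinP; apply: measurable_funM => //; exact: measurable_normc2.
have G0 k x : (0 <= G k x)%E by rewrite lee_fin mulr_ge0 ?sqr_ge0 ?exprn_ge0.
have iG : (\int[mu]_x (\sum_(k <oo) G k x) < +oo)%E.
  rewrite integral_nneseries//.
  apply: (@le_lt_trans _ _ 1%:E); last exact: ltey.
  rewrite -geometric_eseries_half; apply: lee_nneseries.
    by move=> k _ _; apply: integral_ge0.
  move=> k _.
  have -> : (\int[mu]_x G k x = (2 ^+ k)%:E * isqr (g k))%E.
    rewrite /isqr -ge0_integralZl//.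
    - by apply/measurable_EFinP; exact: measurable_normc2.
    - by move=> x _; rewrite lee_fin sqr_ge0.
  apply: (@le_trans _ _ ((2 ^+ k)%:E * (e k)%:E)%E).
    by apply: lee_wpmul2l => //; rewrite lee_fin exprn_ge0.
  by rewrite -EFinM lee_fin /e mulrC divfK// expf_neq0.
have aeG : \forall x \ae mu, (\sum_(k <oo) G k x < +oo)%E.
  have mS : measurable_fun [set: R] (fun x => \sum_(k <oo) G k x)%E.
    by apply: ge0_emeasurable_sum => // k x _ _.
  have S0 x : (0 <= \sum_(k <oo) G k x)%E by apply: nneseries_ge0.
  have : mu.-integrable [set: R] (fun x => \sum_(k <oo) G k x)%E.
    apply/integrableP; split => //.
    by under eq_integral do rewrite gee0_abs//.
  move/(integrable_ae measurableT); apply: filterS => x /(_ I).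
  by rewrite ge0_fin_numE.
have aecvg : \forall x \ae mu, cvgn (fun n => Re (v (phi n) x)) /\
    cvgn (fun n => Im (v (phi n) x)).
  apply: filterS aeG => x Gx.
  have c1 : cvgn (series (fun k => 2 ^+ k * normc (g k x) ^+ 2)).
    apply: nneseries_fin_cvg => // k.
    by rewrite mulr_ge0 ?sqr_ge0 ?exprn_ge0.
  have c2 : cvgn (series (geometric 1 (2^-1 : R))).
    by apply: is_cvg_geometric_series; rewrite ger0_norm ?invr_ge0// invf_lt1// ltr1n.
  have c3 : cvgn (series (fun k => geometric 1 (2^-1) k + 2 ^+ k * normc (g k x) ^+ 2)).
    rewrite (_ : series _ = series (geometric 1 (2^-1 : R)) +
      series (fun k => 2 ^+ k * normc (g k x) ^+ 2)); first exact: is_cvgD.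
    by rewrite -seriesD.
  have bnd k : normc (g k x) <= geometric 1 (2^-1) k + 2 ^+ k * normc (g k x) ^+ 2.
    rewrite /geometric /= mul1r exprVn; set t : R := 2 ^+ k; set z := normc _.
    have t0 : 0 < t by rewrite exprn_gt0.
    have : 0 <= t^-1 * (t * z - 1) ^+ 2 by rewrite mulr_ge0 ?sqr_ge0// invr_ge0 ltW.
    have -> : t^-1 * (t * z - 1) ^+ 2 = t * z ^+ 2 - 2 * z + t^-1.
      by field; rewrite gt_eqF.
    have : 0 <= z by exact: normc_ge0.
    lra.
  split; apply: cvg_of_abs_summable c3 => k; apply: le_trans (bnd k).
    rewrite (_ : _ - _ = Re (g k x)); last by rewrite /g !cE.
    exact: normc_Re_le.
  rewrite (_ : _ - _ = Im (g k x)); last by rewrite /g !cE.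
  exact: normc_Im_le.
(* The limit is written as an upper limit, which is measurable without restriction; off the set of
   convergence its value is irrelevant. *)
pose lsup (h : nat -> R -> R) x : R := fine (limn_esup (fun n => (h n x)%:E)).
have mlsup h : (forall n, measurable_fun [set: R] (h n)) ->
    measurable_fun [set: R] (lsup h).
  move=> mh; apply: (measurableT_comp (fine_measurable measurableT)).
  by apply: (@measurable_fun_limn_esup _ _ _ _ (fun n x => (h n x)%:E)) => n;
    exact/measurable_EFinP.
have lsupE h x : cvgn (fun n => h n x) -> (fun n => h n x) @ \oo --> lsup h x.
  move=> ch; rewrite /lsup.
  have ch' : (fun n => (h n x)%:E) @ \oo --> (lim ((fun n => h n x) @ \oo))%:E.
    by apply: cvg_EFin => //; exact: nearW.
  by have [_ ->] := cvg_limn_einf_sup ch'.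
pose f x := lsup (fun n x => Re (v (phi n) x)) x +i* lsup (fun n x => Im (v (phi n) x)) x.
have mf : cmeasurable f.
  split; apply: mlsup => n; have [mr mi] := @sqint_cmeasurable R (v (phi n)) => //.
have aef : \forall x \ae mu, (fun n => normc (v (phi n) x - f x)) @ \oo --> (0 : R).
  apply: filterS aecvg => x [c1 c2].
  have l1 := lsupE (fun n x => Re (v (phi n) x)) x c1.
  have l2 := lsupE (fun n x => Im (v (phi n) x)) x c2.
  apply: (@squeeze0 R _ (fun n => `|Re (f x) - Re (v (phi n) x)| +
     `|Im (f x) - Im (v (phi n) x)|)).
  - by move=> n; exact: normc_ge0.
  - move=> n; apply: le_trans (normc_le_ReIm _) _; rewrite !cE /=.
    by rewrite distrC (distrC (Im (v _ x))).
  - rewrite -[X in _ --> X](addr0 0); apply: cvgD.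
      rewrite -[X in _ --> X](@normr0 R R); apply: cvg_norm.
      by rewrite -(subrr (Re (f x))); apply: cvgB => //; exact: cvg_cst.
    rewrite -[X in _ --> X](@normr0 R R); apply: cvg_norm.
    by rewrite -(subrr (Im (f x))); apply: cvgB => //; exact: cvg_cst.
(* The tail of the subsequence stays close to [v n] for large [n], so Fatou bounds the distance from
   [v n] to [f] along the full sequence. *)
have key (d : R) : 0 < d -> exists M, forall n, (M <= n)%N ->
    (isqr (fun x => v n x - f x)%R <= d%:E)%E.
  move=> d0; have [M hM] := cv d d0.
  exists M => n Mn; apply: (@L2cvg_fatou R (fun j => v (phi (j + M)%N)) (v n) f d mf).
    by apply: filterS aef => x; rewrite -(cvg_shiftn M).
  by move=> j; apply: hM => //; rewrite /phi -addnA addnCA leq_addr.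
have fs : f \in @sqint R.
  have [M hM] := key 1 ltr01.
  have hB : (fun x => v M x - f x) \in @sqint R.
    apply: sqint_mem; first by apply: cmeasurableB => //; exact: sqint_cmeasurable.
    by apply: le_lt_trans (hM _ (leqnn M)) _; exact: ltey.
  (* Square integrability of [f] follows by subtracting from [v M] a difference of finite square
     integral. *)
  rewrite (_ : f = (v M : R -> R[i]) - (fun x => v M x - f x)).
    by apply: rpredB => //; exact: sqint_L2.
  by apply/funext => x; rewrite !fctE opprB addrC subrK.
exists (L2of f); apply/cvgrPdist_le => d d0; have [M hM] := key d d0.
exists M => // n /= /hM; rewrite sub0r normrN ger0_norm ?sqn_ge0// -lee_fin.
rewrite (@sqn_ae _ (v n - L2of f) (fun x => v n x - f x))//.
  by apply: cmeasurableB => //; exact: sqint_cmeasurable.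
by apply: filterS2 (L2B_ae (v n) (L2of f)) (L2of_ae fs) => x -> ->.
Qed.

End Completeness.

(** * The Poisson kernel *)

Section PoissonKernel.
Variable R : realType.
Implicit Types (t y x : R).

(** Adding 1 to the cosine makes the integrand nonnegative, so the improper integral can be computed
    from a primitive. The contribution of the added 1 is removed in [cintegral_expabs]. *)
Lemma derive_exp_trig t y x : 0 < t ->
  is_derive x (1 : R) (fun x => expR (- (t * x)) *
    (- t^-1 + (t ^+ 2 + y ^+ 2)^-1 * (y * sin (y * x) - t * cos (y * x))))
   (expR (- (t * x)) * (1 + cos (y * x))).
Proof.
move=> t0; have h : t ^+ 2 + y ^+ 2 != 0.
  by rewrite gt_eqF// ltr_pwDl ?sqr_ge0// exprn_gt0.
have hl a : is_derive x (1 : R) (fun x => a * x) a.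
  by apply: is_derive_eq; rewrite /GRing.scale/= mulr1.
have h1 : is_derive x (1 : R) (fun x => expR (- (t * x))) (- t * expR (- (t * x))).
  have -> : (fun x : R => expR (- (t * x))) = expR \o (fun x => (- t) * x).
    by apply/funext => z /=; rewrite mulNr.
  by apply: is_derive_eq; rewrite mulNr mulrC.
have h2 : is_derive x (1 : R) (fun x => sin (y * x)) (y * cos (y * x)).
  have -> : (fun x : R => sin (y * x)) = sin \o (fun x => y * x) by [].
  by apply: is_derive_eq; rewrite mulrC.
have h3 : is_derive x (1 : R) (fun x => cos (y * x)) (- y * sin (y * x)).
  have -> : (fun x : R => cos (y * x)) = cos \o (fun x => y * x) by [].
  by apply: is_derive_eq; ring.
apply: is_derive_eq; rewrite /GRing.scale /=.
by field; rewrite h gt_eqF.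
Qed.


Lemma continuous_exp_trig t y :
  continuous (fun x => expR (- (t * `|x|)) * (1 + cos (y * x))).
Proof.
move=> x; apply: cvgM.
  apply: (@continuous_comp _ _ _ (fun x : R => - (t * `|x|)) (@expR R)).
    by apply: cvgN; apply: cvgMr; exact: norm_continuous.
  exact: continuous_expR.
apply: cvgD; first exact: cvg_cst.
apply: (@continuous_comp _ _ _ (fun x : R => y * x) (@cos R)).
  by apply: cvgMr; exact: cvg_id.
exact: continuous_cos.
Qed.

Lemma cvgy_expRN t : 0 < t -> (fun x : R => expR (- (t * x))) @ +oo --> (0 : R).
Proof.
move=> t0; rewrite (_ : (fun x => _) = (fun z => expR (- z)) \o (fun z => t * z))//.
apply: (@cvg_comp _ _ _ _ _ _ (pinfty_nbhs R)); last exact: cvgr_expR.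
exact: gt0_cvgMry.
Qed.

Lemma integral0y_exp_trig t y : 0 < t ->
  (\int[mu]_(x in `[0%R, +oo[) (expR (- (t * `|x|)) * (1 + cos (y * x)))%:E =
   (t^-1 + t / (t ^+ 2 + y ^+ 2))%:E)%E.
Proof.
move=> t0; have h : t ^+ 2 + y ^+ 2 != 0.
  by rewrite gt_eqF// ltr_pwDl ?sqr_ge0// exprn_gt0.
have tn : t != 0 by rewrite gt_eqF.
pose F x := expR (- (t * x)) *
    (- t^-1 + (t ^+ 2 + y ^+ 2)^-1 * (y * sin (y * x) - t * cos (y * x))).
rewrite (@ge0_continuous_FTC2y _ _ F 0 0).
- rewrite -EFinB /F !mulr0 oppr0 expR0 sin0 cos0; congr EFin; field.
  by rewrite ?h ?tn.
- move=> x _; apply: mulr_ge0; first exact: expR_ge0.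
  by have := cos_geN1 (y * x); lra.
- by apply: continuous_subspaceT; exact: continuous_exp_trig.
- pose K := t^-1 + `|(t ^+ 2 + y ^+ 2)^-1| * (`|y| + `|t|).
  have FK x : `|F x| <= K * expR (- (t * x)).
    rewrite /F normrM (ger0_norm (expR_ge0 _)) mulrC ler_wpM2r ?expR_ge0//.
    apply: (le_trans (ler_normD _ _)); rewrite normrN gtr0_norm ?invr_gt0//.
    rewrite lerD2l normrM ler_wpM2l//.
    apply: (le_trans (ler_normB _ _)); rewrite !normrM; apply: lerD.
      by rewrite ler_piMr// ler_norml sin_geN1 sin_le1.
    by rewrite ler_piMr// ler_norml cos_geN1 cos_le1.
  have K0 : (fun x : R => K * expR (- (t * x))) @ +oo --> (0 : R).
    by rewrite -[X in _ --> X](mulr0 K); apply: cvgMr; exact: cvgy_expRN.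
  apply: (@squeeze_cvgr _ _ _ _ (fun x => - (K * expR (- (t * x))))
     (fun x => K * expR (- (t * x)))) => //.
    by apply: nearW => x; rewrite -ler_norml.
  by rewrite -oppr0; exact: cvgN.
- by move=> x _; have [] := derive_exp_trig y x t0.
- apply: cvg_at_right_filter; apply: differentiable_continuous.
  by apply/derivable1_diffP; have [] := derive_exp_trig y 0 t0.
- move=> x; rewrite in_itv/= andbT => x0; rewrite derive1E.
  have [_ ->] := derive_exp_trig y x t0.
  by rewrite ger0_norm// ltW.
Qed.

Lemma integral_exp_trig t y : 0 < t ->
  (\int[mu]_x (expR (- (t * `|x|)) * (1 + cos (y * x)))%:E =
   (2 * (t^-1 + t / (t ^+ 2 + y ^+ 2)))%:E)%E.
Proof.
move=> t0; rewrite ge0_symfun_integralT.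
- by rewrite -set_itvcy integral0y_exp_trig// EFinM.
- move=> x; apply: mulr_ge0; first exact: expR_ge0.
  by have := cos_geN1 (y * x); lra.
- exact: continuous_exp_trig.
- by move=> x /=; rewrite normrN mulrN cosN.
Qed.

Definition expabs (t x : R) : R := expR (- (t * `|x|)).

Lemma expabs_gt0 t x : 0 < expabs t x. Proof. exact: expR_gt0. Qed.

Lemma expabs_le1 t x : 0 <= t -> expabs t x <= 1.
Proof. by move=> t0; rewrite -expR0 ler_expR oppr_le0 mulr_ge0. Qed.

Lemma continuous_expabs t : continuous (expabs t).
Proof.
move=> x; apply: (@continuous_comp _ _ _ (fun x : R => - (t * `|x|)) (@expR R)).
  by apply: cvgN; apply: cvgMr; exact: norm_continuous.
exact: continuous_expR.
Qed.

Lemma measurable_expabs t : measurable_fun [set: R] (expabs t).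
Proof. by apply: continuous_measurable_fun; exact: continuous_expabs. Qed.

Lemma integral_expabs t : 0 < t -> (\int[mu]_x (expabs t x)%:E = (2 / t)%:E)%E.
Proof.
(* At frequency 0 the integrand is twice [expabs t]. *)
move=> t0; have := integral_exp_trig 0 t0.
under eq_integral do rewrite mul0r cos0 mulrC EFinM.
rewrite ge0_integralZl//; last first.
  by apply/measurable_EFinP; exact: measurable_expabs.
have -> : (2 * (t^-1 + t / (t ^+ 2 + 0 ^+ 2)) = 2 * (2 / t))%R.
  by field; rewrite ?gt_eqF.
move=> h; have h2 : (2^-1%:E * (2%:E * \int[mu]_x (expR (- (t * `|x|)))%:E) =
   2^-1%:E * (2 * (2 / t))%:E)%E by congr (_ * _)%E; exact: h.
by move: h2; rewrite muleA -!EFinM mulKf// mulVf// mul1e.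
Qed.

Lemma integrable_expabs t : 0 < t -> mu.-integrable [set: R] (EFin \o expabs t).
Proof.
move=> t0; apply/integrableP; split.
  by apply/measurable_EFinP; exact: measurable_expabs.
under eq_integral do rewrite /= gtr0_norm ?expabs_gt0//.
by rewrite integral_expabs// ltry.
Qed.

Lemma cintegrable_expabs t : 0 < t -> cintegrable (fun x => (expabs t x)%:C).
Proof.
move=> t0; apply/cintegrableP; split => /=; first exact: integrable_expabs.
exact: integrable0.
Qed.

Lemma bounded_expi (h : R -> R) x : normc (expi (h x)) <= 1.
Proof. by rewrite normc_expi. Qed.

Lemma cintegral_expabs t y : 0 < t ->
  cintegral (fun x => (expabs t x)%:C * expi (- (y * x))) =
  (2 * t / (t ^+ 2 + y ^+ 2))%:C.
Proof.
move=> t0.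
have me s : cmeasurable (fun x : R => expi (s * x)).
  apply: cmeasurable_expi; exact: measurable_funM.
have fI : cintegrable (fun x => (expabs t x)%:C * expi (- (y * x))).
  under eq_fun do rewrite -mulNr.
  by apply: (@cintegrable_bounded _ _ _ 1); [exact: cintegrable_expabs|exact: me|
     move=> x; exact: bounded_expi].
have /cintegrableP[fr fi] := fI.
(* The reflection [x -> - x] conjugates the integrand, so the integral is its own conjugate and its
   imaginary part vanishes. *)
have sym : (cintegral (fun x => (expabs t x)%:C * expi (- (y * x))))^* =
    cintegral (fun x => (expabs t x)%:C * expi (- (y * x))).
  have n1 := oppr1_neq0 R.
  rewrite -cintegral_conjc// [RHS](cintegral_affine 0 n1 fI).
  rewrite normrN normr1 mul1r; congr cintegral; apply/funext => x.
  rewrite addr0 mulN1r /expabs normrN mulrN opprK.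
  by apply: complex_eqP; rewrite !cE /= ?cosN ?sinN; ring.
apply: complex_eqP => /=; last first.
  by move: sym => /(congr1 (@complex.Im R)) /=; lra.
have Ec x : Re ((expabs t x)%:C * expi (- (y * x))) = expabs t x * cos (y * x).
  by rewrite cE /= mul0r subr0 cosN.
have ic : mu.-integrable [set: R] (EFin \o (fun x => expabs t x * cos (y * x))).
  apply: eq_integrable fr => // x _; rewrite /comp; congr EFin; exact: Ec.
transitivity (\int[mu]_x (expabs t x * cos (y * x))).
  by apply: eq_Rintegral => x _; exact: Ec.
have h1 : \int[mu]_x (expabs t x + expabs t x * cos (y * x)) =
    2 * (t^-1 + t / (t ^+ 2 + y ^+ 2)).
  rewrite /Rintegral; under eq_integral do rewrite -{1}[expabs _ _]mulr1 -mulrDr.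
  by rewrite integral_exp_trig.
have h2 : \int[mu]_x expabs t x = 2 / t by rewrite /Rintegral integral_expabs.
move: h1; rewrite RintegralD//; last exact: integrable_expabs.
rewrite h2 => E; transitivity (2 * (t^-1 + t / (t ^+ 2 + y ^+ 2)) - 2 / t).
  by rewrite -E; ring.
have h : t ^+ 2 + y ^+ 2 != 0.
  by rewrite gt_eqF// ltr_pwDl ?sqr_ge0// exprn_gt0.
have tn : t != 0 by rewrite gt_eqF.
by field; rewrite ?h ?tn.
Qed.

Definition poisson (t x : R) : R := t / (pi * (t ^+ 2 + x ^+ 2)).

End PoissonKernel.

(** * Fubini for bounded kernels *)

Section FubiniKernel.
Variable R : realType.
Implicit Types (f g : R -> R[i]) (E : R * R -> R[i]).

Lemma product_integrable (k : R * R -> R) (f g : R -> R) :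
  measurable_fun [set: R * R] k ->
  mu.-integrable [set: R] (EFin \o f) -> mu.-integrable [set: R] (EFin \o g) ->
  (forall x y, `|k (x, y)| <= `|f x| * `|g y|) ->
  (mu \x mu)%E.-integrable [set: R * R] (EFin \o k).
Proof.
move=> mk fi gi kfg.
have mE : measurable_fun [set: R * R] (EFin \o k) by exact/measurable_EFinP.
have mf : measurable_fun [set: R] f by apply/measurable_EFinP; exact: measurable_int fi.
have mg : measurable_fun [set: R] g by apply/measurable_EFinP; exact: measurable_int gi.
have Ig := integrable_lty measurableT (integrable_abse gi).
have If := integrable_lty measurableT (integrable_abse fi).
have [_ hI] := @integrable12ltyP _ _ _ _ R mu mu (EFin \o k) mE; apply: hI.
apply: (@le_lt_trans _ _ (\int[mu]_x ((\int[mu]_y `|(g y)%:E|) * `|(f x)%:E|))%E).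
  apply: ge0_le_integral => //.
  - by move=> x _; exact: integral_ge0.
  - have mkE : measurable_fun [set: R * R] (abse \o (EFin \o k)).
      exact: measurableT_comp.
    have k0 z : (0 <= (abse \o (EFin \o k)) z)%E by exact: abse_ge0.
    exact: (@measurable_fun_fubini_tonelli_F _ _ _ _ R mu _ mkE k0).
  - apply: emeasurable_funM => //; apply: measurableT_comp => //.
    exact/measurable_EFinP.
  - move=> x _; rewrite muleC -ge0_integralZl//.
    + apply: ge0_le_integral => //.
      * by apply: measurableT_comp => //; exact: (measurableT_comp mE (pair1_measurable x)).
      * apply: emeasurable_funM => //; apply: measurableT_comp => //.
        exact/measurable_EFinP.
      * by move=> y _ /=; rewrite -EFinM lee_fin.
    + by apply: measurableT_comp => //; exact/measurable_EFinP.
have h0 : (0 <= \int[mu]_y `|(g y)%:E|)%E by exact: integral_ge0.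
have hf : (\int[mu]_y `|(g y)%:E|)%E \is a fin_num by rewrite ge0_fin_numE.
rewrite -(fineK hf) ge0_integralZl//.
- by apply: lte_mul_pinfty => //; rewrite lee_fin fine_ge0.
- by apply: measurableT_comp => //; exact/measurable_EFinP.
- by rewrite lee_fin fine_ge0.
Qed.

Lemma product_slice1 (k : R * R -> R) (f g : R -> R) x :
  measurable_fun [set: R * R] k -> mu.-integrable [set: R] (EFin \o g) ->
  (forall x y, `|k (x, y)| <= `|f x| * `|g y|) ->
  mu.-integrable [set: R] (fun y => (k (x, y))%:E).
Proof.
move=> mk gi kfg.
have mE : measurable_fun [set: R * R] (EFin \o k) by exact/measurable_EFinP.
have gI : mu.-integrable [set: R] (fun y => (f x)%:E * (g y)%:E)%E.
  exact: integrableZl.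
apply: le_integrable gI => //.
  exact: (measurableT_comp mE (pair1_measurable x)).
by move=> y _; rewrite abseM /= -EFinM lee_fin.
Qed.

Lemma product_slice2 (k : R * R -> R) (f g : R -> R) y :
  measurable_fun [set: R * R] k -> mu.-integrable [set: R] (EFin \o f) ->
  (forall x y, `|k (x, y)| <= `|f x| * `|g y|) ->
  mu.-integrable [set: R] (fun x => (k (x, y))%:E).
Proof.
move=> mk fi kfg.
have mE : measurable_fun [set: R * R] (EFin \o k) by exact/measurable_EFinP.
have fI : mu.-integrable [set: R] (fun x => (g y)%:E * (f x)%:E)%E.
  exact: integrableZl.
apply: le_integrable fI => //.
  exact: (measurableT_comp mE (pair2_measurable y)).
by move=> x _; rewrite abseM /= -EFinM lee_fin mulrC.
Qed.

Lemma Rfubini (k : R * R -> R) (f g : R -> R) :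
  measurable_fun [set: R * R] k ->
  mu.-integrable [set: R] (EFin \o f) -> mu.-integrable [set: R] (EFin \o g) ->
  (forall x y, `|k (x, y)| <= `|f x| * `|g y|) ->
  \int[mu]_x \int[mu]_y k (x, y) = \int[mu]_y \int[mu]_x k (x, y).
Proof.
move=> mk fi gi kfg; have kI := product_integrable mk fi gi kfg.
have i1 x := product_slice1 x mk gi kfg; have i2 y := product_slice2 y mk fi kfg.
rewrite /Rintegral; congr fine.
under eq_integral do rewrite fineK ?(integrable_fin_num measurableT (i1 _))//.
under [RHS]eq_integral do rewrite fineK ?(integrable_fin_num measurableT (i2 _))//.
exact: (Fubini kI).
Qed.

Lemma Rfubini_measurable (k : R * R -> R) (f g : R -> R) :
  measurable_fun [set: R * R] k ->
  mu.-integrable [set: R] (EFin \o f) -> mu.-integrable [set: R] (EFin \o g) ->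
  (forall x y, `|k (x, y)| <= `|f x| * `|g y|) ->
  measurable_fun [set: R] (fun x => \int[mu]_y k (x, y)).
Proof.
move=> mk fi gi kfg; have kI := product_integrable mk fi gi kfg.
exact: (measurableT_comp (fine_measurable measurableT) (measurable_fubini_F kI)).
Qed.

Lemma normc_abs (z : R[i]) : normc z = `|normc z|.
Proof. by rewrite ger0_norm// normc_ge0. Qed.

Definition cmeasurable2 E := measurable_fun [set: R * R] (fun z => Re (E z)) /\
  measurable_fun [set: R * R] (fun z => Im (E z)).

Section Kernel.
Variables (f g : R -> R[i]) (E : R * R -> R[i]) (C : R).
Hypotheses (fi : cintegrable f) (gi : cintegrable g) (mE : cmeasurable2 E).
Hypothesis EC : forall x y, normc (E (x, y)) <= C.

Let K (z : R * R) := f z.1 * (g z.2 * E z).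

Let mK : cmeasurable2 K.
Proof.
have [[mf mf'] _] := fi; have [[mg mg'] _] := gi; have [m1 m2] := mE.
have f1 := measurableT_comp mf (@measurable_fst _ _ R R).
have f2 := measurableT_comp mf' (@measurable_fst _ _ R R).
have g1 := measurableT_comp mg (@measurable_snd _ _ R R).
have g2 := measurableT_comp mg' (@measurable_snd _ _ R R).
split; rewrite /K; under eq_fun do rewrite !cE.
  apply: measurable_funB.
    exact: measurable_funM f1 (measurable_funB (measurable_funM g1 m1) (measurable_funM g2 m2)).
  exact: measurable_funM f2 (measurable_funD (measurable_funM g1 m2) (measurable_funM g2 m1)).
apply: measurable_funD.
  exact: measurable_funM f1 (measurable_funD (measurable_funM g1 m2) (measurable_funM g2 m1)).
exact: measurable_funM f2 (measurable_funB (measurable_funM g1 m1) (measurable_funM g2 m2)).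
Qed.

Let KC x y : normc (K (x, y)) <= `|C * normc (f x)| * `|normc (g y)|.
Proof.
have C0 : 0 <= C by exact: le_trans (normc_ge0 _) (EC 0 0).
rewrite /K !normcM normrM (ger0_norm C0) -!normc_abs /=.
rewrite (_ : C * _ * _ = normc (f x) * (normc (g y) * C)); last by ring.
by do 2 (apply: ler_wpM2l; first exact: normc_ge0); exact: EC.
Qed.

Let fI : mu.-integrable [set: R] (EFin \o (fun x => C * normc (f x))).
Proof.
rewrite /comp; under eq_fun do rewrite EFinM.
by apply: integrableZl => //; exact: cintegrable_normc.
Qed.

Let gI := cintegrable_normc gi.

Lemma kernel_cmeasurable1 x : cmeasurable (fun y => E (x, y)).
Proof.
have [m1 m2] := mE; have h1 := measurableT_comp m1 (pair1_measurable x).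
have h2 := measurableT_comp m2 (pair1_measurable x); by split.
Qed.

Lemma kernel_cmeasurable2 y : cmeasurable (fun x => E (x, y)).
Proof.
have [m1 m2] := mE; have h1 := measurableT_comp m1 (pair2_measurable y).
have h2 := measurableT_comp m2 (pair2_measurable y); by split.
Qed.

Lemma kernel_cintegrable1 x : cintegrable (fun y => g y * E (x, y)).
Proof. exact: cintegrable_bounded gi (kernel_cmeasurable1 x) (EC x). Qed.

Lemma kernel_cintegrable2 y : cintegrable (fun x => f x * E (x, y)).
Proof. by apply: cintegrable_bounded fi (kernel_cmeasurable2 y) _ => x; exact: EC. Qed.

(** Used with the Fourier kernel for the multiplication formula, and with a Poisson kernel for
    averages over balls. *)
Lemma cfubini :
  cintegral (fun x => f x * cintegral (fun y => g y * E (x, y))) =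
  cintegral (fun y => g y * cintegral (fun x => f x * E (x, y))).
Proof.
have [mr mi] := mK.
have h1 : (fun x => f x * cintegral (fun y => g y * E (x, y))) =
    (fun x => cintegral (fun y => K (x, y))).
  by apply/funext => x; rewrite -cintegralZ//; exact: kernel_cintegrable1.
have h2 : (fun y => g y * cintegral (fun x => f x * E (x, y))) =
    (fun y => cintegral (fun x => K (x, y))).
  apply/funext => y; rewrite -cintegralZ; last exact: kernel_cintegrable2.
  by congr cintegral; apply/funext => x; rewrite /K mulrCA.
have e1 := Rfubini mr fI gI (fun x y => le_trans (normc_Re_le _) (KC x y)).
have e2 := Rfubini mi fI gI (fun x y => le_trans (normc_Im_le _) (KC x y)).
by rewrite h1 h2; apply: complex_eqP; [exact: e1|exact: e2].
Qed.

Lemma cfubini_measurable :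
  cmeasurable (fun x => f x * cintegral (fun y => g y * E (x, y))).
Proof.
have [mr mi] := mK.
have -> : (fun x => f x * cintegral (fun y => g y * E (x, y))) =
    (fun x => cintegral (fun y => K (x, y))).
  by apply/funext => x; rewrite -cintegralZ//; exact: kernel_cintegrable1.
split.
  apply: Rfubini_measurable mr fI gI _ => x y.
  by apply: le_trans (KC x y); exact: normc_Re_le.
apply: Rfubini_measurable mi fI gI _ => x y.
by apply: le_trans (KC x y); exact: normc_Im_le.
Qed.

End Kernel.

(** Measurability from Fubini requires an integrable outer factor. The factor [exp (- |x|)] is
    inserted and then divided out, as it never vanishes. *)
Lemma cintegral_kernel_measurable g E C : cintegrable g -> cmeasurable2 E ->
  (forall x y, normc (E (x, y)) <= C) ->
  cmeasurable (fun x => cintegral (fun y => g y * E (x, y))).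
Proof.
move=> gi mE EC; have h := cfubini_measurable (cintegrable_expabs ltr01) gi mE EC.
have -> : (fun x => cintegral (fun y => g y * E (x, y))) = (fun x =>
   (expR (1 * `|x|))%:C * ((expabs 1 x)%:C * cintegral (fun y => g y * E (x, y)))).
  apply/funext => x; rewrite mulrA -rmorphM/= /expabs -expRD addrN expR0.
  by rewrite mul1r.
apply: cmeasurableM h; apply: cmeasurable_real; apply: continuous_measurable_fun.
move=> x; apply: (@continuous_comp _ _ _ (fun x : R => 1 * `|x|) (@expR R)).
  by apply: cvgMr; exact: norm_continuous.
exact: continuous_expR.
Qed.

End FubiniKernel.

Section PoissonFacts.
Variable R : realType.
Implicit Types (t y x : R).

Lemma poisson_den_gt0 t x : 0 < t -> 0 < pi * (t ^+ 2 + x ^+ 2) :> R.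
Proof.
by move=> t0; rewrite mulr_gt0 ?pi_gt0// ltr_pwDl ?sqr_ge0// exprn_gt0.
Qed.

Lemma poisson_ge0 t x : 0 < t -> 0 <= poisson t x.
Proof. by move=> t0; rewrite /poisson divr_ge0 ?ltW// poisson_den_gt0. Qed.

Lemma poisson_le t x : 0 < t -> poisson t x <= (pi * t)^-1.
Proof.
move=> t0; have d0 := poisson_den_gt0 x t0.
rewrite /poisson ler_pdivrMr// mulrC ler_pdivlMr ?mulr_gt0 ?pi_gt0//.
have := sqr_ge0 x; have := pi_gt0 R; nra.
Qed.

Lemma poissonN t x : poisson t (- x) = poisson t x.
Proof. by rewrite /poisson sqrrN. Qed.

Lemma measurable_poisson t : 0 < t -> measurable_fun [set: R] (poisson t).
Proof.
move=> t0; apply: continuous_measurable_fun => x.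
apply: cvgM; first exact: cvg_cst.
apply: cvgV; first by rewrite gt_eqF// poisson_den_gt0.
by apply: cvgMr; apply: cvgD; [exact: cvg_cst|exact: exprn_continuous].
Qed.

Lemma poisson_scale t x : 0 < t -> poisson t (t * x) = t^-1 * poisson 1 x.
Proof.
move=> t0; rewrite /poisson; have := pi_gt0 R; move: (@pi R) => p p0.
have h1 : 1 + x ^+ 2 != 0 by rewrite gt_eqF// ltr_pwDl ?sqr_ge0.
have h2 : t ^+ 2 + (t * x) ^+ 2 != 0.
  by rewrite gt_eqF// ltr_pwDl ?sqr_ge0// exprn_gt0.
by field; rewrite h1 h2 !gt_eqF.
Qed.

Lemma integral_poisson1 : (\int[mu]_x (poisson (1 : R) x)%:E = 1)%E.
Proof.
rewrite ge0_symfun_integralT; last 3 first.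
- by move=> x; exact: poisson_ge0.
- move=> x; apply: cvgM; first exact: cvg_cst.
  apply: cvgV; first by rewrite gt_eqF// poisson_den_gt0.
  by apply: cvgMr; apply: cvgD; [exact: cvg_cst|exact: exprn_continuous].
- by move=> x /=; rewrite poissonN.
rewrite -set_itvcy.
have E x : poisson 1 x = pi^-1 * (oneDsqr x)^-1 :> R.
  by rewrite /poisson /oneDsqr expr1n mul1r invfM.
under eq_integral do rewrite E EFinM.
rewrite ge0_integralZl//; last 2 first.
- apply/measurable_EFinP; apply: measurable_funTS; apply: continuous_measurable_fun.
  exact: continuous_oneDsqrV.
- by rewrite lee_fin invr_ge0 pi_ge0.
rewrite integral0y_oneDsqr -!EFinM; congr EFin.
have := pi_gt0 R; move: (@pi R) => p p0; field; by rewrite gt_eqF.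
Qed.

Lemma integral_poisson t y : 0 < t -> (\int[mu]_x (poisson t (x + y))%:E = 1)%E.
Proof.
move=> t0; rewrite (@ge0_integral_affine R t (- y))//; last 3 first.
- by rewrite gt_eqF.
- apply/measurable_EFinP; apply: (measurableT_comp (measurable_poisson t0)).
  by apply: measurable_funD.
- by move=> x; rewrite lee_fin poisson_ge0.
under eq_integral do rewrite subrK poisson_scale// EFinM.
rewrite ge0_integralZl//; last 3 first.
- by apply/measurable_EFinP; exact: measurable_poisson.
- by move=> x _; rewrite lee_fin poisson_ge0.
- by rewrite lee_fin invr_ge0 ltW.
by rewrite integral_poisson1 mule1 gtr0_norm// -EFinM divff// gt_eqF.
Qed.

Lemma fatou_bound (h_ : nat -> R -> R) (h : R -> R) (C : \bar R) :
  (forall n, measurable_fun [set: R] (h_ n)) ->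
  (forall n x, 0 <= h_ n x) ->
  (forall x, (fun n => h_ n x) @ \oo --> h x) ->
  (forall n, (\int[mu]_x (h_ n x)%:E <= C)%E) ->
  (\int[mu]_x (h x)%:E <= C)%E.
Proof.
move=> mh h0 hh hC.
have mE n : measurable_fun [set: R] (fun x => (h_ n x)%:E) by exact/measurable_EFinP.
have h0' n x : [set: R] x -> (0 <= (h_ n x)%:E)%E by rewrite lee_fin.
have -> : (\int[mu]_x (h x)%:E =
    \int[mu]_x limn_einf (fun n => (h_ n x)%:E))%E.
  apply: eq_integral => x _.
  have /cvg_limn_einf_sup[-> //] : (fun n => (h_ n x)%:E) @ \oo --> (h x)%:E.
  by apply: cvg_EFin; [exact: nearW|exact: hh].
apply: le_trans (fatou mu measurableT mE h0') _.
rewrite limn_einf_lim; apply: lime_le; first exact: is_cvg_einfs.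
apply: nearW => n; apply: le_trans (hC n).
by apply: ereal_inf_lbound; exists n => /=.
Qed.

End PoissonFacts.

(** * The Fourier transform on [L2] *)

Section FourierIntegral.
Variable R : realType.
Implicit Types (t y x : R) (f g : R -> R[i]).

Let c0 : R[i] := ((Num.sqrt (2 * pi))^-1)%:C.

Lemma c0_sqr : c0 * c0 = ((2 * pi)^-1)%:C.
Proof.
by rewrite /c0 -rmorphM/= -invfM -expr2 sqr_sqrtr// mulr_ge0 ?pi_ge0.
Qed.

Definition fkernel (z : R * R) : R[i] := expi (- (z.1 * z.2)).

Lemma fkernel_cmeasurable2 : cmeasurable2 fkernel.
Proof.
have m : measurable_fun [set: R * R] (fun z : R * R => - (z.1 * z.2)).
  have h := measurable_funM (@measurable_fst _ _ R R) (@measurable_snd _ _ R R).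
  exact: (measurable_funN h).
have h1 := measurableT_comp (@measurable_cos R) m.
have h2 := measurableT_comp (@measurable_sin R) m; by split.
Qed.

Lemma fkernel_bounded x y : normc (fkernel (x, y)) <= 1.
Proof. by rewrite normc_expi. Qed.

Lemma cmeasurable_character y : cmeasurable (fun x : R => expi (- (y * x))).
Proof.
by under eq_fun do rewrite -mulNr; apply: cmeasurable_expi; exact: measurable_funM.
Qed.

Lemma cintegrable_character f y : cintegrable f ->
  cintegrable (fun x => f x * expi (- (y * x))).
Proof.
move=> fi; apply: (@cintegrable_bounded _ _ _ 1) => //; first exact: cmeasurable_character.
by move=> x; rewrite normc_expi.
Qed.

Lemma fourier_integral_cmeasurable f : cintegrable f ->
  cmeasurable (fourier_integral f).
Proof.
move=> fi; apply: cmeasurableM; first exact: cmeasurable_cst.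
exact: (cintegral_kernel_measurable fi fkernel_cmeasurable2 fkernel_bounded).
Qed.

Lemma fourier_integral_bounded f : cintegrable f ->
  exists C : R, forall y, normc (fourier_integral f y) <= C.
Proof.
move=> fi; exists (normc c0 * (2 * \int[mu]_x normc (f x))) => y.
rewrite /fourier_integral normcM; apply: ler_wpM2l; first exact: normc_ge0.
apply: le_trans (normc_cintegral_le2 (cintegrable_character y fi)) _.
rewrite ler_pM2l//; under eq_Rintegral do rewrite normcM normc_expi mulr1.
exact: lexx.
Qed.

(** The kernel [exp (- i x y)] is symmetric in its two variables, so this is Fubini. *)
Lemma multiplication_formula f g : cintegrable f -> cintegrable g ->
  cintegral (fun x => f x * fourier_integral g x) =
  cintegral (fun x => g x * fourier_integral f x).
Proof.
move=> fi gi.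
have h f' g' : cintegrable f' -> cintegrable g' ->
   cintegral (fun x => f' x * fourier_integral g' x) =
   c0 * cintegral (fun x => f' x * cintegral (fun y => g' y * fkernel (x, y))).
  move=> fi' gi'; have [C hC] := fourier_integral_bounded gi'.
  have mF := fourier_integral_cmeasurable gi'.
  have hI : cintegrable (fun x => f' x * fourier_integral g' x).
    exact: cintegrable_bounded fi' mF hC.
  have c0n : c0 != 0.
    rewrite /c0 -[0]/(0%:C) (inj_eq (@complexI R)) invr_eq0 sqrtr_eq0 -ltNge.
    by rewrite mulr_gt0// pi_gt0.
  have hI2 : cintegrable (fun x => f' x * cintegral (fun y => g' y * fkernel (x, y))).
    have := cintegrableZ c0^-1 hI; congr cintegrable; apply/funext => x.
    by rewrite /fourier_integral mulrCA mulKf.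
  by rewrite -cintegralZ//; congr cintegral; apply/funext => x; rewrite mulrCA.
have E := cfubini fi gi fkernel_cmeasurable2 fkernel_bounded.
apply: (etrans (h f g fi gi)); apply: (etrans _ (esym (h g f gi fi))).
congr (_ * _); apply: (etrans E).
congr cintegral; apply/funext => x; congr (_ * _); congr cintegral.
by apply/funext => y; congr (_ * _); rewrite /fkernel /= mulrC.
Qed.

Lemma fourier_integral_expabs t y x : 0 < t ->
  fourier_integral (fun xi => (expabs t xi)%:C * expi (- (y * xi))) x =
  c0 * (2 * t / (t ^+ 2 + (x + y) ^+ 2))%:C.
Proof.
move=> t0; rewrite /fourier_integral -cintegral_expabs//; congr (_ * _).
congr cintegral; apply/funext => xi; rewrite -mulrA -expiD; congr (_ * expi _).
by ring.
Qed.

(** The multiplication formula moves the outer transform onto the damped character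
    [expabs t xi * exp (- i y xi)], whose transform is a Poisson kernel. Two forward transforms
    reflect the variable, hence [x + y] in place of [x - y]. *)
Lemma fourier_integral_poisson f t y : cintegrable f -> 0 < t ->
  fourier_integral (fun xi => fourier_integral f xi * (expabs t xi)%:C) y =
  cintegral (fun x => f x * (poisson t (x + y))%:C).
Proof.
move=> fi t0.
pose g xi := (expabs t xi)%:C * expi (- (y * xi)).
have gi : cintegrable g by apply: cintegrable_character; exact: cintegrable_expabs.
rewrite {1}/fourier_integral.
have -> : (fun x => fourier_integral f x * (expabs t x)%:C * expi (- (y * x))) =
   (fun x => g x * fourier_integral f x).
  by apply/funext => x; rewrite /g -mulrA mulrC.
rewrite multiplication_formula// -cintegralZ.
  congr cintegral; apply/funext => x; rewrite /g fourier_integral_expabs//.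
  rewrite mulrCA; congr (_ * _); rewrite mulrA c0_sqr -rmorphM/=; congr (_%:C).
  have h2 : t ^+ 2 + (x + y) ^+ 2 != 0.
    by rewrite gt_eqF// ltr_pwDl ?sqr_ge0// exprn_gt0.
  rewrite /poisson; have := pi_gt0 R; move: (@pi R) => p p0; field.
  by rewrite h2 gt_eqF.
have [C hC] := fourier_integral_bounded gi.
exact: cintegrable_bounded fi (fourier_integral_cmeasurable gi) hC.
Qed.

End FourierIntegral.

Lemma conjcM (R : realType) (z w : R[i]) : conjc (z * w) = conjc z * conjc w.
Proof. by apply: complex_eqP; rewrite !cE; ring. Qed.

Lemma ler_norm_mul (R : realDomainType) (a p c : R) :
  0 <= a -> 0 <= p -> p <= c -> `|a * p| <= `|c * a|.
Proof.
move=> a0 p0 pc; rewrite !normrM mulrC; apply: ler_wpM2r => //.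
by rewrite !ger0_norm//; exact: le_trans pc.
Qed.

(** * Bessel's inequality for the Fourier integral *)

Section Bessel.
Variable R : realType.
Implicit Types (t y x : R) (f g : R -> R[i]).

Lemma integrable_poisson t y : 0 < t ->
  mu.-integrable [set: R] (EFin \o (fun x => poisson t (x + y))).
Proof.
move=> t0; apply/integrableP; split.
  apply/measurable_EFinP; apply: (measurableT_comp (measurable_poisson t0)).
  exact: measurable_funD.
under eq_integral do rewrite /= ger0_norm ?poisson_ge0//.
by rewrite integral_poisson// ltry.
Qed.

Lemma sqint_normc2_integrable f : f \in @sqint R ->
  mu.-integrable [set: R] (EFin \o (fun x => normc (f x) ^+ 2)).
Proof.
move=> fs; have [mf f2] := set_mem fs; apply/integrableP; split.
  by apply/measurable_EFinP; exact: measurable_normc2.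
by under eq_integral do rewrite /= ger0_norm ?sqr_ge0//.
Qed.

(** Lets [|F f|^2] be read as a product of two transforms, to which the multiplication formula
    applies. *)
Lemma fourier_integral_conj f : cintegrable f ->
  fourier_integral (fun x => (f (- x))^*) = (fun xi => (fourier_integral f xi)^*).
Proof.
move=> fi; apply/funext => xi; rewrite /fourier_integral.
rewrite conjcM; congr (_ * _).
  by apply: complex_eqP; rewrite !cE /= ?oppr0.
rewrite [RHS](_ : _ = cintegral (fun x => (f x * expi (- (xi * x)))^*)); last first.
  by rewrite cintegral_conjc//; exact: cintegrable_character.
have n1 := oppr1_neq0 R.
rewrite [RHS](cintegral_affine 0 n1); last first.
  by apply: cintegrable_conjc; exact: cintegrable_character.
rewrite normrN normr1 mul1r; congr cintegral; apply/funext => x.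
by rewrite addr0 mulN1r conjcM; congr (_ * _); rewrite conjc_expi mulrN opprK.
Qed.

Lemma poisson_bound f t (y : R) (z : R[i]) : cintegrable f -> f \in @sqint R -> 0 < t ->
  Re (z * cintegral (fun x => f x * (poisson t (x + y))%:C)) <=
  2^-1 * normc z ^+ 2 + 2^-1 * \int[mu]_x (normc (f x) ^+ 2 * poisson t (x + y)).
Proof.
move=> fi fs t0; have [mf _] := fi.
have mp : measurable_fun [set: R] (fun x => poisson t (x + y)).
  by apply: (measurableT_comp (measurable_poisson t0)); exact: measurable_funD.
have pI := integrable_poisson y t0.
have hI : cintegrable (fun x => z * (f x * (poisson t (x + y))%:C)).
  apply: cintegrableZ; apply: (@cintegrable_bounded _ _ _ ((pi * t)^-1)) => //.
  by move=> x; rewrite normc_real ger0_norm ?poisson_ge0 ?poisson_le.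
rewrite -cintegralZ; last first.
  apply: (@cintegrable_bounded _ _ _ ((pi * t)^-1)) => //.
  by move=> x; rewrite normc_real ger0_norm ?poisson_ge0 ?poisson_le.
have p1 : \int[mu]_x poisson t (x + y) = 1 by rewrite /Rintegral integral_poisson.
have fpI : mu.-integrable [set: R]
    (EFin \o (fun x => normc (f x) ^+ 2 * poisson t (x + y))).
  have h := integrableZl measurableT (pi * t)^-1 (sqint_normc2_integrable fs).
  apply: le_integrable h => //.
    apply/measurable_EFinP; apply: measurable_funM => //; exact: measurable_normc2.
  move=> x _ /=; rewrite -?EFinM lee_fin.
  exact: ler_norm_mul (sqr_ge0 _) (poisson_ge0 _ t0) (poisson_le _ t0).
(* The kernel has mass 1, so the constant term is itself an integral against it and the two sides
   can be compared under the integral sign. *)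
have -> : 2^-1 * normc z ^+ 2 = \int[mu]_x (2^-1 * normc z ^+ 2 * poisson t (x + y)).
  by rewrite RintegralZl// p1 mulr1.
rewrite -RintegralZl// -RintegralD//; last 2 first.
- by rewrite /comp; under eq_fun do rewrite EFinM; exact: integrableZl.
- by rewrite /comp; under eq_fun do rewrite EFinM; exact: integrableZl.
have /cintegrableP[hr _] := hI.
apply: le_Rintegral => //.
- rewrite /comp; under eq_fun do rewrite EFinD !EFinM.
  by apply: integrableD => //; exact: integrableZl.
move=> x _; apply: le_trans (ler_norm _) _; apply: le_trans (normc_Re_le _) _.
rewrite !normcM normc_real (ger0_norm (poisson_ge0 _ t0)).
have := poisson_ge0 (x + y) t0; set p := poisson _ _.
have := sqr_ge0 (normc z - normc (f x)).
set a := normc z; set b := normc _ => h p0.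
rewrite (_ : 2^-1 * a ^+ 2 * p + _ = (2^-1 * (a ^+ 2 + b ^+ 2)) * p); last by ring.
rewrite mulrA; apply: ler_wpM2r => //; nra.
Qed.

(* By Fubini the left-hand side is the integral of
   [f x * conj (f y) * poisson t (x - y)], which AM-GM bounds by [isqr f] because
   the Poisson kernel has mass 1. *)
Lemma bessel_expabs f t : cintegrable f -> f \in @sqint R -> 0 < t ->
  (\int[mu]_x (expabs t x * normc (fourier_integral f x) ^+ 2)%:E <= isqr f)%E.
Proof.
move=> fi fs t0; have [mf f2] := set_mem fs.
have fn : isqr f \is a fin_num by rewrite ge0_fin_numE ?isqr_ge0.
have n1 := oppr1_neq0 R.
(* The transform of [f'] is the conjugate of that of [f]; the multiplication formula thus rewrites
   the damped integral of [|F f|^2] as the integral of [f'] times a Poisson integral of [f]. *)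
pose f' x := (f (- x))^*.
have fi' : cintegrable f'.
  have := cintegrable_affine 0 n1 (cintegrable_conjc fi).
  by under eq_fun do rewrite mulN1r addr0.
have [mf' _] := fi'.
have isqrf' : isqr f' = isqr f.
  rewrite (isqr_affine 0 n1 mf) normrN normr1 mul1e.
  rewrite /isqr; apply: eq_integral => x _.
  by rewrite /f' normc_conjc mulN1r addr0.
have fs' : f' \in @sqint R by apply: sqint_mem => //; rewrite isqrf'.
have [C hC] := fourier_integral_bounded fi.
have mF := fourier_integral_cmeasurable fi.
pose g xi := fourier_integral f xi * (expabs t xi)%:C.
have gi : cintegrable g.
  have := cintegrable_bounded (cintegrable_expabs t0) mF hC.
  by under eq_fun do rewrite mulrC.
have [D hD] := fourier_integral_bounded gi.
have mG := fourier_integral_cmeasurable gi.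
have E := multiplication_formula gi fi'.
have Fc : fourier_integral f' = (fun xi => conjc (fourier_integral f xi)).
  exact: fourier_integral_conj fi.
have L : (fun x => g x * fourier_integral f' x) =
    (fun x => (expabs t x * normc (fourier_integral f x) ^+ 2)%:C).
  by apply/funext => x; rewrite Fc /g mulrAC mulc_conjc mulrC -rmorphM.
rewrite L in E.
have E' : \int[mu]_x (expabs t x * normc (fourier_integral f x) ^+ 2) =
    \int[mu]_x Re (f' x * fourier_integral g x).
  exact: (congr1 (@complex.Re R) E).
have LI : mu.-integrable [set: R]
    (EFin \o (fun x => expabs t x * normc (fourier_integral f x) ^+ 2)).
  have : cintegrable (fun x => g x * fourier_integral f' x).
    apply: cintegrable_bounded gi (fourier_integral_cmeasurable fi') _ => x.
    by rewrite Fc normc_conjc; exact: hC.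
  by rewrite L => /cintegrableP[].
have hI : cintegrable (fun x => f' x * fourier_integral g x).
  exact: cintegrable_bounded fi' mG hD.
(* By Tonelli and the mass of the kernel in [y], the integral of [Q] is [isqr f]. The two halves of
   the AM-GM bound, from [f'] and from [Q], then add up to exactly [isqr f]. *)
pose Q y := \int[mu]_x (normc (f x) ^+ 2 * poisson t (x + y)).
pose k (z : R * R) := (normc (f z.1) ^+ 2 * poisson t (z.1 + z.2))%:E.
have mk : measurable_fun [set: R * R] k.
  apply/measurable_EFinP; apply: measurable_funM.
    exact: (measurableT_comp (measurable_normc2 mf) (@measurable_fst _ _ R R)).
  apply: (measurableT_comp (measurable_poisson t0)).
  by apply: measurable_funD; [exact: measurable_fst|exact: measurable_snd].
have k0 z : (0 <= k z)%E by rewrite lee_fin mulr_ge0 ?sqr_ge0 ?poisson_ge0.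
have QE : (\int[mu]_y (\int[mu]_x k (x, y)) = isqr f)%E.
  rewrite -(@fubini_tonelli _ _ _ _ R mu mu k mk k0) /isqr.
  apply: eq_integral => x _; rewrite /k /=.
  under eq_integral do rewrite EFinM addrC.
  rewrite ge0_integralZl//.
  - by rewrite integral_poisson// mule1.
  - apply/measurable_EFinP; apply: (measurableT_comp (measurable_poisson t0)).
    exact: measurable_funD.
  - by move=> y _; rewrite lee_fin poisson_ge0.
  - by rewrite lee_fin sqr_ge0.
have mQ : measurable_fun [set: R] (fun y => \int[mu]_x k (x, y))%E.
  exact: (@measurable_fun_fubini_tonelli_G _ _ _ _ R mu _ mk k0).
have Qfin y : (\int[mu]_x k (x, y))%E \is a fin_num.
  apply: (integrable_fin_num measurableT).
  have h := integrableZl measurableT (pi * t)^-1 (sqint_normc2_integrable fs).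
  apply: le_integrable h => //.
    exact: (measurableT_comp mk (pair2_measurable y)).
  move=> x _ /=; rewrite -?EFinM lee_fin.
  exact: ler_norm_mul (sqr_ge0 _) (poisson_ge0 _ t0) (poisson_le _ t0).
have QI : mu.-integrable [set: R] (EFin \o Q).
  have QI0 : mu.-integrable [set: R] (fun y => \int[mu]_x k (x, y))%E.
    apply/integrableP; split => //.
    under eq_integral do rewrite gee0_abs ?integral_ge0//.
    by rewrite QE.
  apply: eq_integrable QI0 => // y _.
  by rewrite /Q /Rintegral /= fineK//; exact: Qfin.
have QE' : \int[mu]_y Q y = fine (isqr f).
  rewrite /Rintegral -QE; congr fine; apply: eq_integral => y _.
  by rewrite /Q /Rintegral fineK//; exact: Qfin.
have f'2 : \int[mu]_x (normc (f' x) ^+ 2) = fine (isqr f) by rewrite -isqrf'.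
have f'I := sqint_normc2_integrable fs'.
rewrite -(fineK (integrable_fin_num measurableT LI)) -(fineK fn) lee_fin.
rewrite [leLHS]E'.
have -> : fine (isqr f) = \int[mu]_y (2^-1 * normc (f' y) ^+ 2 + 2^-1 * Q y).
  rewrite RintegralD//; last 2 first.
  - by rewrite /comp; under eq_fun do rewrite EFinM; exact: integrableZl.
  - by rewrite /comp; under eq_fun do rewrite EFinM; exact: integrableZl.
  by rewrite !RintegralZl// f'2 QE'; lra.
have /cintegrableP[hr _] := hI.
apply: le_Rintegral => //.
  rewrite /comp; under eq_fun do rewrite EFinD !EFinM.
  by apply: integrableD => //; exact: integrableZl.
move=> y _; rewrite /g fourier_integral_poisson//; exact: poisson_bound.
Qed.

Lemma expabs_cvg1 x : (fun n => expabs (n.+1%:R^-1) x) @ \oo --> (1 : R).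
Proof.
have h : (fun n => - (n.+1%:R^-1 * `|x|)) @ \oo --> (- (0 * `|x|) : R).
  by apply: cvgN; apply: cvgM; [exact: cvg_harmonic|exact: cvg_cst].
have := cvg_comp _ _ h (@continuous_expR R _).
by rewrite mul0r oppr0 expR0.
Qed.

Lemma bessel f : cintegrable f -> f \in @sqint R ->
  (isqr (fourier_integral f) <= isqr f)%E.
Proof.
move=> fi fs; have mF := fourier_integral_cmeasurable fi.
apply: (@fatou_bound R
  (fun n x => expabs n.+1%:R^-1 x * normc (fourier_integral f x) ^+ 2)).
- move=> n; apply: measurable_funM; first exact: measurable_expabs.
  exact: measurable_normc2.
- by move=> n x; rewrite mulr_ge0 ?sqr_ge0// ltW// expabs_gt0.
- move=> x; rewrite -[X in _ --> X]mul1r; apply: cvgM; last exact: cvg_cst.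
  exact: expabs_cvg1.
- by move=> n; apply: bessel_expabs.
Qed.

End Bessel.

(** * Functions with vanishing integrals over balls *)

Section BallUniqueness.
Variable R : realType.

(** At a Lebesgue point the mean of [|f y - f x|] over small balls tends to 0, while the mean of
    [f y - f x] is [- f x]. *)
Lemma ae0_of_balls (f : R -> R) : locally_integrable [set: R] f ->
  (forall x r : R, 0 < r -> \int[mu]_(y in ball x r) f y = 0) ->
  \forall x \ae mu, f x = 0.
Proof.
move=> fl f0; apply: filterS (lebesgue_differentiation fl) => x.
rewrite /lebesgue_pt => h; apply/eqP; rewrite -normr_le0.
apply/ler_addgt0Pr => e e0; rewrite add0r.
have [mf _ lf] := fl.
have h1 : \forall r \near (0:R)^'+, (davg f x r < e%:E)%E.
  move/fine_cvgP : h => [hfin hlim].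
  apply: filterS2 hfin (cvgr_lt _ hlim _ e0) => r rfin /=.
  by rewrite -lte_fin fineK.
near (0:R)^'+ => r.
have r0 : 0 < r by near: r; exact: nbhs_right_gt.
have : (davg f x r < e%:E)%E by near: r.
have bI : mu.-integrable (ball x r) (EFin \o f).
  apply/integrableP; split.
    by apply/measurable_EFinP; exact: measurable_funS mf.
  apply: (@le_lt_trans _ _ (\int[mu]_(y in closed_ball x r) `|(f y)%:E|)%E).
    apply: ge0_subset_integral => //; first exact: measurable_ball.
    - exact: measurable_closed_ball.
    - apply/measurable_EFinP; apply: measurableT_comp => //.
      exact: measurable_funS mf.
    - exact: subset_closed_ball.
  apply: lf => //; exact: closed_ballR_compact.
have mB : mu (ball x r) = (r *+ 2)%:E by exact: lebesgue_measure_ball (ltW r0).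
have mBf : (mu (ball x r) < +oo)%E by rewrite mB ltry.
have cI : mu.-integrable (ball x r) (EFin \o (fun=> f x)).
  apply: measurable_bounded_integrable => //; first exact: measurable_ball.
  by exists `|f x|; split => // M hM y _ /=; exact: ltW.
have dI : mu.-integrable (ball x r) (EFin \o (fun y => f y - f x)).
  rewrite /comp; under eq_fun do rewrite EFinB; apply: integrableB => //.
  exact: measurable_ball.
rewrite /davg /iavg (lebesgue_measure_ball _ (ltW r0)) => h2.
have E1 : \int[mu]_(y in ball x r) (f y - f x) = - (f x * (r *+ 2)).
  rewrite RintegralB//; last exact: measurable_ball.
  rewrite f0// Rintegral_cst ?sub0r; last exact: measurable_ball.
  by congr (- (_ * _)); rewrite -[RHS]/(fine (r *+ 2)%:E) -mB.
have r2 : 0 < r *+ 2 by rewrite mulrn_wgt0.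
have : `|\int[mu]_(y in ball x r) (f y - f x)| <= e * (r *+ 2).
  apply: le_trans (le_normr_Rintegral _ dI) _; first exact: measurable_ball.
  have nI := integrable_norm dI.
  rewrite -lee_fin /Rintegral fineK; last first.
    by apply: integrable_fin_num nI; exact: measurable_ball.
  move: h2; rewrite inver gt_eqF// muleC -lte_pdivlMr; last by rewrite invr_gt0.
  by rewrite invrK => /ltW.
by rewrite E1 normrN normrM (gtr0_norm r2) ler_pM2r.
Unshelve. all: by end_near. Qed.

Lemma cae0_of_balls (f : R -> R[i]) :
  locally_integrable [set: R] (fun x => Re (f x)) ->
  locally_integrable [set: R] (fun x => Im (f x)) ->
  (forall x r : R, 0 < r ->
    cintegral (fun y => (\1_(ball x r) y)%:C * f y) = 0) ->
  \forall x \ae mu, f x = 0.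
Proof.
move=> l1 l2 f0.
have h (p : R -> R) x r : \int[mu]_(y in ball x r) p y = \int[mu]_y (\1_(ball x r) y * p y).
  rewrite Rintegral_mkcond; apply: eq_Rintegral => y _.
  by rewrite patchE indicE; case: ifP => _; rewrite ?mul1r ?mul0r.
have h1 : \forall x \ae mu, Re (f x) = 0.
  apply: ae0_of_balls => // x r r0; have /(congr1 (@complex.Re R)) := f0 x r r0.
  rewrite h => E; rewrite -[RHS]E; apply: eq_Rintegral => y _.
  by rewrite cE /= mul0r subr0.
have h2 : \forall x \ae mu, Im (f x) = 0.
  apply: ae0_of_balls => // x r r0; have /(congr1 (@complex.Im R)) := f0 x r r0.
  rewrite h => E; rewrite -[RHS]E; apply: eq_Rintegral => y _.
  by rewrite cE /= mul0r addr0.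
by apply: filterS2 h1 h2 => x e1 e2; apply: complex_eqP.
Qed.

Lemma locally_integrable_cintegrable (f : R -> R[i]) : cintegrable f ->
  locally_integrable [set: R] (fun x => Re (f x)) /\
  locally_integrable [set: R] (fun x => Im (f x)).
Proof.
by move=> /cintegrableP[fr fi]; split; apply: open_integrable_locally => //;
  exact: openT.
Qed.

Lemma cintegrable_ball (x r : R) : cintegrable (fun y => (\1_(ball x r) y : R)%:C).
Proof.
apply/cintegrableP; split => /=; last exact: integrable0.
rewrite ball_itv; exact: integrable_indic_itv.
Qed.

Lemma cintegrable_ball_sqint (f : R -> R[i]) (x r : R) : f \in @sqint R ->
  cintegrable (fun y => (\1_(ball x r) y)%:C * f y).
Proof.
move=> fs; have [mf _] := set_mem fs.
have [mb _] := cintegrable_ball x r.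
apply: (@cintegrable_dom _ _ (fun y => \1_(ball x r) y + normc (f y) ^+ 2)).
- exact: cmeasurableM.
- rewrite /comp; under eq_fun do rewrite EFinD.
  apply: integrableD => //; last exact: sqint_normc2_integrable.
  by have /cintegrableP[] := cintegrable_ball x r.
move=> y; rewrite normcM normc_real ger0_norm ?indicE//.
case: (_ \in _); last by rewrite mul0r add0r sqr_ge0.
by rewrite /= mul1r; have := sqr_ge0 (normc (f y) - 1); nra.
Qed.

Lemma locally_integrable_sqint (f : R -> R[i]) : f \in @sqint R ->
  locally_integrable [set: R] (fun x => Re (f x)) /\
  locally_integrable [set: R] (fun x => Im (f x)).
Proof.
move=> fs; have [[mr mi] f2] := set_mem fs.
have h (p : R -> R) : measurable_fun [set: R] p ->
   (forall x, `|p x| <= normc (f x)) -> locally_integrable [set: R] p.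
  move=> mp pf; split; [exact: mp|exact: openT|] => K _ cK.
  have mK := compact_measurable cK.
  apply: (@le_lt_trans _ _ (\int[mu]_(x in K) (1 + normc (f x) ^+ 2)%:E)%E).
    apply: ge0_le_integral => //.
    - apply/measurable_EFinP; apply: measurableT_comp => //.
      exact: measurable_funTS mp.
    - apply/measurable_EFinP; apply: measurable_funD => //.
      by apply: measurable_funTS; exact: measurable_normc2.
    - move=> x _; rewrite lee_fin; apply: le_trans (pf x) _.
      by have := sqr_ge0 (normc (f x) - 1); nra.
  under eq_integral do rewrite EFinD.
  rewrite ge0_integralD//; last first.
    by apply/measurable_EFinP; apply: measurable_funTS; exact: measurable_normc2.
    by move=> x _; rewrite lee_fin sqr_ge0.
  apply: lte_add_pinfty.
    by rewrite integral_cst// mul1e; exact: compact_finite_measure.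
  apply: le_lt_trans f2; apply: ge0_subset_integral => //.
  - by apply/measurable_EFinP; apply: measurable_normc2.
  - by move=> x _; rewrite lee_fin sqr_ge0.
by split; apply: h => // x; [exact: normc_Re_le|exact: normc_Im_le].
Qed.

End BallUniqueness.

(** * The Poisson kernel as an approximate identity *)

Section PoissonApproximation.
Variable R : realType.
Implicit Types (a r x y t : R) (h f : R -> R[i]).

(** The convolution of the Poisson kernel with the indicator of the ball, evaluated at [- x]. *)
Definition ball_poisson a r t x : R := \int[mu]_y (\1_(ball a r) y * poisson t (x + y)).

Lemma measurable_ind_ball a r : measurable_fun [set: R] (\1_(ball a r) : R -> R).
Proof. by apply: measurable_indic; exact: measurable_ball. Qed.

(** The substitution [y = t * z - x] leaves [t] only inside the indicator, so that [poisson 1]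
    dominates for all [t] at once. *)
Lemma ball_poissonE a r t x : 0 < t ->
  ball_poisson a r t x = \int[mu]_z (\1_(ball a r) (t * z - x) * poisson 1 z).
Proof.
move=> t0; rewrite /ball_poisson /Rintegral; congr fine.
rewrite (@ge0_integral_affine R t (- x))//; last 3 first.
- by rewrite gt_eqF.
- apply/measurable_EFinP; apply: measurable_funM; first exact: measurable_ind_ball.
  by apply: (measurableT_comp (measurable_poisson t0)); exact: measurable_funD.
- by move=> y; rewrite lee_fin mulr_ge0 ?poisson_ge0// indicE.
rewrite -ge0_integralZl//; last 2 first.
- apply/measurable_EFinP; apply: measurable_funM.
    exact: (measurableT_comp (measurable_ind_ball a r) (affine_measurable t (- x))).
  apply: (measurableT_comp (measurable_poisson t0)).
  by apply: measurable_funD => //; exact: affine_measurable.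
- by move=> y _; rewrite lee_fin mulr_ge0 ?poisson_ge0// indicE.
apply: eq_integral => z _; rewrite -EFinM; congr EFin.
have -> : x + (t * z - x) = t * z by rewrite addrC subrK.
rewrite (poisson_scale _ t0) gtr0_norm// mulrCA.
by rewrite mulVKf// gt_eqF.
Qed.

Lemma integrable_poisson1 : mu.-integrable [set: R] (EFin \o poisson 1).
Proof.
have := @integrable_poisson R 1 0 ltr01; rewrite /comp.
by under eq_fun do rewrite addr0.
Qed.

Lemma ball_poisson_bound a r t x : 0 < t -> `|ball_poisson a r t x| <= 1.
Proof.
move=> t0; rewrite ball_poissonE// ger0_norm; last first.
  by apply: Rintegral_ge0 => z _; rewrite mulr_ge0 ?poisson_ge0// indicE.
have I1 : \int[mu]_z poisson 1 z = 1 :> R by rewrite /Rintegral integral_poisson1.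
rewrite -[leRHS]I1; apply: le_Rintegral => //; last 2 first.
- exact: integrable_poisson1.
- move=> z _; rewrite indicE; have := @poisson_ge0 R 1 z ltr01.
  by case: (_ \in _); rewrite /= ?mul1r ?mul0r.
have I2 := integrable_poisson1; apply: le_integrable I2 => //.
  apply/measurable_EFinP; apply: measurable_funM; last exact: measurable_poisson.
  exact: (measurableT_comp (measurable_ind_ball a r) (affine_measurable t (- x))).
move=> z _; rewrite /= lee_fin normrM ler_piMl// indicE.
by case: (_ \in _); rewrite ?normr1 ?normr0.
Qed.

(** At the two excluded endpoints the limit is 1/2, which is not the value of the indicator. *)
Lemma ball_poisson_cvg a r x : - x != a - r -> - x != a + r ->
  (fun n => ball_poisson a r n.+1%:R^-1 x) @ \oo --> (\1_(ball a r) (- x) : R).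
Proof.
move=> xl xr.
have t0 := @invSn_gt0 R.
have I1 : \int[mu]_z (\1_(ball a r) (- x) * poisson 1 z) = \1_(ball a r) (- x) :> R.
  rewrite RintegralZl//; last exact: integrable_poisson1.
  by rewrite /Rintegral integral_poisson1 mulr1.
rewrite -[X in _ --> X]I1; under eq_fun do rewrite ball_poissonE//.
apply: (@Rdominated_convergence _ _ _ (poisson 1)).
- move=> n; apply: measurable_funM; last exact: measurable_poisson.
  exact: (measurableT_comp (measurable_ind_ball a r) (affine_measurable _ (- x))).
- by apply: measurable_funM => //; exact: measurable_poisson.
- apply: aeW => z; apply: cvgM; last exact: cvg_cst.
  have hl : (fun n => n.+1%:R^-1 * z - x) @ \oo --> - x.
    rewrite -[X in _ --> X]add0r; apply: cvgD; last exact: cvg_cst.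
    rewrite -(mul0r z); apply: cvgM; last exact: cvg_cst.
    exact: cvg_harmonic.
  apply: cvg_near_cst.
  have bE y : (y \in (ball a r : set R)) = (a - r < y < a + r).
    by rewrite ball_itv mem_setE in_itv.
  have [bx|nbx] := boolP (- x \in (ball a r : set R)).
    rewrite bE in bx; case/andP: bx => bx1 bx2; near=> n.
    rewrite !indicE !bE bx1 bx2 (_ : (_ < _ * z - x < _) = true)//.
    apply/andP; split; near: n; [exact: (cvgr_gt _ hl)|exact: (cvgr_lt _ hl)].
  have nin y : (y < a - r) || (a + r < y) -> (a - r < y < a + r) = false.
    by case/orP => h; rewrite (lt_gtF h) ?andbF.
  have bx : (- x < a - r) || (a + r < - x).
    move: nbx; rewrite bE negb_and -!leNgt.
    by rewrite le_eqVlt (negbTE xl) /= le_eqVlt eq_sym (negbTE xr).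
  case/orP : (bx) => bx'; near=> n; rewrite !indicE !bE (nin _ bx) nin//;
    apply/orP; [left|right]; near: n; [exact: (cvgr_lt _ hl)|exact: (cvgr_gt _ hl)].
- exact: integrable_poisson1.
- move=> n z; rewrite normrM ger0_norm ?indicE// ger0_norm ?poisson_ge0//.
  by case: (_ \in _); rewrite /= ?mul1r ?mul0r ?poisson_ge0.
Unshelve. all: by end_near. Qed.

Definition poisson_conv h t y : R[i] :=
  cintegral (fun x => h x * (poisson t (x + y))%:C).

Lemma poisson_conv_fubini h a r t : cintegrable h -> 0 < t ->
  cintegral (fun y => (\1_(ball a r) y)%:C * poisson_conv h t y) =
  cintegral (fun x => h x * (ball_poisson a r t x)%:C).
Proof.
move=> hi t0; pose E (z : R * R) : R[i] := (poisson t (z.2 + z.1))%:C.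
have mE : cmeasurable2 E.
  split; last exact: measurable_cst.
  apply: (measurableT_comp (measurable_poisson t0)).
  by apply: measurable_funD; [exact: measurable_snd|exact: measurable_fst].
have EC x y : normc (E (x, y)) <= (pi * t)^-1.
  by rewrite normc_real ger0_norm ?poisson_ge0 ?poisson_le.
apply: (etrans (cfubini (cintegrable_ball a r) hi mE EC)).
congr cintegral; apply/funext => x; congr (_ * _).
have Cr (p : R -> R) : cintegral (fun y => (p y)%:C) = (\int[mu]_y p y)%:C.
  by rewrite /cintegral /= Rintegral_cst// mul0r.
by rewrite /ball_poisson -Cr; congr cintegral; apply/funext => y; rewrite rmorphM.
Qed.

(** Convergence tested on balls is all that is required later. Fubini moves the kernel from [h] onto
    the indicator, where the limit is explicit and bounded by 1, so no regularity of [h]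
    intervenes. *)
Lemma poisson_approximation h a r : cintegrable h -> 0 < r ->
  (fun n => normc (cintegral (fun y => (\1_(ball a r) y)%:C *
       poisson_conv h n.+1%:R^-1 y) -
     cintegral (fun x => h x * (\1_(ball a r) (- x))%:C))) @ \oo --> (0 : R).
Proof.
move=> hi r0; have [mh _] := hi.
have t0 := @invSn_gt0 R.
under eq_fun do rewrite poisson_conv_fubini//.
have mb n : measurable_fun [set: R] (ball_poisson a r n.+1%:R^-1).
  pose k (z : R * R) := (\1_(ball a r) z.2 * poisson n.+1%:R^-1 (z.1 + z.2))%:E.
  have mk : measurable_fun [set: R * R] k.
    apply/measurable_EFinP; apply: measurable_funM.
      exact: (measurableT_comp (measurable_ind_ball a r) (@measurable_snd _ _ R R)).
    apply: (measurableT_comp (measurable_poisson (t0 n))).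
    by apply: measurable_funD; [exact: measurable_fst|exact: measurable_snd].
  have k0 z : (0 <= k z)%E by rewrite lee_fin mulr_ge0 ?poisson_ge0// indicE.
  have mF := @measurable_fun_fubini_tonelli_F _ _ _ _ R mu k mk k0.
  exact: (measurableT_comp (fine_measurable measurableT) mF).
have mi : measurable_fun [set: R] (fun x : R => \1_(ball a r) (- x) : R).
  apply: (measurableT_comp (measurable_ind_ball a r)); exact: oppr_measurable.
apply: (@cdominated_convergence R _ _ (fun x => normc (h x))).
- by move=> n; apply: cmeasurableM => //; exact: cmeasurable_real.
- by apply: cmeasurableM => //; exact: cmeasurable_real.
- have n1 := oppr1_neq0 R.
  have ae1 c : \forall x \ae (@lebesgue_measure R), - x != c.
    exists [set - c]; split; first exact: measurable_set1.
      exact: lebesgue_measure_set1.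
    by move=> x /= /negP; rewrite negbK => /eqP <-; rewrite opprK.
  apply: filterS2 (ae1 (a - r)) (ae1 (a + r)) => x x1 x2.
  rewrite -[X in _ --> X](mulr0 (normc (h x))).
  under eq_fun do rewrite -mulrBr -rmorphB normcM normc_real.
  apply: cvgMr.
  rewrite -[X in _ --> X](@normr0 R R); apply: cvg_norm.
  rewrite -[X in _ --> X](subrr (\1_(ball a r) (- x))); apply: cvgB; last exact: cvg_cst.
  exact: ball_poisson_cvg.
- exact: cintegrable_normc.
- move=> n x; rewrite normcM normc_real ler_piMr ?normc_ge0//.
  exact: ball_poisson_bound.
Qed.

Lemma cintegral_reflect_ball h a r : cintegrable h ->
  cintegral (fun x => h x * (\1_(ball a r) (- x))%:C) =
  cintegral (fun y => (\1_(ball a r) y)%:C * h (- y)).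
Proof.
move=> hi; have n1 := oppr1_neq0 R.
rewrite (cintegral_affine 0 n1).
  rewrite normrN normr1 mul1r; congr cintegral; apply/funext => x.
  by rewrite addr0 mulN1r opprK mulrC.
apply: (@cintegrable_bounded _ _ _ 1) => //.
  apply: cmeasurable_real; apply: (measurableT_comp (measurable_ind_ball a r)).
  exact: oppr_measurable.
move=> x; rewrite normc_real indicE.
by case: (_ \in _); rewrite ?normr1 ?normr0.
Qed.

Lemma cst_cvg0 (z : R[i]) (b : nat -> R) : (forall n, normc z <= b n) ->
  b @ \oo --> (0 : R) -> z = 0.
Proof.
move=> zb b0; apply: eq0_normc; apply/eqP; rewrite eq_le normc_ge0 andbT.
rewrite -(cvg_lim (@Rhausdorff R) b0); apply: limr_ge; first exact: cvgP b0.
exact: nearW.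
Qed.

(** If the transform vanishes, so do all Poisson integrals of [h], hence in the limit the integrals
    over balls of the reflected function. *)
Lemma fourier_integral_uniqueness h : cintegrable h ->
  (forall y, fourier_integral h y = 0) -> \forall x \ae mu, h x = 0.
Proof.
move=> hi h0.
have n1 := oppr1_neq0 R.
have hi' : cintegrable (fun x => h (- x)).
  by have := cintegrable_affine 0 n1 hi; under eq_fun do rewrite mulN1r addr0.
suff : \forall x \ae mu, h (- x) = 0.
  move=> /(ae_affine 0 n1); apply: filterS => x /=.
  by rewrite addr0 mulN1r opprK.
have [l1 l2] := locally_integrable_cintegrable hi'.
apply: cae0_of_balls => // a r r0.
rewrite -cintegral_reflect_ball//.
have := poisson_approximation a hi r0.
have t0 := @invSn_gt0 R.
apply: cst_cvg0 => n.
have -> : (fun y => (\1_(ball a r) y)%:C * poisson_conv h n.+1%:R^-1 y) = (fun=> 0).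
  apply/funext => y; rewrite /poisson_conv -fourier_integral_poisson//.
  rewrite /fourier_integral; under eq_fun do rewrite [X in X * _ * _]h0 !mul0r.
  by rewrite /cintegral /= Rintegral_cst// mul0r !mulr0.
have -> : cintegral (fun=> 0 : R[i]) = 0 by rewrite /cintegral /= Rintegral_cst// mul0r.
by rewrite sub0r normcN.
Qed.

End PoissonApproximation.

(** * Extension of the transform to [L2] *)

Section FourierExistence.
Variable R : realType.
Implicit Types (u v w : L2 R).

Lemma cintegrableD_L2 u v : cintegrable u -> cintegrable v -> cintegrable (u + v : L2 R).
Proof.
move=> ui vi; apply: (cintegrable_ae _ (cintegrableD ui vi)).
  exact: sqint_cmeasurable.
by apply: filterS (L2D_ae u v) => x ->.
Qed.

Lemma cintegrableZ_L2 (a : R[i]) u : cintegrable u -> cintegrable (a *: u : L2 R).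
Proof.
move=> ui; apply: (cintegrable_ae _ (cintegrableZ a ui)).
  exact: sqint_cmeasurable.
by apply: filterS (L2Z_ae a u) => x ->.
Qed.

Lemma fourier_integral_ae (f g : R -> R[i]) : cmeasurable f -> cmeasurable g ->
  (\forall x \ae mu, f x = g x) -> fourier_integral f = fourier_integral g.
Proof.
move=> mf mg fg; apply/funext => xi; rewrite /fourier_integral; congr (_ * _).
apply: ae_eq_cintegral.
- by apply: cmeasurableM => //; exact: cmeasurable_character.
- by apply: cmeasurableM => //; exact: cmeasurable_character.
- by apply: filterS fg => x ->.
Qed.

Lemma fourier_integralD u v : cintegrable u -> cintegrable v ->
  fourier_integral (u + v : L2 R) =
  (fun xi => fourier_integral u xi + fourier_integral v xi).
Proof.
move=> ui vi; rewrite (@fourier_integral_ae _ (fun x => u x + v x)).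
- apply/funext => xi; rewrite /fourier_integral -mulrDr -cintegralD.
  + congr (_ * _); congr cintegral; by apply/funext => x; rewrite mulrDl.
  + exact: cintegrable_character.
  + exact: cintegrable_character.
- exact: sqint_cmeasurable.
- by apply: cmeasurableD; exact: sqint_cmeasurable.
- exact: L2D_ae.
Qed.

Lemma fourier_integralZ (a : R[i]) u : cintegrable u ->
  fourier_integral (a *: u : L2 R) = (fun xi => a * fourier_integral u xi).
Proof.
move=> ui; rewrite (@fourier_integral_ae _ (fun x => a * u x)).
- apply/funext => xi; rewrite /fourier_integral [RHS]mulrCA; congr (_ * _).
  rewrite -cintegralZ; last exact: cintegrable_character.
  by congr cintegral; apply/funext => x; rewrite mulrA.
- exact: sqint_cmeasurable.
- by apply: cmeasurableM; [exact: cmeasurable_cst|exact: sqint_cmeasurable].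
- exact: L2Z_ae.
Qed.

Definition fourier1 u : L2 R := L2of (fourier_integral u).

Lemma fourier1_sqint u : cintegrable u -> fourier_integral u \in @sqint R.
Proof.
move=> ui; apply: sqint_mem; first exact: fourier_integral_cmeasurable.
apply: (le_lt_trans (bessel ui (sqint_L2 u))); rewrite -sqnE; exact: ltry.
Qed.

Lemma fourier1_ae u : cintegrable u ->
  \forall xi \ae mu, fourier1 u xi = fourier_integral u xi.
Proof. by move=> ui; exact: L2of_ae (fourier1_sqint ui). Qed.

Lemma fourier1_bessel u : cintegrable u -> sqn (fourier1 u) <= sqn u.
Proof.
move=> ui; rewrite -lee_fin sqn_L2of ?fourier1_sqint// sqnE.
exact: bessel ui (sqint_L2 u).
Qed.

Lemma fourier1D u v : cintegrable u -> cintegrable v ->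
  fourier1 (u + v) = fourier1 u + fourier1 v.
Proof.
move=> ui vi; apply: L2P.
have h := fourier1_ae (cintegrableD_L2 ui vi); rewrite fourier_integralD// in h.
apply: filterS3 h (L2D_ae (fourier1 u) (fourier1 v)) (filterI (fourier1_ae ui) (fourier1_ae vi)).
move=> x e1 e2 [e3 e4].
exact: (etrans e1 (esym (etrans e2 (f_equal2 +%R e3 e4)))).
Qed.

Lemma fourier1Z (a : R[i]) u : cintegrable u -> fourier1 (a *: u) = a *: fourier1 u.
Proof.
move=> ui; apply: L2P.
have h := fourier1_ae (cintegrableZ_L2 a ui); rewrite fourier_integralZ// in h.
apply: filterS3 h (L2Z_ae a (fourier1 u)) (fourier1_ae ui) => x e1 e2 e3.
exact: (etrans e1 (esym (etrans e2 (f_equal ( *%R a) e3)))).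
Qed.

Lemma fourier1B u v : cintegrable u -> cintegrable v ->
  fourier1 (u - v) = fourier1 u - fourier1 v.
Proof.
move=> ui vi; have vi' := cintegrableZ_L2 (- 1) vi.
by rewrite -[in LHS]scaleN1r (fourier1D ui vi') (fourier1Z _ vi) scaleN1r.
Qed.

Lemma cintegrableB_L2 u v : cintegrable u -> cintegrable v -> cintegrable (u - v : L2 R).
Proof.
by move=> ui vi; rewrite -scaleN1r; apply: cintegrableD_L2 => //; exact: cintegrableZ_L2.
Qed.

Lemma truncD n u v : trunc n (u + v) = trunc n u + trunc n v.
Proof.
apply: L2P.
apply: filterS3 (filterI (trunc_ae n (u + v)) (L2D_ae u v))
  (L2D_ae (trunc n u) (trunc n v)) (filterI (trunc_ae n u) (trunc_ae n v)).
by move=> x [-> ->] -> [-> ->]; rewrite mulrDr.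
Qed.

Lemma truncZ n (a : R[i]) u : trunc n (a *: u) = a *: trunc n u.
Proof.
apply: L2P.
apply: filterS3 (filterI (trunc_ae n (a *: u)) (L2Z_ae a u))
  (L2Z_ae a (trunc n u)) (trunc_ae n u).
by move=> x [-> ->] -> ->; rewrite mulrCA.
Qed.

(** Bessel's inequality makes the transforms of the truncations a Cauchy sequence. The same
    inequality shows that the limit agrees with the integral formula when [u] is already
    integrable. *)
Lemma fourier_extension_exists : exists F : L2 R -> L2 R, is_fourier_extension F.
Proof.
have cv u : exists w, L2cvg (fun n => fourier1 (trunc n u)) w.
  apply: L2_complete => e e0; have [N hN] := L2cvg_cauchy (trunc_cvg u) e0.
  exists N => n k Nn Nk; apply: le_trans (hN n k Nn Nk).
  rewrite -fourier1B; [|exact: trunc_cintegrable|exact: trunc_cintegrable].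
  apply: fourier1_bessel; apply: cintegrableB_L2; exact: trunc_cintegrable.
have [F hF] := choice cv.
exists F; split.
  apply: (@bop_intro R F 1) => //.
  - move=> u v; apply: (L2cvg_unique (hF (u + v))).
    have E : (fun n => fourier1 (trunc n (u + v))) =
        (fun n => fourier1 (trunc n u) + fourier1 (trunc n v)).
      apply/funext => n; rewrite truncD.
      exact: fourier1D (trunc_cintegrable n u) (trunc_cintegrable n v).
    rewrite E; exact: L2cvgD (hF u) (hF v).
  - move=> a u; apply: (L2cvg_unique (hF (a *: u))).
    have E : (fun n => fourier1 (trunc n (a *: u))) =
        (fun n => a *: fourier1 (trunc n u)).
      by apply/funext => n; rewrite truncZ; exact: fourier1Z (trunc_cintegrable n u).
    rewrite E; exact: L2cvgZ (hF u).
  - move=> u; rewrite mul1r; apply: L2cvg_sqn_le (hF u) _ => n.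
    apply: (le_trans (fourier1_bessel (trunc_cintegrable n u))); exact: sqn_trunc_le.
move=> u ui; suff -> : F u = fourier1 u by exact: fourier1_ae.
apply: (L2cvg_unique (hF u)).
apply: (@squeeze0 R _ (fun n => sqn (trunc n u - u))).
- by move=> n; exact: sqn_ge0.
- move=> n; rewrite -fourier1B//; last exact: trunc_cintegrable.
  apply: fourier1_bessel; apply: cintegrableB_L2 => //; exact: trunc_cintegrable.
- exact: trunc_cvg.
Qed.

(** The choice operator returns some extension; what follows relies on this property only. *)
Lemma fourierP : is_fourier_extension (@fourier R).
Proof.
have [F hF] := fourier_extension_exists.
by rewrite /fourier; apply: (@xgetPex _ _ [set F | @is_fourier_extension R F]); exists F.
Qed.

Lemma fourier_bop : bounded_operator (@fourier R).
Proof. by have [] := fourierP. Qed.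

Lemma fourier_fourier1 u : cintegrable u -> fourier u = fourier1 u.
Proof.
move=> ui; have [_ h] := fourierP; apply: L2P.
by apply: filterS2 (h u ui) (fourier1_ae ui) => x -> ->.
Qed.

Lemma fourier_ae u : cintegrable u ->
  \forall xi \ae mu, fourier u xi = fourier_integral u xi.
Proof. by have [_] := fourierP; apply. Qed.

Lemma sqn_fourier_le u : sqn (fourier u) <= sqn u.
Proof.
rewrite -[leRHS]mul1r; apply: bop_sqn_le => //; first exact: fourier_bop.
by move=> v vi; rewrite fourier_fourier1// mul1r fourier1_bessel.
Qed.

End FourierExistence.

(** * Affine substitutions and multiplication operators *)

Section AffineAndMultiplication.
Variable R : realType.
Implicit Types (u v w : L2 R) (a b c : R).

(** Common form of [dilate] and [translate], and also of the action of a dilation on the Fourier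
    side. *)
Definition affine_op (c : R[i]) a b u : L2 R := L2of (fun x => c * u (a * x + b)).

Lemma affine_op_ae (c : R[i]) a b u : a != 0 ->
  \forall x \ae mu, affine_op c a b u x = c * u (a * x + b).
Proof. by move=> a0; exact: L2of_ae (sqint_affine c b u a0). Qed.

Lemma sqn_affine_op (c : R[i]) a b u : a != 0 ->
  sqn (affine_op c a b u) = normc c ^+ 2 * (`|a|^-1 * sqn u).
Proof.
move=> a0; have mu' := sqint_cmeasurable u.
apply: EFin_inj; rewrite sqn_L2of; last exact: sqint_affine.
rewrite isqrZ; last exact: cmeasurable_affine.
rewrite (EFinM (normc c ^+ 2)) (EFinM `|a|^-1); congr (_ * _)%E; rewrite sqnE (isqr_affine b a0 mu').
by rewrite muleA -EFinM mulVf ?normr_eq0// mul1e.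
Qed.

Lemma affine_op_bop (c : R[i]) a b : a != 0 -> bounded_operator (affine_op c a b).
Proof.
move=> a0; apply: (@bop_intro R _ (normc c ^+ 2 * `|a|^-1)).
- move=> u v; apply: L2P.
  apply: filterS3 (filterI (affine_op_ae c b (u + v) a0) (ae_affine b a0 (L2D_ae u v)))
    (L2D_ae (affine_op c a b u) (affine_op c a b v))
    (filterI (affine_op_ae c b u a0) (affine_op_ae c b v a0)).
  by move=> x [-> ->] -> [-> ->]; rewrite mulrDr.
- move=> d u; apply: L2P.
  apply: filterS3 (filterI (affine_op_ae c b (d *: u) a0) (ae_affine b a0 (L2Z_ae d u)))
    (L2Z_ae d (affine_op c a b u)) (affine_op_ae c b u a0).
  by move=> x [-> ->] -> ->; rewrite mulrCA.
- by rewrite mulr_ge0 ?sqr_ge0.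
- by move=> u; rewrite sqn_affine_op// mulrA.
Qed.

Lemma dilateE lam : lam != 0 -> @dilate R lam = affine_op (`|lam|^-1)%:C lam^-1 0.
Proof.
move=> l0; apply/funext => u; apply: L2P.
apply: filterS2 (dilate_ae lam u) (affine_op_ae (`|lam|^-1)%:C 0 u (invr_neq0 l0)).
by move=> x -> ->; rewrite addr0 (mulrC x).
Qed.

Lemma translateE c : @translate R c = affine_op 1 1 (- c).
Proof.
apply/funext => u; apply: L2P.
apply: filterS2 (translate_ae c u) (affine_op_ae 1 (- c) u (oner_neq0 R)).
by move=> x -> ->; rewrite !mul1r.
Qed.

Lemma dilate_bop lam : lam != 0 -> bounded_operator (@dilate R lam).
Proof. by move=> l0; rewrite dilateE//; apply: affine_op_bop; rewrite invr_eq0. Qed.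

Lemma translate_bop c : bounded_operator (@translate R c).
Proof. by rewrite translateE; apply: affine_op_bop; exact: oner_neq0. Qed.

Definition mul_op (phi : R -> R[i]) u : L2 R := L2of (fun x => phi x * u x).

Section Multiplier.
Variables (phi : R -> R[i]) (C : R).
Hypotheses (mphi : cmeasurable phi) (phiC : forall x, normc (phi x) <= C).

Lemma mul_op_ae u : \forall x \ae mu, mul_op phi u x = phi x * u x.
Proof. exact: L2of_ae (sqintM mphi phiC (sqint_L2 u)). Qed.

Lemma mul_op_bop : bounded_operator (mul_op phi).
Proof.
apply: (@bop_intro R _ (C ^+ 2)).
- move=> u v; apply: L2P.
  apply: filterS3 (filterI (mul_op_ae (u + v)) (L2D_ae u v))
    (L2D_ae (mul_op phi u) (mul_op phi v)) (filterI (mul_op_ae u) (mul_op_ae v)).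
  by move=> x [-> ->] -> [-> ->]; rewrite mulrDr.
- move=> d u; apply: L2P.
  apply: filterS3 (filterI (mul_op_ae (d *: u)) (L2Z_ae d u))
    (L2Z_ae d (mul_op phi u)) (mul_op_ae u).
  by move=> x [-> ->] -> ->; rewrite mulrCA.
- exact: sqr_ge0.
- move=> u; have mu' := sqint_cmeasurable u.
  have C0 : 0 <= C by exact: le_trans (normc_ge0 _) (phiC 0).
  rewrite -lee_fin sqn_L2of; last exact: sqintM (sqint_L2 u).
  have -> : (C ^+ 2 * sqn u)%:E = isqr (fun x => C%:C * u x).
    by rewrite isqrZ// EFinM sqnE normc_real ger0_norm.
  apply: isqr_le.
  + exact: cmeasurableM.
  + by apply: cmeasurableM => //; exact: cmeasurable_cst.
  apply: aeW => x; rewrite !normcM normc_real ger0_norm//.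
  by apply: ler_wpM2r => //; exact: normc_ge0.
Qed.

End Multiplier.

Lemma cintegrable_affine_op (c : R[i]) a b u : a != 0 -> cintegrable u ->
  cintegrable (affine_op c a b u).
Proof.
move=> a0 ui; apply: (cintegrable_ae _ (cintegrableZ c (cintegrable_affine b a0 ui))).
  exact: sqint_cmeasurable.
by apply: filterS (affine_op_ae c b u a0) => x ->.
Qed.

Lemma fourier_integral_affine (f : R -> R[i]) (c : R[i]) a b xi : a != 0 ->
  cintegrable f ->
  fourier_integral (fun x => c * f (a * x + b)) xi =
  c * (`|a|^-1)%:C * expi (b / a * xi) * fourier_integral f (xi / a).
Proof.
move=> a0 fi; rewrite /fourier_integral [RHS]mulrCA; congr (_ * _).
rewrite (cintegral_affine b a0 (cintegrable_character (xi / a) fi)).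
have hI : cintegrable (fun x => f (a * x + b) * expi (- (xi / a * (a * x + b)))).
  exact: (cintegrable_affine b a0 (cintegrable_character (xi / a) fi)).
have an0 : `|a| != 0 by rewrite normr_eq0.
have -> : c * (`|a|^-1)%:C * expi (b / a * xi) * (`|a|%:C *
    cintegral (fun x => f (a * x + b) * expi (- (xi / a * (a * x + b))))) =
  (c * expi (b / a * xi)) *
    cintegral (fun x => f (a * x + b) * expi (- (xi / a * (a * x + b)))).
  rewrite mulrA; congr (_ * _); rewrite mulrAC -(mulrA c) -rmorphM/= mulVf//.
  by rewrite mulr1.
rewrite -cintegralZ//; congr cintegral; apply/funext => x.
have -> : - (xi * x) = b / a * xi - xi / a * (a * x + b) by field.
rewrite expiD; set p := expi _; set q := expi _; ring.
Qed.

End AffineAndMultiplication.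

(** * Inversion and Plancherel *)

Section FourierInversion.
Variable R : realType.
Implicit Types (u v w : L2 R) (a b c r : R).

(** Minimising over [s] would give the bound [2 sqrt (K * D n)]; keeping [s] free avoids the square
    root. *)
Lemma cvg0_weighted (X D : nat -> R) (K : R) : 0 <= K -> (forall n, 0 <= X n) ->
  (forall n, 0 <= D n) -> D @ \oo --> (0 : R) ->
  (forall n s, 0 < s -> X n <= s * K + s^-1 * D n) -> X @ \oo --> (0 : R).
Proof.
move=> K0 X0 D0 Dc XD; apply/cvgrPdist_le => e e0.
have K1 : 0 < K + 1 by rewrite ltr_wpDl.
(* This [s] makes the first term at most [e / 2]; the bound on [D n] does the same for the
   second. *)
pose s := e / 2 / (K + 1); have s0 : 0 < s by rewrite !divr_gt0.
have d0 : 0 < e / 2 * s by rewrite mulr_gt0// divr_gt0.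
move/cvgrPdist_le : Dc => /(_ _ d0); apply: filterS => n.
rewrite !sub0r !normrN !ger0_norm// => Dn.
apply: le_trans (XD n s s0) _.
have h1 : s * K <= e / 2.
  rewrite /s mulrAC ler_pdivrMr//; apply: ler_wpM2l; first by rewrite divr_ge0// ltW.
  by rewrite lerDl.
have h2 : s^-1 * D n <= e / 2 by rewrite mulrC ler_pdivrMr.
lra.
Qed.

Lemma integral_ball_ge0 a r : 0 <= \int[mu]_y (\1_(ball a r) y : R).
Proof. by apply: Rintegral_ge0 => y _; rewrite indicE. Qed.

(** Cauchy-Schwarz in weighted form, from [2 z <= s + s^-1 z^2] on the ball. *)
Lemma ball_pairing_le a r w (s : R) : 0 < s ->
  normc (cintegral (fun y => (\1_(ball a r) y)%:C * w y)) <=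
  s * (2 * \int[mu]_y (\1_(ball a r) y : R)) + s^-1 * (2 * sqn w).
Proof.
move=> s0; have wI := cintegrable_ball_sqint a r (sqint_L2 w).
apply: le_trans (normc_cintegral_le2 wI) _.
have w2 := sqint_normc2_integrable (sqint_L2 w).
have w2E : \int[mu]_x (normc (w x) ^+ 2) = sqn w by [].
have bI : mu.-integrable [set: R] (EFin \o (fun y => \1_(ball a r) y : R)).
  by have /cintegrableP[] := cintegrable_ball a r.
rewrite -w2E [_ * (2 * _)]mulrCA (mulrCA s^-1) -mulrDr ler_pM2l//.
rewrite -RintegralZl// -RintegralZl// -RintegralD//; last 2 first.
- by rewrite /comp; under eq_fun do rewrite EFinM; exact: integrableZl.
- by rewrite /comp; under eq_fun do rewrite EFinM; exact: integrableZl.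
apply: le_Rintegral => //.
- exact: cintegrable_normc.
- rewrite /comp; under eq_fun do rewrite EFinD !EFinM.
  by apply: integrableD => //; exact: integrableZl.
move=> y _; rewrite normcM normc_real ger0_norm ?indicE//.
have := normc_ge0 (w y); set z := normc _ => z0.
have si : 0 < s^-1 by rewrite invr_gt0.
case: (_ \in _) => /=; last by rewrite mul0r mulr0 add0r mulr_ge0 ?sqr_ge0// ltW.
have : 0 <= s^-1 * (s - z) ^+ 2 by rewrite mulr_ge0 ?sqr_ge0// ltW.
have -> : s^-1 * (s - z) ^+ 2 = s - 2 * z + s^-1 * z ^+ 2.
  by field; rewrite gt_eqF.
by rewrite mul1r mulr1; lra.
Qed.

Lemma ball_pairing_cvg (v : nat -> L2 R) w a r : L2cvg v w ->
  (fun n => normc (cintegral (fun y => (\1_(ball a r) y)%:C * v n y) -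
     cintegral (fun y => (\1_(ball a r) y)%:C * w y))) @ \oo --> (0 : R).
Proof.
move=> vw.
apply: (@cvg0_weighted _ (fun n => 2 * sqn (v n - w))
    (2 * \int[mu]_y (\1_(ball a r) y : R))).
- by rewrite mulr_ge0// integral_ball_ge0.
- by move=> n; exact: normc_ge0.
- by move=> n; rewrite mulr_ge0// sqn_ge0.
- by rewrite -[X in _ --> X](mulr0 2); apply: cvgMr.
move=> n s s0; apply: le_trans _ (ball_pairing_le a r (v n - w) s0).
rewrite le_eqVlt; apply/orP; left; apply/eqP; congr normc.
have vI := cintegrable_ball_sqint a r (sqint_L2 (v n)).
have wI := cintegrable_ball_sqint a r (sqint_L2 w).
rewrite -cintegralB//; apply: ae_eq_cintegral.
- have [mv _] := vI; have [mw _] := wI; exact: cmeasurableB.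
- by have [] := cintegrable_ball_sqint a r (sqint_L2 (v n - w)).
- by apply: filterS (L2B_ae (v n) w) => y ->; rewrite mulrBr.
Qed.

Lemma normc_cvg_unique (X : nat -> R[i]) (z z' : R[i]) :
  (fun n => normc (X n - z)) @ \oo --> (0 : R) ->
  (fun n => normc (X n - z')) @ \oo --> (0 : R) -> z = z'.
Proof.
move=> Xz Xz'; apply/eqP; rewrite -subr_eq0; apply/eqP.
apply: (@cst_cvg0 R _ (fun n => normc (X n - z) + normc (X n - z'))).
  move=> n; rewrite -(normcN (X n - z)) opprB.
  by rewrite -[z - z'](subrKA (X n)); exact: le_normcD.
by rewrite -[X in _ --> X](addr0 0); apply: cvgD.
Qed.

Lemma dilateN1_ae u : \forall x \ae mu, dilate (- 1) u x = u (- x).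
Proof.
apply: filterS (dilate_ae (- 1) u) => x ->.
by rewrite normrN normr1 invr1 mul1r invrN invr1 mulrN1.
Qed.

(* The functions [fourier u * expabs t] tend to [fourier u] in [L2] as [t] tends
   to 0, and their transforms are reflected Poisson integrals of [u], which
   converge to the reflection of [u] when integrated over balls. *)
Lemma fourier_fourier_integrable u : cintegrable u ->
  fourier (fourier u) = dilate (- 1) u.
Proof.
move=> ui; have n1 := oppr1_neq0 R.
have t0 := @invSn_gt0 R.
have [C hC] := fourier_integral_bounded ui.
have mF := fourier_integral_cmeasurable ui.
pose g n xi := fourier_integral u xi * (expabs n.+1%:R^-1 xi)%:C.
have mg n : cmeasurable (g n).
  by apply: cmeasurableM => //; apply: cmeasurable_real; exact: measurable_expabs.
have gi n : cintegrable (g n).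
  have := cintegrable_bounded (cintegrable_expabs (t0 n)) mF hC.
  by under eq_fun do rewrite mulrC.
have gs n : g n \in @sqint R.
  apply: sqint_dom (mg n) (fourier1_sqint ui) _; apply: aeW => x.
  rewrite normcM normc_real ler_piMr ?normc_ge0// gtr0_norm ?expabs_gt0//.
  by apply: expabs_le1; exact: ltW.
pose v n := L2of (g n).
have vi n : cintegrable (v n).
  apply: (cintegrable_ae _ (gi n)); first exact: sqint_cmeasurable.
  by apply: filterS (L2of_ae (gs n)) => x ->.
have vc : L2cvg v (fourier u).
  rewrite (fourier_fourier1 ui).
  apply: (@L2_dominated R v _
    (fun n xi => fourier_integral u xi * (expabs n.+1%:R^-1 xi - 1)%:C)
    _ (fourier1_sqint ui)).
  - move=> n; apply: cmeasurableM => //; apply: cmeasurable_real.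
    by apply: measurable_funB => //; exact: measurable_expabs.
  - move=> n; apply: filterS2 (L2of_ae (gs n)) (fourier1_ae ui) => x e1 e2.
    rewrite [X in X - _]e1 [X in _ - X]e2 /g rmorphB/= mulrBr mulr1.
    by [].
  - move=> x; rewrite -[X in _ --> X](mulr0 (normc (fourier_integral u x))).
    under eq_fun do rewrite normcM normc_real.
    apply: cvgMr; rewrite -[X in _ --> X](@normr0 R R); apply: cvg_norm.
    rewrite -[X in _ --> X](subrr 1); apply: cvgB; last exact: cvg_cst.
    exact: expabs_cvg1.
  - move=> n x; rewrite normcM normc_real ler_piMr ?normc_ge0//.
    have e1 := expabs_le1 x (ltW (t0 n)).
    have e2 := expabs_gt0 n.+1%:R^-1 x.
    by rewrite ler_norml; apply/andP; split; lra.
have Fvc := L2cvg_bop (fourier_bop R) vc.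
have Fv n : \forall y \ae mu, fourier (v n) y = poisson_conv u n.+1%:R^-1 y.
  apply: filterS (fourier_ae (vi n)) => y ->.
  rewrite /poisson_conv -fourier_integral_poisson//.
  congr (_ y); apply: fourier_integral_ae (L2of_ae (gs n)) => //.
  exact: sqint_cmeasurable.
have mP n : cmeasurable (poisson_conv u n.+1%:R^-1).
  have -> : poisson_conv u n.+1%:R^-1 = fourier_integral (g n).
    by apply/funext => y; rewrite fourier_integral_poisson.
  exact: fourier_integral_cmeasurable.
have key a r : 0 < r -> cintegral (fun y => (\1_(ball a r) y)%:C * fourier (fourier u) y) =
    cintegral (fun y => (\1_(ball a r) y)%:C * dilate (- 1) u y).
  move=> r0; have [mb _] := cintegrable_ball a r.
  have h1 := ball_pairing_cvg a r Fvc.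
  have h2 := poisson_approximation a ui r0.
  rewrite (cintegral_reflect_ball a r ui) in h2.
  have E1 n : cintegral (fun y => (\1_(ball a r) y)%:C * fourier (v n) y) =
      cintegral (fun y => (\1_(ball a r) y)%:C * poisson_conv u n.+1%:R^-1 y).
    apply: ae_eq_cintegral.
    - by apply: cmeasurableM => //; exact: sqint_cmeasurable.
    - exact: cmeasurableM.
    - by apply: filterS (Fv n) => y ->.
  have E2 : cintegral (fun y => (\1_(ball a r) y)%:C * dilate (- 1) u y) =
      cintegral (fun y => (\1_(ball a r) y)%:C * u (- y)).
    apply: ae_eq_cintegral.
    - by apply: cmeasurableM => //; exact: sqint_cmeasurable.
    - apply: cmeasurableM => //.
      apply: cmeasurable_comp; [exact: sqint_cmeasurable|exact: oppr_measurable].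
    - by apply: filterS (dilateN1_ae u) => y ->.
  rewrite E2; apply: normc_cvg_unique h1 _.
  apply: cvg_trans h2; apply: near_eq_cvg; apply: nearW => n.
  exact: (f_equal (fun z => normc (z - _)) (esym (E1 n))).
apply: L2P.
have ds : (fun y => fourier (fourier u) y - dilate (- 1) u y) \in @sqint R.
  by apply: rpredB; exact: sqint_L2.
have [l1 l2] := locally_integrable_sqint ds.
have := cae0_of_balls l1 l2; move=> H; apply: filterS (H _) => [y /eqP|a r r0].
  by rewrite subr_eq0 => /eqP.
have i1 := cintegrable_ball_sqint a r (sqint_L2 (fourier (fourier u))).
have i2 := cintegrable_ball_sqint a r (sqint_L2 (dilate (- 1) u)).
under eq_fun do rewrite mulrBr.
by rewrite cintegralB// key// subrr.
Qed.

Lemma fourier_fourier u : fourier (fourier u) = dilate (- 1) u.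
Proof.
have n1 := oppr1_neq0 R.
have /(_ _ _ fourier_fourier_integrable) E :=
  @bop_eq_integrable R (@fourier R \o @fourier R) (dilate (- 1)).
by rewrite -E//; [apply: bop_comp; exact: fourier_bop|exact: dilate_bop].
Qed.

(** The transform is a contraction and its square is the isometry [u (- x)]: no norm can be lost at
    either application. *)
Lemma sqn_fourier u : sqn (fourier u) = sqn u.
Proof.
have n1 := oppr1_neq0 R.
apply/eqP; rewrite eq_le sqn_fourier_le /=.
apply: le_trans (sqn_fourier_le (fourier u)).
rewrite fourier_fourier dilateE// sqn_affine_op ?invr_eq0//.
rewrite !normrN !normr1 normc_real !invr1 normr1 expr1n !mul1r.
by rewrite invrN invr1 normrN normr1 invr1 mul1r.
Qed.

Lemma fourier_inj : injective (@fourier R).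
Proof.
move=> u v uv; apply/eqP; rewrite -subr_eq0; apply/eqP; apply: sqn_eq0.
by rewrite -sqn_fourier (bopB _ _ (fourier_bop R)) uv subrr sqn0.
Qed.

Lemma dilateN1K u : dilate (- 1) (dilate (- 1) u) = u.
Proof.
apply: L2P; have n1 := oppr1_neq0 R.
have h := ae_affine 0 n1 (dilateN1_ae u).
apply: filterS2 (dilateN1_ae (dilate (- 1) u)) h => x ->.
by rewrite addr0 mulN1r opprK.
Qed.

Lemma fourier_surj v : exists u, fourier u = v.
Proof.
exists (fourier (dilate (- 1) v)).
by rewrite fourier_fourier dilateN1K.
Qed.

End FourierInversion.

(** * Multipliers *)

Section Multiplier.
Variable R : realType.
Implicit Types (u v w : L2 R) (a b c r : R).

Lemma sqint_mul_conj_cintegrable (f g : R -> R[i]) :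
  f \in @sqint R -> g \in @sqint R -> cintegrable (fun x => f x * conjc (g x)).
Proof.
move=> fs gs; have [mf _] := set_mem fs; have [mg _] := set_mem gs.
apply: (@cintegrable_dom _ _ (fun x => normc (f x) ^+ 2 + normc (g x) ^+ 2)).
- by apply: cmeasurableM => //; exact: cmeasurable_conjc.
- rewrite /comp; under eq_fun do rewrite EFinD.
  by apply: integrableD => //; exact: sqint_normc2_integrable.
move=> x; rewrite normcM normc_conjc.
have := normc_ge0 (f x); have := normc_ge0 (g x).
by move: (normc (f x)) (normc (g x)) => a b; nra.
Qed.

Lemma L2inner_ae u v (f g : R -> R[i]) : cmeasurable f -> cmeasurable g ->
  (\forall x \ae mu, u x = f x) -> (\forall x \ae mu, v x = g x) ->
  L2inner u v = cintegral (fun x => f x * conjc (g x)).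
Proof.
move=> mf mg uf vg; apply: ae_eq_cintegral.
- apply: cmeasurableM; first exact: sqint_cmeasurable.
  by apply: cmeasurable_conjc; exact: sqint_cmeasurable.
- by apply: cmeasurableM => //; exact: cmeasurable_conjc.
- by apply: filterS2 uf vg => x -> ->.
Qed.

Lemma sqn_Rintegral u : sqn u = \int[mu]_x (normc (u x) ^+ 2).
Proof. by []. Qed.

Lemma sqnD u v : sqn (u + v) = sqn u + sqn v + 2 * Re (L2inner u v).
Proof.
have ui := sqint_normc2_integrable (sqint_L2 u).
have vi := sqint_normc2_integrable (sqint_L2 v).
have /cintegrableP[iI _] := sqint_mul_conj_cintegrable (sqint_L2 u) (sqint_L2 v).
have mu' := sqint_cmeasurable u; have mv := sqint_cmeasurable v.
have -> : sqn (u + v) = \int[mu]_x (normc (u x + v x) ^+ 2).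
  rewrite /Rintegral -/(isqr (fun x => u x + v x)).
  rewrite -(@sqn_ae _ (u + v) (fun x => u x + v x))//; last exact: L2D_ae.
  exact: cmeasurableD.
have uvI : mu.-integrable [set: R]
    (EFin \o (fun x => normc (u x) ^+ 2 + normc (v x) ^+ 2)).
  by rewrite /comp; under eq_fun do rewrite EFinD; exact: integrableD.
rewrite !sqn_Rintegral -RintegralD// /L2inner /cintegral /= -RintegralZl//.
rewrite -RintegralD//.
  apply: eq_Rintegral => x _; rewrite !normc2E !cE; ring.
by rewrite /comp; under eq_fun do rewrite EFinM; exact: integrableZl.
Qed.

Lemma L2innerZr u v (z : R[i]) : L2inner u (z *: v) = conjc z * L2inner u v.
Proof.
have uv := sqint_mul_conj_cintegrable (sqint_L2 u) (sqint_L2 v).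
rewrite (@L2inner_ae u (z *: v) u (fun x => z * v x)).
- rewrite /L2inner -cintegralZ//; congr cintegral; apply/funext => x.
  by rewrite conjcM mulrCA.
- exact: sqint_cmeasurable.
- by apply: cmeasurableM; [exact: cmeasurable_cst|exact: sqint_cmeasurable].
- exact: aeW.
- exact: L2Z_ae.
Qed.

(** Polarisation: a linear map that preserves [sqn] preserves the inner product. The imaginary part
    comes from ['i *: v], since the inner product is conjugate linear on the right. *)
Lemma L2innerE u v : L2inner u v =
  ((sqn (u + v) - sqn u - sqn v) / 2) +i*
  ((sqn (u + 'i%C *: v) - sqn u - sqn ('i%C *: v)) / 2).
Proof.
have h (x y z : R) : (x + y + 2 * z - x - y) / 2 = z by field.
apply: complex_eqP; rewrite [RHS]/= sqnD h//.
by rewrite L2innerZr cE /= mul0r sub0r mulN1r opprK.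
Qed.

Lemma fourier_inner u v : L2inner (fourier u) (fourier v) = L2inner u v.
Proof.
have hF := fourier_bop R.
by rewrite !L2innerE -(bopZ _ _ hF) -!(bopD _ _ hF) !sqn_fourier.
Qed.

Lemma fourier_translate c u : \forall xi \ae mu,
  fourier (translate c u) xi = expi (- (c * xi)) * fourier u xi.
Proof.
have m1 := cmeasurable_character c.
have b1 (x : R) : normc (expi (- (c * x))) <= 1 by rewrite normc_expi.
have hM := mul_op_bop m1 b1.
have E : @fourier R \o @translate R c = mul_op (fun xi => expi (- (c * xi))) \o @fourier R.
  apply: bop_eq_integrable.
  - exact: bop_comp (fourier_bop R) (translate_bop c).
  - exact: bop_comp hM (fourier_bop R).
  move=> v vi /=; apply: L2P.
  have ti : cintegrable (translate c v).
    by rewrite translateE; apply: cintegrable_affine_op => //; exact: oner_neq0.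
  apply: filterS3 (fourier_ae ti) (mul_op_ae m1 b1 (fourier v)) (fourier_ae vi).
  move=> x e1 e2 e3; rewrite [LHS]e1 [RHS]e2 e3.
  rewrite (@fourier_integral_ae _ _ (fun x => 1 * v (1 * x + - c))).
  - rewrite fourier_integral_affine ?oner_neq0//.
    by rewrite normr1 invr1 !mulr1 !mul1r mulNr.
  - exact: sqint_cmeasurable.
  - apply: cmeasurableM; first exact: cmeasurable_cst.
    by apply: cmeasurable_affine; exact: sqint_cmeasurable.
  - by apply: filterS (translate_ae c v) => y ->; rewrite !mul1r.
have -> : fourier (translate c u) = mul_op (fun xi => expi (- (c * xi))) (fourier u).
  exact: (f_equal (@^~ u) E).
exact: mul_op_ae.
Qed.

(** The factor [1 / |c|] in [dilate] cancels the Jacobian, so on the Fourier side a dilation is a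
    plain change of variable. *)
Lemma fourier_dilate c u : c != 0 -> \forall xi \ae mu,
  fourier (dilate c u) xi = fourier u (c * xi).
Proof.
move=> c0.
have hA : bounded_operator (@affine_op R 1 c 0) by exact: affine_op_bop.
have E : @fourier R \o @dilate R c = affine_op 1 c 0 \o @fourier R.
  apply: bop_eq_integrable.
  - exact: bop_comp (fourier_bop R) (dilate_bop c0).
  - exact: bop_comp hA (fourier_bop R).
  move=> v vi /=; apply: L2P.
  have ti : cintegrable (dilate c v).
    by rewrite dilateE//; apply: cintegrable_affine_op => //; rewrite invr_eq0.
  apply: filterS3 (fourier_ae ti) (affine_op_ae 1 0 (fourier v) c0)
    (ae_affine 0 c0 (fourier_ae vi)).
  move=> x e1 e2 e3; rewrite [LHS]e1 [RHS]e2 e3.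
  rewrite (@fourier_integral_ae _ _ (fun x => (`|c|^-1)%:C * v (c^-1 * x + 0))).
  - rewrite fourier_integral_affine ?invr_eq0//.
    rewrite mul0r mul0r expi0 mulr1 invrK addr0 normfV invrK (mulrC x).
    by rewrite -rmorphM mulVf ?normr_eq0.
  - exact: sqint_cmeasurable.
  - apply: cmeasurableM; first exact: cmeasurable_cst.
    by apply: cmeasurable_affine; exact: sqint_cmeasurable.
  - by apply: filterS (dilate_ae c v) => y ->; rewrite addr0 (mulrC y).
have -> : fourier (dilate c u) = affine_op 1 c 0 (fourier u).
  exact: (f_equal (@^~ u) E).
by apply: filterS (affine_op_ae 1 0 (fourier u) c0) => x ->; rewrite mul1r addr0.
Qed.

Lemma translateK c u : translate c (translate (- c) u) = u.
Proof.
apply: L2P.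
have h := ae_affine (- c) (oner_neq0 R) (translate_ae (- c) u).
apply: filterS2 (translate_ae c (translate (- c) u)) h => x ->.
by rewrite mul1r => ->; rewrite opprK subrK.
Qed.

Lemma translation_invariantE (T : L2 R -> L2 R) : translation_invariant T ->
  forall c u, T (translate c u) = translate c (T u).
Proof.
move=> hT c u; have := f_equal (@^~ u) (hT c); rewrite /= => <-.
by rewrite translateK.
Qed.

Lemma multiplier_identity (T : L2 R -> L2 R) u w : unitary T -> translation_invariant T ->
  \forall xi \ae mu, fourier (T u) xi * conjc (fourier (T w) xi) =
    fourier u xi * conjc (fourier w xi).
Proof.
move=> uT tT; have [_ _ Tin] := uT.
have i1 := sqint_mul_conj_cintegrable (sqint_L2 (fourier (T u))) (sqint_L2 (fourier (T w))).
have i2 := sqint_mul_conj_cintegrable (sqint_L2 (fourier u)) (sqint_L2 (fourier w)).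
pose h xi := fourier (T u) xi * conjc (fourier (T w) xi) -
    fourier u xi * conjc (fourier w xi).
have hi : cintegrable h.
  have := cintegrableD i1 (cintegrableZ (- 1) i2).
  by under eq_fun do rewrite mulN1r.
(* The Fourier integral at [y] of such a product is, up to a constant, an inner product with a
   translate; commutation with translations and unitarity of [T] then make the transform of [h]
   vanish. *)
have key v v' y : cintegral (fun x => fourier v x * conjc (fourier v' x) * expi (- (y * x))) =
    L2inner (translate y v) v'.
  rewrite -fourier_inner (@L2inner_ae _ _
    (fun x => expi (- (y * x)) * fourier v x) (fourier v')).
  - by congr cintegral; apply/funext => x; rewrite mulrC mulrA.
  - by apply: cmeasurableM; [exact: cmeasurable_character|exact: sqint_cmeasurable].
  - exact: sqint_cmeasurable.
  - exact: fourier_translate.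
  - exact: aeW.
have h0 y : fourier_integral h y = 0.
  rewrite /fourier_integral /h; under eq_fun do rewrite mulrBl.
  rewrite cintegralB; [|exact: cintegrable_character|exact: cintegrable_character].
  by rewrite !key -(translation_invariantE tT) Tin subrr mulr0.
apply: filterS (fourier_integral_uniqueness hi h0) => x /eqP.
by rewrite subr_eq0 => /eqP.
Qed.

Lemma sqint_expabs1 : (fun x : R => (expabs 1 x)%:C) \in @sqint R.
Proof.
apply: sqint_mem; first by apply: cmeasurable_real; exact: measurable_expabs.
have := integrable_lty measurableT (integrable_expabs (ltr01 : 0 < 1 :> R)).
apply: le_lt_trans; apply: ge0_le_integral => //.
- by move=> x _; rewrite lee_fin sqr_ge0.
- apply/measurable_EFinP; apply: (@measurable_normc2 R (fun x => (expabs 1 x)%:C)).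
  by apply: cmeasurable_real; exact: measurable_expabs.
- by apply/measurable_EFinP; exact: measurable_expabs.
- move=> x _; rewrite lee_fin normc_real (ger0_norm (ltW (expabs_gt0 1 x))).
  have := expabs_gt0 1 x; have := @expabs_le1 R 1 x ler01.
  by move: (expabs 1 x) => e; nra.
Qed.

(* A test function with nowhere vanishing Fourier transform. *)
Definition probe : L2 R := L2of (fun x => (expabs 1 x)%:C).

Definition probe_hat (xi : R) : R := (Num.sqrt (2 * pi))^-1 * (2 / (1 + xi ^+ 2)).

Lemma probe_hat_gt0 xi : 0 < probe_hat xi.
Proof.
rewrite mulr_gt0 ?invr_gt0 ?sqrtr_gt0 ?mulr_gt0 ?pi_gt0//.
by rewrite invr_gt0 ltr_pwDl ?sqr_ge0.
Qed.

Lemma measurable_probe_hatV : measurable_fun [set: R] (fun xi => (probe_hat xi)^-1).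
Proof.
apply: continuous_measurable_fun => x; apply: cvgV; first by rewrite gt_eqF// probe_hat_gt0.
apply: cvgMr; apply: cvgMr; apply: cvgV.
  by rewrite gt_eqF// ltr_pwDl ?sqr_ge0.
by apply: cvgD; [exact: cvg_cst|exact: exprn_continuous].
Qed.

Lemma fourier_probe : \forall xi \ae mu, fourier probe xi = (probe_hat xi)%:C.
Proof.
have pae := L2of_ae sqint_expabs1.
have mp : cmeasurable (fun x : R => (expabs 1 x)%:C).
  by apply: cmeasurable_real; exact: measurable_expabs.
have pi' : cintegrable probe.
  apply: (cintegrable_ae _ (cintegrable_expabs (ltr01 : 0 < 1 :> R))).
    exact: sqint_cmeasurable.
  by apply: filterS pae => x ->.
apply: filterS (fourier_ae pi') => xi ->.
rewrite (fourier_integral_ae (sqint_cmeasurable probe) mp pae).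
rewrite /fourier_integral cintegral_expabs// /probe_hat -rmorphM mulr1 expr1n.
by [].
Qed.

Lemma multiplier_exists (T : L2 R -> L2 R) : unitary T -> translation_invariant T ->
  exists m : R -> R[i], [/\ cmeasurable m, \forall xi \ae mu, normc (m xi) = 1 &
    forall u, \forall xi \ae mu, fourier (T u) xi = m xi * fourier u xi].
Proof.
move=> uT tT.
(* The quotient of the transforms of [T probe] and [probe]. Taking both arguments equal to [probe]
   in the identity gives its modulus. *)
pose m xi := fourier (T probe) xi * ((probe_hat xi)^-1)%:C.
have pn xi : (probe_hat xi)%:C != 0.
  by rewrite -[0]/(0%:C) (inj_eq (@complexI R)) gt_eqF// probe_hat_gt0.
have m1 : \forall xi \ae mu, normc (m xi) = 1.
  apply: filterS2 (multiplier_identity probe probe uT tT) fourier_probe => xi + e.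
  rewrite !mulc_conjc e normc_real => /complexI /eqP.
  rewrite eqrXn2 ?normc_ge0// => /eqP E.
  rewrite /m normcM normc_real E -normrM mulfV ?normr1// gt_eqF//.
  exact: probe_hat_gt0.
exists m; split => //.
  apply: cmeasurableM; first exact: sqint_cmeasurable.
  by apply: cmeasurable_real; exact: measurable_probe_hatV.
move=> u; apply: filterS3 (multiplier_identity u probe uT tT) m1 fourier_probe.
move=> xi + n1 e; rewrite e.
have E : fourier (T probe) xi = m xi * (probe_hat xi)%:C.
  by rewrite /m -mulrA -rmorphM mulVf ?mulr1// gt_eqF// probe_hat_gt0.
rewrite E conjcM conjc_real mulrA => H0.
have H : fourier (T u) xi * conjc (m xi) = fourier u xi.
  by apply: (mulIf (pn xi)); exact: H0.
have := f_equal (fun z => z * m xi) H; rewrite -mulrA.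
by rewrite (mulrC (conjc _)) mulc_conjc n1 expr1n mulr1 mulrC.
Qed.

End Multiplier.

(** * Operators given by a multiplier, and local uniform continuity *)

Section MultiplierOf.
Variable R : realType.
Implicit Types (u v w : L2 R) (a b c r : R) (T : L2 R -> L2 R) (m : R -> R[i]).

Definition multiplier_of T m : Prop :=
  forall u, \forall xi \ae mu, fourier (T u) xi = m xi * fourier u xi.

(** Tested on [probe], whose transform can be cancelled. *)
Lemma multiplier_of_inj T m m' : multiplier_of T m -> multiplier_of T m' ->
  \forall xi \ae mu, m xi = m' xi.
Proof.
move=> h h'; apply: filterS3 (h (probe R)) (h' (probe R)) (fourier_probe R).
move=> xi e1 e2 e; move: e2; rewrite e1 e => H.
have pn : (probe_hat xi)%:C != 0 :> R[i].
  by rewrite -[0]/(0%:C) (inj_eq (@complexI R)) gt_eqF// probe_hat_gt0.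
by apply: (mulIf pn).
Qed.

Lemma multiplier_of_eq T T' m : multiplier_of T m -> multiplier_of T' m -> T = T'.
Proof.
move=> h h'; apply/funext => u; apply: fourier_inj; apply: L2P.
by apply: filterS2 (h u) (h' u) => xi e1 e2; exact: etrans e1 (esym e2).
Qed.

Lemma multiplier_of_comp T T' m m' : multiplier_of T m -> multiplier_of T' m' ->
  multiplier_of (T \o T') (fun xi => m xi * m' xi).
Proof.
move=> h h' u; apply: filterS2 (h (T' u)) (h' u) => xi e1 e2.
by rewrite [LHS]e1 e2 mulrA.
Qed.

Lemma multiplier_of_dilated T m c : c != 0 -> multiplier_of T m ->
  multiplier_of (dilated T c) (fun xi => m (c * xi)).
Proof.
move=> c0 h u.
have e1 := fourier_dilate (T (dilate c^-1 u)) c0.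
have e2 := ae_affine 0 c0 (h (dilate c^-1 u)).
have e3 := ae_affine 0 c0 (fourier_dilate u (invr_neq0 c0)).
apply: filterS3 e1 e2 e3 => xi; rewrite addr0 => e1 e2 e3.
by rewrite [LHS]e1 e2 e3 mulKf.
Qed.

Lemma multiplier_ae T m m' : (\forall xi \ae mu, m xi = m' xi) ->
  multiplier_of T m -> multiplier_of T m'.
Proof. by move=> mm h u; apply: filterS2 mm (h u) => xi <-. Qed.

Lemma indic_sqint (E : set R) : measurable E -> (mu E < +oo)%E ->
  (fun x => (\1_E x)%:C) \in @sqint R.
Proof.
move=> mE Eoo; apply: sqint_mem.
  by apply: cmeasurable_real; exact: measurable_indic.
rewrite /isqr; under eq_integral do rewrite normc_real indicE.
have -> : (\int[mu]_x (`|(x \in E)%:R| ^+ 2)%:E = \int[mu]_x (\1_E x)%:E)%E.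
  apply: eq_integral => x _; rewrite indicE.
  by case: (_ \in _); rewrite /= ?normr1 ?normr0 ?expr1n ?expr0n.
by rewrite integral_indic// setIT.
Qed.

(* Test the operator norm on the [u] whose transform is the normalised indicator
   of the part of the band where [m (lam * xi) - m xi] exceeds [e]. *)
Lemma LUC_multiplier T m r e : bounded_operator T -> cmeasurable m ->
  multiplier_of T m -> LUC T -> 1 < r -> 0 < e ->
  \forall lam \near (1 : R), \forall xi \ae mu,
    r^-1 <= `|xi| <= r -> normc (m (lam * xi) - m xi) <= e.
Proof.
move=> bT mm hm hL r1 e0.
have r0 : 0 < r by exact: lt_trans r1.
(* Continuity at the single dilation 1 suffices: it compares [m (lam * xi)] with [m xi] itself. *)
have := hL r r1 1 ltr01 => /fine_cvgP[hfin hlim].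
have pos1 : \forall lam \near (1 : R), 0 < lam by exact: (lt_nbhsr ltr01).
apply: filterS3 hfin (cvgr_lt _ hlim _ e0) pos1 => lam lfin lime lam0.
pose S u := dilated T lam u - dilated T 1 u.
have {lfin lime} hop : (opnorm_on (@L2band R r) S < e%:E)%E.
  by move: lime; rewrite -lte_fin /= fineK.
have lamn : lam != 0 by rewrite gt_eqF.
pose d xi := normc (m (lam * xi) - m xi).
have md : measurable_fun [set: R] d.
  apply: measurable_normc; apply: cmeasurableB => //.
  by have := cmeasurable_affine lam 0 mm; under eq_fun do rewrite addr0.
pose B : set R := [set xi | r^-1 <= `|xi| <= r].
have mB : measurable B.
  have -> : B = Num.norm @^-1` `[r^-1, r].
    by apply/seteqP; split => x /=; rewrite in_itv.
  by rewrite -[X in measurable X]setTI; exact: (@normr_measurable R [set: R]).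
pose E : set R := B `&` (d @^-1` `]e, +oo[).
have mE : measurable E.
  by apply: measurableI => //; rewrite -[X in measurable X]setTI; apply: md.
have Eoo : (mu E < +oo)%E.
  apply: (@le_lt_trans _ _ (mu `[- r, r])).
    apply: le_measure; rewrite ?inE//.
    by move=> x [/= /andP[_ xr] _]; rewrite in_itv /= -ler_norml.
  by rewrite lebesgue_measure_itv/=; case: ifP => _; rewrite ?ltry// -EFinB ltry.
suff E0 : mu E = 0.
  exists E; split => // x /= /not_implyP[xB /negP]; rewrite -ltNge => dx.
  by split => //=; rewrite in_itv/= dx.
(* If [E] had positive measure, the test vector below would be moved by [S] to a vector of norm at
   least [e], against the strict bound on the operator norm. *)
apply: contrapT => /eqP En0.
have Efin : mu E \is a fin_num by rewrite ge0_fin_numE.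
pose k := fine (mu E).
have k0 : 0 < k by rewrite fine_gt0// lt0e En0 measure_ge0 Eoo.
have iE := indic_sqint mE Eoo.
have [u0 hu0] := fourier_surj (L2of (fun x => (\1_E x)%:C)).
pose s : R := (Num.sqrt k)^-1.
have s2 : s ^+ 2 = k^-1 by rewrite exprVn sqr_sqrtr// ltW.
pose u := s%:C *: u0.
have Fu : \forall xi \ae mu, fourier u xi = s%:C * (\1_E xi)%:C.
  rewrite /u (bopZ _ _ (fourier_bop R)) hu0.
  by apply: filterS2 (L2Z_ae s%:C (L2of (fun x => (\1_E x)%:C))) (L2of_ae iE) => xi -> ->.
have i1 : (isqr (fun x => (\1_E x)%:C) = k%:E)%E.
  rewrite /isqr /k fineK// -[in RHS](setIT E) -integral_indic//.
  apply: eq_integral => x _; rewrite normc_real indicE.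
  by case: (_ \in _); rewrite /= ?normr1 ?normr0 ?expr1n ?expr0n.
have uband : L2band r u.
  apply: filterS Fu => xi -> hxi; rewrite indicE memNset ?mulr0//=.
  move=> [/andP[x1 x2] _]; case: hxi; rewrite ltNge ?x1 ?x2//.
have unorm : L2norm u <= 1.
  rewrite -(@ler_pXn2r _ 2)// ?nnegrE ?L2norm_ge0// L2norm2 expr1n -sqn_fourier.
  rewrite /u (bopZ _ _ (fourier_bop R)) hu0 sqnZ normc_real.
  have -> : sqn (L2of (fun x => (\1_E x)%:C)) = k.
    by apply: EFin_inj; rewrite sqn_L2of.
  by rewrite real_normK ?num_real// s2 mulVf// gt_eqF.
have : (((L2norm (S u))%:E <= opnorm_on (@L2band R r) S)%E).
  by apply: ereal_sup_ubound; exists u.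
move=> /le_lt_trans/(_ hop); rewrite lte_fin ltNge => /negP; apply.
rewrite -(@ler_pXn2r _ 2)// ?nnegrE ?L2norm_ge0 ?(ltW e0)// L2norm2 -sqn_fourier.
have h1 := multiplier_of_dilated lamn hm u.
have h2 := multiplier_of_dilated (oner_neq0 R) hm u.
have mg : cmeasurable (fun xi => (m (lam * xi) - m xi) * (s%:C * (\1_E xi)%:C)).
  apply: cmeasurableM.
    apply: cmeasurableB => //.
    by have := cmeasurable_affine lam 0 mm; under eq_fun do rewrite addr0.
  apply: cmeasurableM; first exact: cmeasurable_cst.
  by apply: cmeasurable_real; exact: measurable_indic.
rewrite -lee_fin (@sqn_ae _ _ (fun xi => (m (lam * xi) - m xi) * (s%:C * (\1_E xi)%:C))) //; last first.
  rewrite /S (bopB _ _ (fourier_bop R)).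
  apply: filterS3 (L2B_ae (fourier (dilated T lam u)) (fourier (dilated T 1 u)))
    (filterI h1 h2) Fu => xi -> [-> ->] ->.
  by rewrite mul1r mulrBl.
have -> : (e ^+ 2)%:E = isqr (fun xi => (e * s)%:C * (\1_E xi)%:C).
  rewrite isqrZ; last by apply: cmeasurable_real; exact: measurable_indic.
  rewrite i1 -EFinM normc_real real_normK ?num_real// exprMn s2 -mulrA mulVf ?mulr1//.
  by rewrite gt_eqF.
apply: isqr_le => //.
  apply: cmeasurableM; first exact: cmeasurable_cst.
  by apply: cmeasurable_real; exact: measurable_indic.
apply: aeW => xi; rewrite !normcM !normc_real indicE.
have s0 : 0 <= s by rewrite invr_ge0 sqrtr_ge0.
have [xE|xE] := boolP (xi \in E); last by rewrite /= normr0 !mulr0.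
rewrite /= !normr1 !mulr1 ger0_norm ?mulr_ge0 ?(ltW e0)// (ger0_norm s0).
apply: ler_wpM2r => //; move: xE; rewrite inE => -[_ /=].
by rewrite in_itv/= andbT => /ltW.
Qed.

End MultiplierOf.

(** * The continuous version of a multiplier *)

Section ContinuousVersion.
Variable R : realType.
Implicit Types (f g : R -> R) (x y r e : R).

Lemma ae_meets_ball (E : set R) x e : 0 < e -> (\forall y \ae mu, E y) ->
  exists y, E y /\ `|x - y| < e.
Proof.
move=> e0 [N [mN N0 EN]]; apply: contrapT => H.
have sub : ball x e `<=` N.
  move=> y xy; apply: EN => /= Ey; apply: H; exists y; split => //.
have : (mu (ball x e) <= mu N)%E.
  by apply: le_measure => //; rewrite inE//; exact: measurable_ball.
have mB : mu (ball x e) = (e *+ 2)%:E by exact: lebesgue_measure_ball (ltW e0).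
by rewrite mB N0 lee_fin leNgt mulrn_wgt0.
Qed.

Lemma locally_integrable_ae_bounded f : measurable_fun [set: R] f ->
  (\forall x \ae mu, `|f x| <= 1) -> locally_integrable [set: R] f.
Proof.
move=> mf f1; split; [exact: mf|exact: openT|] => K _ cK.
have mK := compact_measurable cK.
apply: (@le_lt_trans _ _ (\int[mu]_(x in K) (cst 1%:E x))%E).
  apply: ae_ge0_le_integral => //.
  - by apply/measurable_EFinP; apply: measurableT_comp => //; exact: measurable_funTS.
  - by apply: filterS f1 => x fx _; rewrite lee_fin.
by rewrite integral_cst// mul1e; exact: compact_finite_measure.
Qed.

Lemma lebesgue_pt_near f x e : lebesgue_pt f x -> 0 < e ->
  exists2 d : R, 0 < d & forall rho, 0 < rho -> rho < d ->
    (\int[mu]_(y in ball x rho) `|f y - f x|%:E <= (e * (rho *+ 2))%:E)%E.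
Proof.
rewrite /lebesgue_pt => /fine_cvgP[hfin hlim] e0.
have [d d0 hd] : \forall rho \near (0 : R)^'+,
    (\int[mu]_(y in ball x rho) `|f y - f x|%:E <= (e * (rho *+ 2))%:E)%E.
  have pos : \forall rho \near (0 : R)^'+, 0 < rho by exact: nbhs_right_gt.
  apply: filterS3 hfin (cvgr_lt _ hlim _ e0) pos => rho rfin /= rlt rho0.
  move: rlt; rewrite -lte_fin fineK// /davg /iavg (lebesgue_measure_ball _ (ltW rho0)).
  have r2 : 0 < rho *+ 2 by rewrite mulrn_wgt0.
  rewrite inver gt_eqF// muleC -lte_pdivlMr; last by rewrite invr_gt0.
  by rewrite invrK => /ltW.
exists d => // rho rho0 rd; apply: hd => //=.
by rewrite sub0r normrN gtr0_norm.
Qed.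

Lemma integral_ball_dilation (h : R -> R) x lam rho : 0 < lam ->
  measurable_fun [set: R] h -> (forall y, 0 <= h y) ->
  (\int[mu]_(y in ball (lam * x)%R (lam * rho)%R) (h y)%:E =
   lam%:E * \int[mu]_(u in ball x rho) (h (lam * u)%R)%:E)%E.
Proof.
move=> lam0 mh h0.
have mB z s : measurable (ball z s : set R) by exact: measurable_ball.
have mD : measurable_fun (ball (lam * x) (lam * rho) : set R) (fun y => (h y)%:E).
  by apply/measurable_EFinP; exact: measurable_funTS.
rewrite integral_mkcond [in RHS]integral_mkcond.
rewrite (@ge0_integral_affine R lam 0); last 3 first.
- by rewrite gt_eqF.
- exact: ((measurable_restrictT _ (mB _ _)).1 mD).
- by move=> y; rewrite patchE; case: ifP => _ //; rewrite lee_fin.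
rewrite gtr0_norm//; congr (_ * _)%E; apply: eq_integral => u _.
rewrite !patchE addr0.
have -> : (lam * u \in (ball (lam * x) (lam * rho) : set R)) = (u \in (ball x rho : set R)).
  apply/idP/idP; rewrite !inE /ball/= -mulrBr normrM gtr0_norm// ltr_pM2l//.
by [].
Qed.

(* Compare the averages of [f] over a small ball at [x] and over its dilate by
   [lam], a ball at [lam * x]. *)
Lemma lebesgue_pt_dilation_le f x e lam (A : set R) : measurable_fun [set: R] f ->
  0 < lam -> 0 <= e -> lebesgue_pt f x -> lebesgue_pt f (lam * x) ->
  nbhs x A -> (\forall u \ae mu, A u -> `|f (lam * u) - f u| <= e) ->
  `|f x - f (lam * x)| <= e.
Proof.
move=> mf lam0 e0 lx ly [d3 /= d30 h3] fA; apply/ler_addgt0Pr => d d0.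
have dh : 0 < d / 2 by rewrite divr_gt0.
have [d1 d10 h1] := lebesgue_pt_near lx dh.
have [d2 d20 h2] := lebesgue_pt_near ly dh.
(* The three bounds control the average at [x], the average at [lam * x] over the ball of radius
   [lam * rho], and the inclusion of the ball at [x] in [A]; halving makes them strict. *)
pose rho := Num.min d1 (Num.min (d2 / lam) d3) / 2.
have mn0 : 0 < Num.min d1 (Num.min (d2 / lam) d3).
  by rewrite !lt_min d10 d30 divr_gt0.
have rho0 : 0 < rho by rewrite divr_gt0.
have rmin : rho < Num.min d1 (Num.min (d2 / lam) d3).
  by rewrite /rho ltr_pdivrMr// ltr_pMr// ltr1n.
move: rmin; rewrite !lt_min => /and3P[r1 r2 r3].
have {}h1 := h1 rho rho0 r1.
have lr0 : 0 < lam * rho by rewrite mulr_gt0.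
have lr2 : lam * rho < d2 by rewrite mulrC -ltr_pdivlMr.
have {}h2 := h2 (lam * rho) lr0 lr2.
have mfB (c : R) : measurable_fun [set: R] (fun y => `|f y - c|).
  by apply: measurableT_comp => //; exact: measurable_funB.
rewrite integral_ball_dilation// in h2.
have mB : measurable (ball x rho : set R) by exact: measurable_ball.
have muB : mu (ball x rho) = (rho *+ 2)%:E by exact: lebesgue_measure_ball (ltW rho0).
have R2 : 0 < rho *+ 2 by rewrite mulrn_wgt0.
set y := lam * x in h2 *.
set I1 := (\int[mu]_(u in ball x rho) `|f u - f x|%:E)%E in h1.
set I2 := (\int[mu]_(u in ball x rho) `|f (lam * u)%R - f y|%:E)%E in h2.
have {}h2 : (I2 <= (d / 2 * (rho *+ 2))%:E)%E.
  rewrite -(@lee_pmul2l _ lam%:E)//.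
  apply: (le_trans h2); rewrite -EFinM lee_fin le_eqVlt; apply/orP; left; apply/eqP.
  by rewrite -mulrnAr; ring.
have mfl : measurable_fun [set: R] (fun u => f (lam * u)).
  have := measurableT_comp mf (affine_measurable lam 0); rewrite /comp.
  by under eq_fun do rewrite addr0.
have mI1 : measurable_fun (ball x rho) (fun u => `|f u - f x|%:E)%E.
  by apply/measurable_EFinP; exact: measurable_funTS (mfB _).
have mI2 : measurable_fun (ball x rho) (fun u => `|f (lam * u)%R - f y|%:E)%E.
  apply/measurable_EFinP; apply: measurable_funTS; apply: measurableT_comp => //.
  exact: measurable_funB.
have ineq : ((`|f x - f y| * (rho *+ 2))%:E <= I1 + (e * (rho *+ 2))%:E + I2)%E.
  have -> : (`|f x - f y| * (rho *+ 2))%:E = (\int[mu]_(u in ball x rho) (cst `|f x - f y|%:E u))%E.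
    by rewrite integral_cst// EFinM -muB.
  have -> : ((e * (rho *+ 2))%:E = \int[mu]_(u in ball x rho) (cst e%:E u))%E.
    by rewrite integral_cst// EFinM -muB.
  rewrite /I1 /I2 -ge0_integralD//.
  - rewrite -ge0_integralD//.
    + apply: ae_ge0_le_integral => //.
      * by move=> u _; rewrite lee_fin.
      * by move=> u _; rewrite !adde_ge0 ?lee_fin.
      * by apply: emeasurable_funD => //; apply: emeasurable_funD.
      apply: filterS fA => u fAu uB; rewrite /cst/= -!EFinD lee_fin.
      have Au : A u.
        by apply: h3; move: uB; rewrite /ball/= => /lt_trans; apply.
      have := fAu Au => hu.
      rewrite (_ : f x - f y = (f x - f u) + (f u - f (lam * u)) + (f (lam * u) - f y)); last by ring.
      apply: (le_trans (ler_normD _ _)); rewrite lerD2r.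
      apply: (le_trans (ler_normD _ _)); rewrite distrC lerD2l distrC.
      exact: hu.
    + by move=> u _; rewrite adde_ge0 ?lee_fin.
    + exact: emeasurable_funD.
have : ((`|f x - f y| * (rho *+ 2))%:E <= ((e + d) * (rho *+ 2))%:E)%E.
  apply: (le_trans ineq).
  apply: (@le_trans _ _ ((d / 2 * (rho *+ 2))%:E + (e * (rho *+ 2))%:E +
      (d / 2 * (rho *+ 2))%:E)%E).
    by apply: leeD => //; apply: leeD.
  rewrite -!EFinD lee_fin le_eqVlt; apply/orP; left; apply/eqP.
  by move: (rho *+ 2) => k; field.
by rewrite lee_fin ler_pM2r.
Qed.

(** The exceptional null set may depend on [lam], so the estimate cannot be read at a fixed [xi]
    with [lam] varying. *)
Definition dilation_continuous f : Prop :=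
  forall r e, 1 < r -> 0 < e -> \forall lam \near (1 : R), \forall xi \ae mu,
    r^-1 <= `|xi| <= r -> `|f (lam * xi) - f xi| <= e.

(** Two points near [x0 > 0] differ by the dilation [y / x], which is close to 1; at Lebesgue points
    the a.e. estimate for this single dilation becomes an estimate of values. *)
Lemma lebesgue_pts_cauchy f x0 e : measurable_fun [set: R] f ->
  dilation_continuous f -> 0 < x0 -> 0 < e ->
  exists2 d, 0 < d & forall x y, lebesgue_pt f x -> lebesgue_pt f y ->
    `|x - x0| < d -> `|y - x0| < d -> `|f x - f y| <= e.
Proof.
move=> mf hf x00 e0.
(* The band from [r^-1] to [r] then contains a neighbourhood of every point used below. *)
pose r := 2 * x0 + 2 / x0.
have r1 : 1 < r.
  have h : 0 < 2 / x0 by rewrite divr_gt0.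
  have : 0 <= x0^-1 * (2 * x0 - 1) ^+ 2 by rewrite mulr_ge0 ?sqr_ge0// invr_ge0 ltW.
  have -> : x0^-1 * (2 * x0 - 1) ^+ 2 = 4 * x0 - 4 + x0^-1 by field; rewrite gt_eqF.
  have : 0 < x0^-1 by rewrite invr_gt0.
  by rewrite /r; lra.
have r0 : 0 < r by exact: lt_trans r1.
have [d /= d0 hd] := hf r e r1 e0.
(* The first bound keeps [x] and [y] above [3 * x0 / 4]; the second gives
   [|x - y| < d * x0 / 2 < d * x], hence [|1 - y / x| < d]. *)
pose d' := Num.min (x0 / 4) (d * x0 / 4).
have d'0 : 0 < d' by rewrite lt_min !divr_gt0//= mulr_gt0.
exists d' => // x y lx ly; rewrite !lt_min => /andP[xa xb] /andP[ya yb].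
have x1 : x0 * 3 / 4 < x by move: xa; rewrite ltr_norml => /andP[? ?]; lra.
have x2 : x < x0 * 5 / 4 by move: xa; rewrite ltr_norml => /andP[? ?]; lra.
have xp : 0 < x by apply: lt_trans x1; rewrite !mulr_gt0// invr_gt0.
have y1 : x0 * 3 / 4 < y by move: ya; rewrite ltr_norml => /andP[? ?]; lra.
have yp : 0 < y by apply: lt_trans y1; rewrite !mulr_gt0// invr_gt0.
pose lam := y / x.
have lam0 : 0 < lam by rewrite divr_gt0.
have lx' : lam * x = y by rewrite /lam divfK// gt_eqF.
have lamd : `|1 - lam| < d.
  rewrite /lam -{1}(@divff _ x) ?gt_eqF// -mulrBl normrM normfV (gtr0_norm xp).
  rewrite ltr_pdivrMr//.
  move: xb yb; rewrite !ltr_norml => /andP[? ?] /andP[? ?].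
  have : d * x0 * 3 / 4 < d * x by rewrite -!mulrA ltr_pM2l// mulrA.
  by move=> ?; apply/andP; split; lra.
have hl := hd lam lamd.
pose A : set R := [set u | r^-1 <= `|u| <= r].
have nA : nbhs x A.
  exists (x0 / 4) => /=; first by rewrite divr_gt0.
  move=> u /=; rewrite ltr_norml => /andP[u1 u2].
  have up : 0 < u by lra.
  rewrite /A /= gtr0_norm//; apply/andP; split.
    rewrite -[leRHS]invrK lef_pV2 ?posrE ?invr_gt0//.
    have -> : r = 2 * x0 + 2 / x0 by [].
    have : u^-1 <= 2 / x0.
      rewrite -[leRHS]invrK lef_pV2 ?posrE ?invr_gt0 ?divr_gt0//.
      by rewrite invf_div; lra.
    lra.
  rewrite /r; have : 0 < 2 / x0 by rewrite divr_gt0.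
  lra.
have := @lebesgue_pt_dilation_le f x e lam A mf lam0 (ltW e0) lx.
by rewrite lx'; apply.
Qed.

(** The value [g x0] is the limit of [f] along its Lebesgue points near [x0], and [f] agrees with
    [g] at each positive Lebesgue point. *)
Lemma continuous_version f : measurable_fun [set: R] f ->
  (\forall x \ae mu, `|f x| <= 1) -> dilation_continuous f ->
  exists g : R -> R, (forall x, 0 < x -> {for x, continuous g}) /\
    (\forall x \ae mu, 0 < x -> f x = g x).
Proof.
move=> mf f1 hf.
have aeL := lebesgue_differentiation (locally_integrable_ae_bounded mf f1).
(* Off the half line the limit is set to 0, a default that no later step reads. *)
have lim_ex x0 : exists l : R, 0 < x0 -> forall e, 0 < e -> exists2 d, 0 < d &
    forall y, lebesgue_pt f y -> `|y - x0| < d -> `|f y - l| <= e.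
  have [x0p|x0n] := ltP 0 x0; last by exists 0.
  (* The trace of the neighbourhoods on the Lebesgue points is a proper filter because a set of full
     measure meets every ball. *)
  pose F := f @ within (lebesgue_pt f) (nbhs x0).
  have PF : ProperFilter (within (lebesgue_pt f) (nbhs x0)).
    apply: within_nbhs_proper => B [e e0 Be].
    have [y [Ly xy]] := ae_meets_ball x0 e0 aeL.
    by exists y; split => //; exact: Be.
  have /cauchy_cvgP : cauchy F.
    apply: cauchy_exP => e e0; have e2 : 0 < e / 2 by rewrite divr_gt0.
    have [d d0 hd] := lebesgue_pts_cauchy mf hf x0p e2.
    have [y [Ly xy]] := ae_meets_ball x0 d0 aeL.
    exists (f y); exists d => //= z; rewrite /= => xz Lz.
    apply: (@le_lt_trans _ _ (e / 2)); last by rewrite ltr_pdivrMr// ltr_pMr// ltr1n.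
    by apply: hd => //; rewrite distrC.
  move=> cF; exists (lim F) => _ e e0.
  have /cvgrPdist_le/(_ _ e0) [d d0 hd] : F --> lim F by exact: cF.
  exists d => // y Ly yx; rewrite distrC; apply: hd => //=.
  by rewrite distrC.
have [g hg] := choice lim_ex; exists g; split.
  move=> x0 x0p; apply/cvgrPdist_le => e e0; have e2 : 0 < e / 2 by rewrite divr_gt0.
  have [d d0 hd] := hg x0 x0p _ e2.
  have pos : \forall x \near x0, 0 < x by exact: lt_nbhsr.
  have nd : \forall x \near x0, `|x0 - x| < d / 2.
    by exists (d / 2) => //=; rewrite divr_gt0.
  apply: filterS2 pos nd => x xp xd.
  have [d' d'0 hd'] := hg x xp _ e2.
  have m0 : 0 < Num.min d' (d / 2) by rewrite lt_min d'0 divr_gt0.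
  have [y [Ly]] := ae_meets_ball x m0 aeL.
  rewrite lt_min => /andP[y1 y2].
  have h1 : `|f y - g x| <= e / 2 by apply: hd' => //; rewrite distrC.
  have h2 : `|f y - g x0| <= e / 2.
    apply: hd => //; rewrite -(subrKA x); apply: (le_lt_trans (ler_normD _ _)).
    by rewrite (splitr d); apply: ltrD; rewrite distrC.
  rewrite -(subrKA (f y)); apply: (le_trans (ler_normD _ _)).
  by rewrite (splitr e); apply: lerD => //; rewrite distrC.
apply: filterS aeL => x Lx xp; apply/eqP; rewrite -subr_eq0 -normr_le0.
apply/ler_addgt0Pr => e e0; rewrite add0r.
by have [d d0] := hg x xp _ e0; apply => //; rewrite subrr normr0.
Qed.

End ContinuousVersion.

(** * The functional equation on the half line *)

Section Lifting.
Variable R : realType.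
Implicit Types (z : R[i]) (x y s t : R).

Definition ccontinuous (M : R -> R[i]) : Prop :=
  continuous (fun x => Re (M x)) /\ continuous (fun x => Im (M x)).

(** The function [d] takes its values in the multiples of [2 pi]. If it were not constant, the
    intermediate value theorem would give a value at distance [t] from [d a] with [0 < t <= pi],
    where the cosine is less than 1. *)
Lemma continuous_expi_cst1 (d : R -> R) : continuous d ->
  (forall s, cos (d s) = 1) -> forall s, d s = d 0.
Proof.
move=> cd d1.
have sin0' s : sin (d s) = 0.
  have := cos2Dsin2 (d s); rewrite d1 expr1n => /eqP.
  by rewrite -subr_eq0 addrC addKr sqrf_eq0 => /eqP.
have main a b : a <= b -> d a <> d b -> False.
  move=> ab /eqP dab.
  have ivt v : Num.min (d a) (d b) <= v <= Num.max (d a) (d b) -> exists c, d c = v.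
    move=> hv; have [|c _ dc] := IVT ab _ hv; last by exists c.
    exact: continuous_subspaceT.
  pose t := Num.min `|d b - d a| pi.
  have t0 : 0 < t by rewrite lt_min normr_gt0 subr_eq0 eq_sym dab pi_gt0.
  have tpi : t <= pi by rewrite ge_min lexx orbT.
  have td : t <= `|d b - d a| by rewrite ge_min lexx.
  have ct : cos t < 1.
    by rewrite -cos0 ltr_cos ?in_itv/= ?lexx ?pi_ge0 ?(ltW t0).
  have [dlt|dgt] := ltP (d a) (d b).
    have [|c dc] := ivt (d a + t).
      rewrite (min_idPl (ltW dlt)) (max_idPr (ltW dlt)) lerDl (ltW t0) /=.
      by rewrite addrC -lerBrDr -(@gtr0_norm _ (d b - d a)) ?subr_gt0.
    have := d1 c; rewrite dc cosD d1 sin0' mul0r subr0 mul1r => E.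
    by rewrite E ltxx in ct.
  have [|c dc] := ivt (d a - t).
    rewrite (min_idPr dgt) (max_idPl dgt) gerBl (ltW t0) andbT.
    by rewrite lerBrDl -lerBrDr -(@ger0_norm _ (d a - d b)) ?subr_ge0// distrC.
  have := d1 c; rewrite dc cosB d1 sin0' mul0r addr0 mul1r => E.
  by rewrite E ltxx in ct.
move=> s; apply: contrapT => dn.
have [s0|s0] := leP 0 s; first by apply: (main _ _ s0) => /esym.
exact: (main _ _ (ltW s0)).
Qed.

Definition arg_right z : R := atan (Im z / Re z).

Lemma expi_arg_right z : normc z = 1 -> 0 < Re z -> expi (arg_right z) = z.
Proof.
move=> z1 x0.
have n1 : Re z ^+ 2 + Im z ^+ 2 = 1 by rewrite -normc2E z1 expr1n.
have xn : Re z != 0 by rewrite gt_eqF.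
have C : cos (arg_right z) = Re z.
  rewrite /arg_right cos_atan.
  have -> : 1 + (Im z / Re z) ^+ 2 = (Re z)^-1 ^+ 2.
    rewrite expr_div_n exprVn -[X in X + _](@divff _ (Re z ^+ 2)) ?expf_neq0//.
    by rewrite -mulrDl n1 mul1r.
  by rewrite sqrtr_sqr gtr0_norm ?invr_gt0// invrK.
apply: complex_eqP => //=.
have := atanK (Im z / Re z); rewrite /tan -/(arg_right z) C => /(f_equal (fun t => t * Re z)).
by rewrite !divfK.
Qed.

Lemma expi_surj z : normc z = 1 -> exists t, expi t = z.
Proof.
move=> z1; have n1 : Re z ^+ 2 + Im z ^+ 2 = 1 by rewrite -normc2E z1 expr1n.
have x1 : -1 <= Re z <= 1 by rewrite -ler_norml -z1 normc_Re_le.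
have c1 : cos (acos (Re z)) = Re z by rewrite acosK// in_itv.
have s1 : sin (acos (Re z)) = `|Im z|.
  by rewrite sin_acos// -n1 addrC addKr sqrtr_sqr.
have [i0|i0] := leP 0 (Im z).
  by exists (acos (Re z)); apply: complex_eqP; rewrite //= s1 ger0_norm.
exists (- acos (Re z)); apply: complex_eqP; rewrite /= ?cosN ?c1//.
by rewrite sinN s1 ltr0_norm// opprK.
Qed.

(** For [L >= 0], the truncation of [x] to [-L, L], written with absolute values so that continuity
    is immediate. *)
Definition clamp (L x : R) : R := (`|x + L| - `|x - L|) / 2.

Lemma continuous_clamp L : continuous (clamp L).
Proof.
move=> x; apply: cvgMl; apply: cvgB; apply: cvg_norm.
  by apply: cvgD; [exact: cvg_id|exact: cvg_cst].
by apply: cvgB; [exact: cvg_id|exact: cvg_cst].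
Qed.

Lemma clamp_bound L x : 0 <= L -> `|clamp L x| <= L.
Proof.
move=> L0; rewrite /clamp normrM normfV (@ger0_norm _ 2)// ler_pdivrMr//.
apply: le_trans (ler_dist_dist _ _) _; rewrite ger0_norm; lra.
Qed.

Lemma clamp_id L x : `|x| <= L -> clamp L x = x.
Proof.
rewrite ler_norml => /andP[x1 x2]; rewrite /clamp ger0_norm; last lra.
by rewrite ler0_norm; [field|lra].
Qed.

Section Lift.
Variable M : R -> R[i].
Hypotheses (cM : ccontinuous M) (M1 : forall s, normc (M s) = 1).

(** Uniform continuity on the compact interval, in the form that the lift consumes: over one step
    the quotient of values stays in the right half plane. *)
Lemma quotient_near_one L : 0 <= L -> exists k : nat, forall y t,
  `|y| <= L -> `|t| <= L / k.+1%:R -> 0 < Re (M (y + t) * conjc (M y)).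
Proof.
move=> L0; have [cr ci] := cM.
pose P (k : nat) y := forall t, `|t| <= L / k.+1%:R -> 0 < Re (M (y + t) * conjc (M y)).
have /compact_near_coveringP/(_ nat \oo P _) H := @segment_compact R (- L) L.
have : \forall k \near \oo, `[- L, L]%classic `<=` P k.
  apply: H => x _.
  (* With components within 1/4 of those at [x], the values at [y] and [y + t] are at squared
     distance less than 1/2. For unit vectors the real part of the quotient is 1 minus half of this,
     so it is positive. *)
  have e4 : 0 < 4^-1 :> R by rewrite invr_gt0.
  have [d1 d10 hd1] : \forall u \near x, `|Re (M x) - Re (M u)| < 4^-1.
    by have /cvgrPdist_lt := cr x; apply.
  have [d2 d20 hd2] : \forall u \near x, `|Im (M x) - Im (M u)| < 4^-1.
    by have /cvgrPdist_lt := ci x; apply.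
  pose d := Num.min d1 d2 / 2.
  have d0 : 0 < d by rewrite divr_gt0// lt_min d10 d20.
  have near0 : \forall k \near \oo, L / k.+1%:R < d.
    have : (fun k => L * k.+1%:R^-1) @ \oo --> (L * 0 : R).
      by apply: cvgMr; exact: cvg_harmonic.
    by rewrite mulr0 => /cvgr_lt; apply.
  exists (ball x d, [set k | L / k.+1%:R < d]).
    by split => //=; exact: nbhsx_ballx.
  move=> [y k] /= [xy kd] t tk.
  have bnd u : `|x - u| < d + d -> `|Re (M x) - Re (M u)| < 4^-1 /\
      `|Im (M x) - Im (M u)| < 4^-1.
    have -> : d + d = Num.min d1 d2 by rewrite /d -splitr.
    by rewrite lt_min => /andP[u1 u2]; split; [exact: hd1|exact: hd2].
  have [y1 y2] : `|Re (M x) - Re (M y)| < 4^-1 /\ `|Im (M x) - Im (M y)| < 4^-1.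
    by apply: bnd; rewrite (lt_trans xy)// ltrDl.
  have [t1 t2] : `|Re (M x) - Re (M (y + t))| < 4^-1 /\
      `|Im (M x) - Im (M (y + t))| < 4^-1.
    apply: bnd; rewrite opprD addrA; apply: le_lt_trans (ler_normB _ _) _.
    by apply: ltrD => //; exact: le_lt_trans tk kd.
  rewrite !cE mulrN opprK.
  have n1 u : Re (M u) ^+ 2 + Im (M u) ^+ 2 = 1 by rewrite -normc2E M1 expr1n.
  have := n1 y; have := n1 (y + t); move: y1 y2 t1 t2; rewrite !ltr_norml.
  set a := Re (M x); set b := Im (M x).
  set a1 := Re (M y); set b1 := Im (M y).
  set a2 := Re (M (y + t)); set b2 := Im (M (y + t)).
  move=> /andP[? ?] /andP[? ?] /andP[? ?] /andP[? ?] e1 e2.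
  have h1 : (a2 - a1) ^+ 2 < 4^-1.
    rewrite -[4^-1](_ : 2^-1 ^+ 2 = _); last by rewrite exprVn -natrX.
    rewrite -real_normK ?num_real// ltr_pXn2r ?nnegrE ?invr_ge0//.
    by rewrite ltr_norml; apply/andP; split; lra.
  have h2 : (b2 - b1) ^+ 2 < 4^-1.
    rewrite -[4^-1](_ : 2^-1 ^+ 2 = _); last by rewrite exprVn -natrX.
    rewrite -real_normK ?num_real// ltr_pXn2r ?nnegrE ?invr_ge0//.
    by rewrite ltr_norml; apply/andP; split; lra.
  by move: h1 h2; rewrite !sqrrB; nra.
move=> [k _ hk]; exists k => y t yL tk; apply: (hk k) => //=.
by rewrite in_itv/= -ler_norml.
Qed.

(* On [-L, L] the lift is a sum of [k + 1] principal arguments of the quotients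
   [M (x_(j+1)) / M (x_j)], [x_j = j s / (k + 1)], which lie in the right half
   plane. *)
Lemma local_lift t0 L : 0 <= L -> expi t0 = M 0 ->
  exists h : R -> R, [/\ continuous h, h 0 = t0 & forall s, expi (h s) = M (clamp L s)].
Proof.
move=> L0 ht0; have [k hk] := quotient_near_one L0.
pose x (j : nat) s := clamp L s * (j%:R / k.+1%:R).
pose q j s := M (x j.+1 s) * conjc (M (x j s)).
have kp : 0 < k.+1%:R :> R by [].
have xL j s : (j <= k.+1)%N -> `|x j s| <= L.
  move=> jk; rewrite normrM -[leRHS]mulr1; apply: ler_pM => //; first exact: clamp_bound.
  by rewrite ger0_norm ?divr_ge0// ler_pdivrMr// mul1r ler_nat.
have xS j s : x j.+1 s = x j s + clamp L s / k.+1%:R.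
  by rewrite /x -natr1 mulrDl mulrDr mul1r.
have qpos j s : (j < k.+1)%N -> 0 < Re (q j s).
  move=> jk; rewrite /q xS; apply: hk; first exact/xL/ltnW.
  by rewrite normrM normfV (gtr0_norm kp) ler_pM2r ?invr_gt0//; exact: clamp_bound.
have q1 j s : normc (q j s) = 1 by rewrite normcM normc_conjc !M1 mulr1.
have [cr ci] := cM.
have cx j : continuous (x j).
  by move=> s; apply: cvgM; [exact: continuous_clamp|exact: cvg_cst].
have cxr i : continuous (fun s => Re (M (x i s))).
  by move=> s; apply: (@continuous_comp _ _ _ (x i) (fun y => Re (M y))); [exact: cx|exact: cr].
have cxi i : continuous (fun s => Im (M (x i s))).
  by move=> s; apply: (@continuous_comp _ _ _ (x i) (fun y => Im (M y))); [exact: cx|exact: ci].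
have cRe j : continuous (fun s => Re (q j s)).
  move=> s; rewrite (_ : (fun s => _) = (fun s => Re (M (x j.+1 s)) * Re (M (x j s)) +
      Im (M (x j.+1 s)) * Im (M (x j s)))); last first.
    by apply/funext => u; rewrite !cE mulrN opprK.
  by apply: cvgD; apply: cvgM; [exact: cxr|exact: cxr|exact: cxi|exact: cxi].
have cIm j : continuous (fun s => Im (q j s)).
  move=> s; rewrite (_ : (fun s => _) = (fun s => Im (M (x j.+1 s)) * Re (M (x j s)) -
      Re (M (x j.+1 s)) * Im (M (x j s)))); last first.
    by apply/funext => u; rewrite !cE mulrN addrC.
  by apply: cvgB; apply: cvgM; [exact: cxi|exact: cxr|exact: cxr|exact: cxi].
have carg j : (j < k.+1)%N -> continuous (fun s => arg_right (q j s)).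
  move=> jk s; apply: (@continuous_comp _ _ _ (fun s => Im (q j s) / Re (q j s)) (@atan R)).
    apply: cvgM; first exact: cIm.
    by apply: cvgV; [rewrite gt_eqF// qpos|exact: cRe].
  exact: continuous_atan.
have csum i : (i <= k.+1)%N -> continuous (fun s => \sum_(0 <= j < i) arg_right (q j s)).
  elim: i => [_ s|i IH ik s].
    by under eq_fun do rewrite big_geq//; exact: cvg_cst.
  under eq_fun do rewrite big_nat_recr//=.
  by apply: cvgD; [exact: IH (ltnW ik) s|exact: carg].
pose h s := t0 + \sum_(0 <= j < k.+1) arg_right (q j s).
exists h; split.
- by move=> s; apply: cvgD; [exact: cvg_cst|exact: csum].
- rewrite /h big1 ?addr0// => j _.
  have x00 i : x i 0 = 0 by rewrite /x clamp_id ?normr0// mul0r.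
  by rewrite /arg_right /q !x00 mulc_conjc /= mul0r atan0.
- move=> s.
  have step (i : nat) : (i <= k.+1)%N ->
      expi (t0 + \sum_(0 <= j < i) arg_right (q j s)) = M (x i s).
    elim: i => [_|i IH ik].
      by rewrite big_geq// addr0 ht0 /x mul0r mulr0.
    rewrite big_nat_recr//= addrA expiD IH; last exact: ltnW.
    rewrite expi_arg_right//; last exact: qpos.
    by rewrite /q mulrCA mulc_conjc M1 expr1n mulr1.
  rewrite /h step//.
  by rewrite /x divff ?mulr1.
Qed.

(** Lifts over the intervals [-n, n] with the same value at 0 agree on common intervals, and
    glue. *)
Lemma lift_exists : exists2 h : R -> R, continuous h & forall s, expi (h s) = M s.
Proof.
have [t0 ht0] := expi_surj (M1 0).
have [H HH] := choice (fun n : nat => local_lift (ler0n R n) ht0).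
have clampE n s : `|s| <= n%:R -> expi (H n s) = M s.
  by move=> sn; have [_ _ ->] := HH n; rewrite clamp_id.
have agree n k s : `|s| <= n%:R -> (n <= k)%N -> H n s = H k s.
  move=> sn nk; have [cn n0 En] := HH n; have [ck k0 Ek] := HH k.
  (* Clamping extends the difference of two lifts to a continuous function on the whole line, all of
     whose values are multiples of [2 pi]. *)
  pose d x := H n (clamp n%:R x) - H k (clamp n%:R x).
  have cd : continuous d.
    move=> x; apply: cvgB.
      by apply: (@continuous_comp _ _ _ (clamp n%:R) (H n)); [exact: continuous_clamp|exact: cn].
    by apply: (@continuous_comp _ _ _ (clamp n%:R) (H k)); [exact: continuous_clamp|exact: ck].
  have cb x : `|clamp n%:R x| <= n%:R by exact: clamp_bound.
  have d1 x : cos (d x) = 1.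
    have : expi (d x) = 1.
      rewrite /d expiD -conjc_expi clampE// clampE; last first.
        by apply: le_trans (cb x) _; rewrite ler_nat.
      by rewrite mulc_conjc M1 expr1n.
    by move=> /(f_equal (@complex.Re R)).
  have := continuous_expi_cst1 cd d1 s.
  rewrite /d clamp_id// clamp_id ?normr0// n0 k0 subrr => /eqP.
  by rewrite subr_eq0 => /eqP.
have agree2 n k s : `|s| <= n%:R -> `|s| <= k%:R -> H n s = H k s.
  move=> sn sk; have [nk|/ltnW kn] := leqP n k; first exact: agree.
  by apply/esym; exact: agree.
pose N (s : R) := (Num.truncn `|s|).+1.
have Ns s : `|s| <= (N s)%:R by apply: ltW; exact: truncnS_gt.
exists (fun s => H (N s) s) => [s|s]; last exact: clampE.
(* One unit more than needed at [s], so that a single local lift serves the whole ball of radius 1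
   around [s]. *)
have [c _ _] := HH (N s).+1.
have eqn : \forall y \near s, H (N y) y = H (N s).+1 y.
  exists 1 => //= y; rewrite /= => sy.
  have yN : `|y| <= (N s).+1%:R.
    rewrite -natr1 -(subrK s y) addrC; apply: le_trans (ler_normD _ _) _.
    by apply: lerD => //; rewrite distrC ltW.
  exact: agree2.
rewrite /continuous_at /=.
have -> : H (N s) s = H (N s).+1 s by apply: agree.
apply: cvg_trans (c s); apply: near_eq_cvg.
by apply: filterS eqn.
Qed.

End Lift.
End Lifting.

(** * Continuous phases that double and triple under two shifts *)

Section FunctionalEquation.
Variable R : realType.
Implicit Types (x y s t p q : R).

(** If some interval from 0 to [e] contains no element of [G], distinct elements are at least [e]
    apart, so there is a least positive element; Euclidean division shows that it generates. *)
Lemma subgroup_dense_or_discrete (G : set R) a : 0 < a -> G a ->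
  (forall p q, G p -> G q -> G (p - q)) ->
  (forall e, 0 < e -> exists2 p, G p & 0 < p < e) \/
  (exists2 p0, 0 < p0 & forall q, G q -> exists k : int, q = k%:~R * p0).
Proof.
move=> a0 Ga GB.
have G0 : G 0 by rewrite -(subrr a); exact: GB.
have GN p : G p -> G (- p) by rewrite -sub0r; exact: GB.
have GD p q : G p -> G q -> G (p + q).
  by move=> Gp Gq; rewrite -[q]opprK; apply: GB => //; exact: GN.
have GM (k : int) p : G p -> G (k%:~R * p).
  move=> Gp; have Gn (n : nat) : G (n%:R * p).
    by elim: n => [|n IH]; [rewrite mul0r|rewrite -natr1 mulrDl mul1r; exact: GD].
  by case: k => n; rewrite ?NegzE ?mulrNz ?mulNr -?pmulrn//; exact/GN.
have [dense|/existsNP[e /not_implyP[e0 he]]] :=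
  pselect (forall e, 0 < e -> exists2 p, G p & 0 < p < e); [by left|right].
have gap p q : G p -> G q -> p < q -> e <= q - p.
  move=> Gp Gq pq; rewrite leNgt; apply/negP => h; apply: he.
  by exists (q - p); [exact: GB|rewrite subr_gt0 pq].
pose S := [set p | G p /\ 0 < p].
have infS : has_inf S by split; [exists a|exists 0 => p [_ /ltW]].
(* An element within [e] of the infimum is already the least one: a smaller positive element would
   lie at least [e] below it, hence below the infimum. *)
have [q [Gq q0] qe] := @inf_adherent _ S e e0 infS.
have qmin p : G p -> 0 < p -> q <= p.
  move=> Gp p0; rewrite leNgt; apply/negP => pq.
  have := gap _ _ Gp Gq pq; rewrite leNgt; apply/negP; rewrite negbK ltrBlDr addrC.
  by apply: lt_le_trans qe _; rewrite lerD2r; apply: ge_inf => //; exact: infS.2.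
exists q => // p Gp; exists (Num.floor (p / q)).
set k := Num.floor (p / q).
have /andP[k1 k2] := mem_rg1_floor (p / q).
have r0 : 0 <= p - k%:~R * q by rewrite subr_ge0 -ler_pdivlMr.
have r1 : p - k%:~R * q < q.
  by rewrite ltrBlDl -{2}[q]mul1r -mulrDl -ltr_pdivrMr// -intrD1.
apply/eqP; rewrite -subr_eq0 -[_ == 0]negbK; apply/negP => n0.
have := qmin _ (GB _ _ Gp (GM k _ Gq)).
by rewrite lt_neqAle eq_sym n0 r0 => /(_ isT); rewrite leNgt r1.
Qed.

(** A common measure of the two logarithms would give [2^m = 3^n] with positive exponents, which
    parity excludes. *)
Lemma ln2_ln3_independent p (k l : int) : 0 < p ->
  ln 2 = k%:~R * p -> ln 3 = l%:~R * p -> False.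
Proof.
move=> p0 hk hl.
have pos (c : R) (m : int) : 1 < c -> ln c = m%:~R * p -> exists2 n : nat, (0 < n)%N & m = n.
  move=> c1 E; have : 0 < m%:~R * p by rewrite -E ln_gt0.
  by rewrite pmulr_lgt0// ltr0z; case: m {E} => // n n0; exists n.
have [n n0 kn] := pos 2 k (ltr1n _ 2) hk.
have [m m0 lm] := pos 3 l (ltr1n _ 3) hl.
have E : (2 ^ m)%N = (3 ^ n)%N.
  apply/eqP; rewrite -(eqr_nat R) !natrX; apply/eqP; apply: ln_inj; rewrite ?posrE ?exprn_gt0//.
  have -> : ln ((2 : R) ^+ m) = ln 2 *+ m by apply: lnXn.
have -> : ln ((3 : R) ^+ n) = ln 3 *+ n by apply: lnXn.
rewrite hk hl kn lm -!pmulrn -[LHS]mulr_natr -[RHS]mulr_natr.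
by rewrite mulrAC [RHS]mulrAC (mulrC n%:R).
have := congr1 odd E; rewrite !oddX /= orbF orbT => /eqP m00.
by rewrite m00 in m0.
Qed.

Lemma period_intmul (f : R -> R) p (k : int) s :
  (forall s, f (s + p) = f s) -> f (s + k%:~R * p) = f s.
Proof.
move=> fp.
have fn (n : nat) t : f (t + n%:R * p) = f t.
  by elim: n t => [|n IH] t; rewrite ?mul0r ?addr0// -natr1 mulrDl mul1r addrA fp.
case: k => n; first exact: fn.
by rewrite NegzE mulrNz mulNr -[in RHS](subrK (n.+1%:R * p) s) fn.
Qed.

(** Reducing [s] modulo an arbitrarily small period brings it arbitrarily close to 0 without
    changing the value. *)
Lemma dense_periods_constant (f : R -> R) : continuous f ->
  (forall e, 0 < e -> exists2 p, (forall s, f (s + p) = f s) & 0 < p < e) ->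
  forall s, f s = f 0.
Proof.
move=> cf hp s; apply/eqP; rewrite eq_sym; apply/eqP; apply/subr0_eq/normr0_eq0/eqP.
rewrite eq_le normr_ge0 andbT; apply/ler_addgt0Pl => e e0; rewrite addr0.
have [d d0 hd] : \forall t \near 0, `|f 0 - f t| < e by have /cvgrPdist_lt := cf 0; apply.
have [p fp /andP[p0 pd]] := hp d d0.
set k := Num.floor (s / p).
have /andP[k1 k2] := mem_rg1_floor (s / p).
rewrite -(subrK (k%:~R * p) s) period_intmul//; apply/ltW/hd => /=.
have r0 : 0 <= s - k%:~R * p by rewrite subr_ge0 -ler_pdivlMr.
rewrite sub0r normrN ger0_norm//; apply: lt_trans pd.
by rewrite ltrBlDl -{2}[p]mul1r -mulrDl -ltr_pdivrMr// -intrD1.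
Qed.

Lemma periodic_bounded (f : R -> R) p : continuous f -> 0 < p ->
  (forall s, f (s + p) = f s) -> exists K, forall s, `|f s| <= K.
Proof.
move=> cf p0 fp.
have [c _ hc] : exists2 c, c \in `[0, p]%R & forall t, t \in `[0, p]%R -> `|f t| <= `|f c|.
  apply: (@EVT_max _ (fun t => `|f t|)); first exact: ltW.
  by apply: continuous_subspaceT => t; apply: cvg_norm; exact: cf.
exists `|f c| => s; set k := Num.floor (s / p).
have /andP[k1 k2] := mem_rg1_floor (s / p).
rewrite -(subrK (k%:~R * p) s) period_intmul//; apply: hc.
rewrite in_itv/= subr_ge0 -ler_pdivlMr// k1 /=; apply/ltW.
by rewrite ltrBlDl -{2}[p]mul1r -mulrDl -ltr_pdivrMr// -intrD1.
Qed.

(** For [rho > 1] the values [f (s + n * b) = rho^n * f s] would be unbounded. Applied to [b] and to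
    [- b] it forces the factor to be 1. *)
Lemma scaled_bounded_ge1 (f : R -> R) K rho b s : 0 < rho ->
  (forall s, `|f s| <= K) -> f s != 0 -> (forall s, f (s + b) = rho * f s) -> rho <= 1.
Proof.
move=> rho0 fK fs fb; rewrite leNgt; apply/negP => rho1.
have fn (n : nat) : f (s + n%:R * b) = rho ^+ n * f s.
  elim: n => [|n IH]; first by rewrite mul0r addr0 mul1r.
  by rewrite -natr1 mulrDl mul1r addrA fb IH exprS mulrA.
have fs0 : 0 < `|f s| by rewrite normr_gt0.
have lin (n : nat) : n%:R * (rho - 1) <= rho ^+ n.
  elim: n => [|n IH]; first by rewrite mul0r.
  have r1 : 1 <= rho ^+ n by rewrite exprn_ege1// ltW.
  rewrite -natr1 exprS; nra.
(* By Bernoulli's bound [n * (rho - 1) <= rho^n], this [n] pushes [rho^n * |f s|] beyond [K]. *)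
pose n := (Num.truncn (K / `|f s| / (rho - 1))).+1.
have := truncnS_gt (K / `|f s| / (rho - 1)).
rewrite -/n ltr_pdivrMr ?subr_gt0// ltr_pdivrMr// => h.
have := fK (s + n%:R * b); rewrite fn normrM (gtr0_norm (exprn_gt0 n rho0)) leNgt.
by apply/negP; rewrite negbK; apply: lt_le_trans h _; rewrite ler_pM2r.
Qed.

Lemma expi_eq1 t : expi t = 1 :> R[i] -> cos t = 1.
Proof. by move=> /(f_equal (@complex.Re R)). Qed.

Lemma expi_sub x y : expi (x - y) = expi x * conjc (expi y) :> R[i].
Proof. by rewrite expiD conjc_expi. Qed.

Lemma expi_natmul n x : expi (n%:R * x) = expi x ^+ n :> R[i].
Proof.
elim: n => [|n IH]; first by rewrite mul0r expi0.
by rewrite -natr1 mulrDl mul1r expiD IH exprSr.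
Qed.

(* With [h] a lift of the argument of [M], the functions [h (s + c) - n * h s]
   are continuous with values in [2 pi Z], hence constant. *)
Lemma lift_shift (M : R -> R[i]) h c n : continuous h ->
  (forall s, expi (h s) = M s) -> (forall s, M (s + c) = M s ^+ n) ->
  (forall s, h (s + c) - n%:R * h s = h c - n%:R * h 0) /\
  expi (h c - n%:R * h 0) = 1 :> R[i].
Proof.
move=> ch hM Mc.
have E s : expi (h (s + c) - n%:R * h s) = 1 :> R[i].
  rewrite expi_sub expi_natmul !hM Mc mulc_conjc -hM -expi_natmul normc_expi.
  by rewrite expr1n.
have := E 0; rewrite add0r => E0; split => // s.
rewrite -[in RHS](add0r c); apply: (continuous_expi_cst1 (d := fun s => h (s + c) - n%:R * h s)).
  move=> t; apply: cvgB; last by apply: cvgMr; exact: ch.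
  apply: (@continuous_comp _ _ _ (fun t => t + c) h); last exact: ch.
  by apply: cvgD; [exact: cvg_id|exact: cvg_cst].
by move=> t; exact: expi_eq1.
Qed.

Lemma square_cube_equation (M : R -> R[i]) b : ccontinuous M ->
  (forall s, normc (M s) = 1) ->
  (forall s, M (s + ln 2) = M s ^+ 2) -> (forall s, M (s + b) = M s ^+ 3) ->
  exists beta, forall s, M s = expi (beta * expR s).
Proof.
move=> cM M1 M2 M3; have [h ch hM] := lift_exists cM M1.
have [h2 e2] := lift_shift ch hM M2.
set kappa := h (ln 2) - _ in h2 e2.
(* Here [h (s + ln 2) = 2 * h s + kappa] with [kappa] a multiple of [2 pi]; adding [kappa] to the
   lift absorbs the constant and leaves a lift of [M]. *)
pose H s := h s + kappa.
have cH : continuous H by move=> s; apply: cvgD; [exact: ch|exact: cvg_cst].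
have HM s : expi (H s) = M s by rewrite expiD e2 mulr1.
have H2 s : H (s + ln 2) = 2 * H s by have := h2 s; rewrite /H; lra.
have [h3 _] := lift_shift cH HM M3.
set nu := H b - _ in h3.
(* The shifts by [ln 2] and [b] commute: computing [H (ln 2 + b)] in both orders gives
   [2 * nu = nu]. *)
have nu0 : nu = 0.
  have := h3 0; have := h3 (0 + ln 2).
  by rewrite (addrAC 0 (ln 2) b) !H2; lra.
have H3 s : H (s + b) = 3 * H s by have := h3 s; rewrite nu0; lra.
pose P s := H s * expR (- s).
have HP s : H s = P s * expR s by rewrite /P -mulrA -expRD addNr expR0 mulr1.
have cP : continuous P.
  move=> s; apply: cvgM; first exact: cH.
  apply: (@continuous_comp _ _ _ (fun t => - t) (@expR R)); last exact: continuous_expR.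
  by apply: cvgN; exact: cvg_id.
have P2 s : P (s + ln 2) = P s.
  by rewrite /P H2 opprD expRD [expR (- ln 2)]expRN lnK ?posrE//; field.
pose rho := 3 * expR (- b).
have rho0 : 0 < rho by rewrite mulr_gt0// expR_gt0.
have P3 s : P (s + b) = rho * P s by rewrite /P H3 opprD expRD /rho; ring.
have ln20 : 0 < ln 2 :> R by rewrite ln_gt0// ltr1n.
have [K PK] := periodic_bounded cP ln20 P2.
have [P0|/existsNP[s0 /eqP Ps0]] := pselect (forall s, P s = 0).
  by exists 0 => s; rewrite -HM HP P0.
have rho1 : rho = 1.
  apply/eqP; rewrite eq_le (scaled_bounded_ge1 rho0 PK Ps0 P3)/=.
  rewrite -invf_le1//.
  have P3' s : P (s + - b) = rho^-1 * P s.
    by rewrite -[in RHS](subrK b s) P3 mulKf// gt_eqF.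
  by apply: (scaled_bounded_ge1 _ PK Ps0 P3'); rewrite invr_gt0.
have P3' s : P (s + b) = P s by rewrite P3 rho1 mul1r.
have bE : b = ln 3.
  have : rho * expR b = 3 by rewrite /rho -mulrA -expRD addNr expR0 mulr1.
  by rewrite rho1 mul1r => <-; rewrite expRK.
exists (P 0) => s; rewrite -HM HP; congr (expi (_ * _)).
apply: dense_periods_constant => //.
(* The periods of [P] form a group containing [ln 2] and [ln 3], so it cannot be discrete. *)
pose G : set R := [set p | forall s, P (s + p) = P s].
have GB p q : G p -> G q -> G (p - q).
  by move=> hp hq t; rewrite -hq addrA subrK hp.
have [//|[p p0 hp]] := subgroup_dense_or_discrete ln20 (P2 : G (ln 2)) GB.
have [k hk] := hp _ P2.
have [l hl] := hp _ P3'; rewrite bE in hl.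
by have := ln2_ln3_independent p0 hk hl.
Qed.

End FunctionalEquation.

(** * Identification of the multiplier and the equivalence *)

Section Schrodinger.
Variable R : realType.
Implicit Types (T : L2 R -> L2 R) (m : R -> R[i]).

(** Every ball around [x] meets the set of equality; intersecting with the ball of radius [x] keeps
    the chosen point positive. *)
Lemma ae_eq_pos_continuous (f g : R -> R) x : 0 < x ->
  (forall y, 0 < y -> {for y, continuous f}) ->
  (forall y, 0 < y -> {for y, continuous g}) ->
  (\forall y \ae mu, 0 < y -> f y = g y) -> f x = g x.
Proof.
move=> x0 cf cg fg; apply/eqP; rewrite -subr_eq0 -normr_le0.
apply/ler_addgt0Pr => e e0; rewrite add0r.
have c : {for x, continuous (fun y => f y - g y)} by apply: cvgB; [exact: cf|exact: cg].
have [d d0 hd] : \forall y \near x, `|(f x - g x) - (f y - g y)| < e.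
  by have /cvgrPdist_lt := c; apply.
have m0 : 0 < Num.min d x by rewrite lt_min d0.
have [y [fgy]] := ae_meets_ball x m0 fg.
rewrite lt_min => /andP[yd yx].
have y0 : 0 < y by move: yx; rewrite ltr_norml => /andP[_]; lra.
by have := hd y yd; rewrite (fgy y0) subrr subr0 => /ltW.
Qed.

Lemma powR_multiplier_scale (alpha beta xi : R) : alpha != 0 ->
  expi (beta * `|2 `^ alpha^-1 * xi| `^ alpha) =
  expi (beta * `|xi| `^ alpha) * expi (beta * `|xi| `^ alpha) :> R[i].
Proof.
move=> a0; rewrite -expiD normrM (ger0_norm (powR_ge0 _ _)) powRM ?powR_ge0//.
by rewrite -powRrM mulVf// powRr1//; congr expi; ring.
Qed.

Lemma schrodinger_dilation T alpha beta : alpha != 0 ->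
  schrodinger_multiplier alpha beta T -> T \o T = dilated T (2 `^ alpha^-1).
Proof.
move=> a0 hT.
have h : multiplier_of T (fun xi => expi (beta * `|xi| `^ alpha)) by [].
have p0 : 2 `^ alpha^-1 != 0 :> R by rewrite gt_eqF// powR_gt0.
apply: multiplier_of_eq (multiplier_of_comp h h) _.
apply: multiplier_ae (multiplier_of_dilated p0 h).
by apply: aeW => xi; exact: powR_multiplier_scale.
Qed.

Lemma LUC_dilation_continuous T m : bounded_operator T -> cmeasurable m ->
  multiplier_of T m -> LUC T ->
  dilation_continuous (fun x => Re (m x)) /\ dilation_continuous (fun x => Im (m x)).
Proof.
move=> bT mm hm hL; split=> r e r1 e0;
  apply: filterS (LUC_multiplier bT mm hm hL r1 e0) => lam;
  apply: filterS => xi h /h; apply: le_trans.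
- by have := normc_Re_le (m (lam * xi) - m xi); rewrite !cE.
- by have := normc_Im_le (m (lam * xi) - m xi); rewrite !cE.
Qed.

Definition pos_ccontinuous (g : R -> R[i]) : Prop :=
  forall x, 0 < x -> {for x, continuous (fun y => Re (g y))} /\
                     {for x, continuous (fun y => Im (g y))}.

Lemma pos_ccontinuous_eq (f g : R -> R[i]) x : 0 < x -> pos_ccontinuous f -> pos_ccontinuous g ->
  (\forall y \ae mu, 0 < y -> f y = g y) -> f x = g x.
Proof.
move=> x0 cf cg fg; apply: complex_eqP.
- apply: (ae_eq_pos_continuous x0 (fun y y0 => (cf y y0).1) (fun y y0 => (cg y y0).1)).
  by apply: filterS fg => y h /h ->.
- apply: (ae_eq_pos_continuous x0 (fun y y0 => (cf y y0).2) (fun y y0 => (cg y y0).2)).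
  by apply: filterS fg => y h /h ->.
Qed.

Lemma pos_ccontinuousM (f g : R -> R[i]) : pos_ccontinuous f -> pos_ccontinuous g ->
  pos_ccontinuous (fun x => f x * g x).
Proof.
move=> cf cg x x0; have [f1 f2] := cf x x0; have [g1 g2] := cg x x0; split.
- rewrite (_ : (fun y => _) = fun y => Re (f y) * Re (g y) - Im (f y) * Im (g y)).
    by apply: cvgB; apply: cvgM.
  by apply/funext => y; rewrite !cE.
- rewrite (_ : (fun y => _) = fun y => Re (f y) * Im (g y) + Im (f y) * Re (g y)).
    by apply: cvgD; apply: cvgM.
  by apply/funext => y; rewrite !cE addrC.
Qed.

Lemma pos_ccontinuous_scale (f : R -> R[i]) c : 0 < c -> pos_ccontinuous f ->
  pos_ccontinuous (fun x => f (c * x)).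
Proof.
move=> c0 cf x x0; have [f1 f2] := cf _ (mulr_gt0 c0 x0).
have cc : {for x, continuous (fun y => c * y)} by apply: cvgMr; exact: cvg_id.
split.
- exact: (@continuous_comp _ _ _ (fun y => c * y) (fun y => Re (f y)) _ cc f1).
- exact: (@continuous_comp _ _ _ (fun y => c * y) (fun y => Im (f y)) _ cc f2).
Qed.

Lemma pos_ccontinuous_expR (f : R -> R[i]) (c : R) : pos_ccontinuous f ->
  ccontinuous (fun s => f (expR (s / c))).
Proof.
move=> cf.
have cc : continuous (fun s : R => expR (s / c)).
  move=> s; have c1 : {for s, continuous (fun s : R => s / c)} by apply: cvgMl; exact: cvg_id.
  exact: (@continuous_comp _ _ _ (fun s : R => s / c) (@expR R) _ c1 (@continuous_expR R _)).
split=> s; have [f1 f2] := cf _ (expR_gt0 (s / c)).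
- exact: (@continuous_comp _ _ _ (fun s : R => expR (s / c)) (fun y : R => Re (f y)) _ (cc s) f1).
- exact: (@continuous_comp _ _ _ (fun s : R => expR (s / c)) (fun y : R => Im (f y)) _ (cc s) f2).
Qed.

Lemma positive_multiplier_powR (g : R -> R[i]) (alpha b : R) :
  alpha != 0 -> 0 < b -> pos_ccontinuous g -> (forall x, 0 < x -> normc (g x) = 1) ->
  (forall x, 0 < x -> g (2 `^ alpha^-1 * x) = g x ^+ 2) ->
  (forall x, 0 < x -> g (b * x) = g x ^+ 3) ->
  exists beta, forall x, 0 < x -> g x = expi (beta * x `^ alpha).
Proof.
move=> a0 b0 cg g1 g2 g3.
have [|||beta hb] := @square_cube_equation R (fun s => g (expR (s / alpha)))
  (alpha * ln b) (pos_ccontinuous_expR alpha cg).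
- by move=> s; apply: g1; exact: expR_gt0.
- move=> s; rewrite mulrDl expRD mulrC -g2 ?expR_gt0//.
  by rewrite /powR gt_eqF// (mulrC alpha^-1).
- move=> s; rewrite mulrDl expRD mulrC -g3 ?expR_gt0//.
  by rewrite mulrAC divff// mul1r lnK.
exists beta => x x0; have := hb (alpha * ln x).
by rewrite mulrAC divff// mul1r lnK ?posrE// /powR gt_eqF.
Qed.

Lemma multiplier_powR T m (alpha : R) : unitary T -> semistable T -> symmetric_op T ->
  LUC T -> alpha != 0 -> cmeasurable m -> (\forall xi \ae mu, normc (m xi) = 1) ->
  multiplier_of T m -> T \o T = dilated T (2 `^ alpha^-1) ->
  exists beta, schrodinger_multiplier alpha beta T.
Proof.
move=> [bT _ _] [a [b [_ b0 _ T3]]] sT lT a0 mm m1 hm T2.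
have p0 : 0 < 2 `^ alpha^-1 :> R by rewrite powR_gt0.
have [dr di] := LUC_dilation_continuous bT mm hm lT.
have [mr mi] := mm.
have [gr [cgr hgr]] : exists g : R -> R, (forall x, 0 < x -> {for x, continuous g}) /\
    (\forall x \ae mu, 0 < x -> Re (m x) = g x).
  apply: continuous_version => //.
  by apply: filterS m1 => x <-; exact: normc_Re_le.
have [gi [cgi hgi]] : exists g : R -> R, (forall x, 0 < x -> {for x, continuous g}) /\
    (\forall x \ae mu, 0 < x -> Im (m x) = g x).
  apply: continuous_version => //.
  by apply: filterS m1 => x <-; exact: normc_Im_le.
pose g x : R[i] := gr x +i* gi x.
have cg : pos_ccontinuous g by move=> x x0; split; [exact: cgr|exact: cgi].
have hg : \forall x \ae mu, 0 < x -> m x = g x.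
  by apply: filterS2 hgr hgi => x h1 h2 x0; apply: complex_eqP; [exact: h1|exact: h2].
have g2 x : 0 < x -> g x * g x = g (2 `^ alpha^-1 * x).
  move=> x0; apply: (pos_ccontinuous_eq x0 (pos_ccontinuousM cg cg) (pos_ccontinuous_scale p0 cg)).
  have e1 := multiplier_of_comp hm hm.
  rewrite T2 in e1.
  have e2 := multiplier_of_inj e1 (multiplier_of_dilated (lt0r_neq0 p0) hm).
  have e3 := ae_affine 0 (lt0r_neq0 p0) hg.
  apply: filterS3 e2 e3 hg => y e2 e3 e4 y0; rewrite addr0 in e3.
  by rewrite -e4// e2 e3// mulr_gt0.
have g3 x : 0 < x -> g x * g x * g x = g (b * x).
  move=> x0; apply: (pos_ccontinuous_eq x0 (pos_ccontinuousM (pos_ccontinuousM cg cg) cg)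
    (pos_ccontinuous_scale b0 cg)).
  have e1 := multiplier_of_comp (multiplier_of_comp hm hm) hm.
  rewrite T3 in e1.
  have e2 := multiplier_of_inj e1 (multiplier_of_dilated (lt0r_neq0 b0) hm).
  have e3 := ae_affine 0 (lt0r_neq0 b0) hg.
  apply: filterS3 e2 e3 hg => y e2 e3 e4 y0; rewrite addr0 in e3.
  by rewrite -e4// e2 e3// mulr_gt0.
(* The modulus of [m] passes to [g] by continuity; the squared modulus is used because it is
   polynomial in the two components. *)
have g1 x : 0 < x -> normc (g x) = 1.
  move=> x0.
  have : Re (g x) ^+ 2 + Im (g x) ^+ 2 = 1.
    apply: (@ae_eq_pos_continuous (fun y => Re (g y) ^+ 2 + Im (g y) ^+ 2) (cst 1) x x0).
    - by move=> y y0; have [c1 c2] := cg y y0; apply: cvgD; apply: cvgM.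
    - by move=> y y0; exact: cvg_cst.
    - by apply: filterS2 hg m1 => y h h1 y0; rewrite -h// -normc2E h1 expr1n.
  rewrite -normc2E => /eqP; rewrite -[X in _ == X](expr1n _ 2) eqrXn2 ?normc_ge0//.
  by move/eqP.
have [beta hb] : exists beta, forall x, 0 < x -> g x = expi (beta * x `^ alpha).
  apply: (positive_multiplier_powR a0 b0 cg g1) => x x0; first by rewrite -g2.
  by rewrite -g3// exprSr expr2.
exists beta.
(* Symmetry says [m (- xi) = m xi] a.e., which carries the formula to the negative half line; the
   origin is discarded as a null set. *)
have hm' : \forall xi \ae mu, m xi = expi (beta * `|xi| `^ alpha).
  have N1 := oppr1_neq0 R.
  have s1 := multiplier_of_dilated N1 hm; rewrite sT in s1.
  have s2 := multiplier_of_inj hm s1.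
  have h' := ae_affine 0 N1 hg.
  have n0 : \forall xi \ae mu, xi != 0 :> R.
    exists [set 0]; split => //; first exact: lebesgue_measure_set1.
    by move=> x /= /negP; rewrite negbK => /eqP.
  apply: filterS3 (filterI s2 h') hg n0 => xi [e1 e2] e3 x0.
  rewrite addr0 mulN1r in e2; rewrite mulN1r in e1.
  have [xp|xn] := ltP 0 xi; first by rewrite e3// gtr0_norm// hb.
  have xn' : 0 < - xi by rewrite oppr_gt0 lt_neqAle x0.
  by rewrite e1 e2// ler0_norm// hb.
exact: (multiplier_ae hm' hm).
Qed.

End Schrodinger.

Theorem corollary1p1 (R : realType) (T : L2 R -> L2 R) (alpha : R) :
  unitary T -> T <> idfun ->
  semistable T -> translation_invariant T -> symmetric_op T -> LUC T ->
  alpha != 0 ->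
  (schrodinger_of_order T alpha <-> T \o T = dilated T (2 `^ alpha^-1)).
Proof.
move=> uT Tid ssT tT sT lT a0.
(* Since [T] is not the identity, its order is the exponent itself. *)
have ordE (s : R) : (if `[< T = idfun >] then 0 else s) = s.
  by case: ifPn => // /asboolP.
split.
  move=> [_ [alpha' [beta [a'0 hT]]]]; rewrite ordE => ->.
  exact: schrodinger_dilation hT.
move=> T2; have [m [mm m1 hm]] := multiplier_exists uT tT.
have [beta hb] := multiplier_powR uT ssT sT lT a0 mm m1 hm T2.
by split => //; exists alpha, beta; rewrite ordE.
Qed.
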